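(* Let $0<r_1<r_2$, let $\Omega\subset\mathbb{R}^2$ be the annulus $r_1<r<r_2$, with $\Gamma_1,\Gamma_2$, the states $u,u_\alpha$, the cost functionals $J_i,J_{i\alpha}$ ($i=1,\dots,4$) and the constants $E_i,E_{i\alpha}$ ($i=1,\dots,6$) as defined in the context. Let $z_d\in\mathbb{R}$, $M_1,\dots,M_5>0$ and $\alpha>0$; the data among $g,q,b\in\mathbb{R}$ that are not controls are fixed. i) (Control $g$; $q,b$ fixed.) The minimizer of $J_1$ over $\mathbb{R}$ and the optimal value are $$g_{op}=-\frac{E_4 q r_1+E_5 (b-z_d)}{2 r_1^2 \left(E_1+E_3\frac{ M_1}{r_1^4}\right)},$$ $$J_1(g_{op})=\frac{\pi r_1^2}{4 \left(E_1+E_3\frac{ M_1}{r_1^4}\right)}\Big[4 \left(E_1+E_3\tfrac{ M_1}{r_1^4}\right) \left(E_2 q^2 r_1^2+ E_3 (b-z_d)^2+E_6 q r_1 (b-z_d)\right)-\left(E_4 q r_1+E_5 (b-z_d)\right)^2\Big].$$ The minimizer $g_{\alpha_{op}}$ of $J_{1\alpha}$ and the value $J_{1\alpha}(g_{\alpha_{op}})$ are given by the same expressions with every $E_i$ replaced by $E_{i\alpha}$. ii) (Control $q$; $g,b$ fixed.) The minimizer of $J_2$ over $\mathbb{R}$ and the optimal value are $$q_{op}=-\frac{E_4 g r_1^2+ E_6 (b-z_d)}{2 r_1 \left(E_2+\frac{M_2 r_2}{r_1^4}\right)},$$ $$J_2(q_{op})=\frac{\pi r_1^2}{4 \left(E_2+\frac{M_2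 r_2}{ r_1^4}\right)}\Big[4 \left(E_2+\tfrac{M_2 r_2}{ r_1^4}\right) \left(E_1 g^2 r_1^4+E_3 (b-z_d)^2+E_5 g r_1^2 (b-z_d)\right)-\left(E_4 g r_1^2+E_6 (b-z_d)\right)^2\Big].$$ The minimizer $q_{\alpha_{op}}$ of $J_{2\alpha}$ and the value $J_{2\alpha}(q_{\alpha_{op}})$ are given by the same expressions with every $E_i$ replaced by $E_{i\alpha}$. iii) (Control $b$; $g,q$ fixed.) The minimizer of $J_3$ over $\mathbb{R}$ and the optimal value are $$b_{op}=-\frac{E_5 g r_1^2+E_6 q r_1-2 E_3 z_d}{2 \left(E_3+\frac{M_3}{r_1}\right)},$$ $$J_3(b_{op})=\frac{\pi r_1^2}{4 \left(E_3+\frac{M_3}{r_1}\right)} \Big[4 \left(E_3+\tfrac{M_3}{r_1}\right) \left(E_1 g^2 r_1^4+E_2 q^2 r_1^2+E_3 z_d^2+E_4 g q r_1^3-E_5 g r_1^2 z_d-E_6 q r_1 z_d\right)-\left(-2 E_3 z_d+E_5 g r_1^2+E_6 q r_1\right)^2\Big].$$ The minimizer $b_{\alpha_{op}}$ of $J_{3\alpha}$ and the value $J_{3\alpha}(b_{\alpha_{op}})$ are given by the same expressions with every $E_i$ replaced by $E_{i\alpha}$. iv) (Control $(g,q)$; $b$ fixed.) The minimizer of $J_4$ over $\mathbb{R}\times\mathbb{R}$ is $$(g,q)_{op}=(g^{op},q^{op})=\left(\frac{b-z_d}{r_1^2} \Delta_2,\ \frac{b-z_d}{r_1}\Pi_2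 \right),$$ $$\Delta_2=\frac{E_4 E_6-2 E_5 \left(E_2+\frac{M_5 r_2}{r_1^4}\right)}{4 \left(E_1+E_3\frac{ M_4}{r_1^4}\right) \left(E_2+\frac{M_5 r_2}{r_1^4}\right)-E_4^2},\qquad \Pi_2=\frac{E_4 E_5-2 E_6 \left(E_1+E_3\frac{ M_4}{r_1^4}\right)}{ 4 \left(E_1+E_3\frac{ M_4}{r_1^4}\right) \left(E_2+\frac{M_5 r_2}{r_1^4}\right)-E_4^2},$$ and $$J_4(g^{op},q^{op})=\frac{\pi r_1^2 (b-z_d)^2}{4 \left(E_1+E_3\frac{ M_4}{r_1^4}\right) \left(E_2+\frac{M_5 r_2}{r_1^4}\right)-E_4^2} \Big[4 E_3 \left(E_1+E_3\tfrac{ M_4}{r_1^4}\right) \left(E_2+\tfrac{M_5 r_2}{r_1^4}\right)-E_6^2 \left(E_1+E_3\tfrac{ M_4}{r_1^4}\right)-E_5^2 \left(E_2+\tfrac{M_5 r_2}{r_1^4}\right)-E_3 E_4^2+E_4 E_5 E_6\Big].$$ The minimizer $(g,q)_{\alpha_{op}}=(g_\alpha^{op},q_\alpha^{op})$ of $J_{4\alpha}$ and the value $J_{4\alpha}(g_\alpha^{op},q_\alpha^{op})$ are given by the same expressions with every $E_i$ replaced by $E_{i\alpha}$. v) As $\alpha\to\infty$ (all other data fixed): $g_{\alpha_{op}}\to g_{op}$, $q_{\alpha_{op}}\to q_{op}$, $b_{\alpha_{op}}\to b_{op}$, $(g_\alpha^{op},q_\alpha^{op})\to(g^{op},q^{op})$,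 and $|g_{\alpha_{op}}-g_{op}|$, $|q_{\alpha_{op}}-q_{op}|$, $|b_{\alpha_{op}}-b_{op}|$, $|g_\alpha^{op}-g^{op}|$, $|q_\alpha^{op}-q^{op}|$ are all $\mathcal{O}(1/\alpha)$. Moreover $J_{1\alpha}(g_{\alpha_{op}})\to J_1(g_{op})$, $J_{2\alpha}(q_{\alpha_{op}})\to J_2(q_{op})$, $J_{3\alpha}(b_{\alpha_{op}})\to J_3(b_{op})$, $J_{4\alpha}((g,q)_{\alpha_{op}})\to J_4((g,q)_{op})$, and in each of the four cases the absolute value of the difference is $\mathcal{O}(1/\alpha)$.
   Context: Domain (polar coordinates): $\Omega=\{(r,\theta): r_1<r<r_2,\ 0\le\theta<2\pi\}\subset\mathbb{R}^2$, $\Gamma_1=\{r=r_1\}$, $\Gamma_2=\{r=r_2\}$. $\partial/\partial n$ is the outward normal derivative. States: for real constants $g,q,b$ and $\alpha>0$, $u$ is the unique (variational, $H^1(\Omega)$) solution of $$-\Delta u=g\ \text{in }\Omega,\quad u|_{\Gamma_1}=b,\quad -\tfrac{\partial u}{\partial n}|_{\Gamma_2}=q,$$ and $u_\alpha$ is the unique (variational) solution of $$-\Delta u_\alpha=g\ \text{in }\Omega,\quad -\tfrac{\partial u_\alpha}{\partial n}|_{\Gamma_1}=\alpha(u_\alpha-b),\quad -\tfrac{\partial u_\alpha}{\partial n}|_{\Gamma_2}=q.$$ Cost functionals, with $H=L^2(\Omega)$, $Q=L^2(\Gamma_2)$, $B=L^2(\Gamma_1)$ and real numbers identified with constant functions: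 $J_1(g)=\frac12\|u-z_d\|_H^2+\frac{M_1}{2}\|g\|_H^2$ (as a function of $g\in\mathbb{R}$, with $q,b$ fixed); $J_2(q)=\frac12\|u-z_d\|_H^2+\frac{M_2}{2}\|q\|_Q^2$ (function of $q\in\mathbb{R}$, $g,b$ fixed); $J_3(b)=\frac12\|u-z_d\|_H^2+\frac{M_3}{2}\|b\|_B^2$ (function of $b\in\mathbb{R}$, $g,q$ fixed); $J_4(g,q)=\frac12\|u-z_d\|_H^2+\frac{M_4}{2}\|g\|_H^2+\frac{M_5}{2}\|q\|_Q^2$ (function of $(g,q)\in\mathbb{R}^2$, $b$ fixed). $J_{1\alpha},\dots,J_{4\alpha}$ are defined in the same way with $u$ replaced by $u_\alpha$. Constants. Write $\rho=r_2/r_1$, $L=\log(r_2/r_1)$, $\varepsilon=\frac{1}{\alpha r_1}$. $E_1=\frac18\big[-\frac1{12}+\frac58\rho^2+\rho^4(L-\frac54)+\rho^6(L^2-\frac32L+\frac{17}{24})\big]$, $E_2=\frac14\big[-\rho^2+\rho^4(2L^2-2L+1)\big]$, $E_3=\frac12(-1+\rho^2)$, $E_4=\frac14\big[-\frac38\rho+\rho^3(\frac32-L)+\rho^5(-2L^2+\frac52L-\frac98)\big]$, $E_5=\frac12\big[-\frac14+\rho^2+\rho^4(L-\frac34)\big]$, $E_6=-\big[\frac12\rho+\rho^3(L-\frac12)\big]$; $E_{1\alpha}=\frac18\big[-\frac1{12}+\frac{\varepsilon}{2}-\varepsilon^2+\rho^2(\frac58-\frac52\varepsilon+3\varepsilon^2)+\rho^4(L-\frac54+\varepsilon(\frac72-2L)-3\varepsilon^2)+\rho^6(L^2-\frac32L+\frac{17}{24}-\frac32\varepsilon+2\varepsilon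 L+\varepsilon^2)\big]$, $E_{2\alpha}=\frac14\big[-\rho^2(1+2\varepsilon^2-2\varepsilon)+\rho^4(2L^2-2L+1+2\varepsilon^2+\varepsilon(4L-2))\big]$, $E_{3\alpha}=E_3$, $E_{4\alpha}=\frac14\big[\rho(-\frac38+\frac32\varepsilon-2\varepsilon^2)+\rho^3(\frac32-L+\varepsilon(2L-4)+4\varepsilon^2)+\rho^5(-2L^2+\frac52L-\frac98-4\varepsilon L+\frac52\varepsilon-2\varepsilon^2)\big]$, $E_{5\alpha}=\frac12\big[-\frac14+\varepsilon+\rho^2(1-2\varepsilon)+\rho^4(L-\frac34+\varepsilon)\big]$, $E_{6\alpha}=-\big[\rho(\frac12-\varepsilon)+\rho^3(L-\frac12+\varepsilon)\big]$. *)

(* Defs.v *)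
From HB Require Import structures.
From mathcomp Require Import all_boot all_order all_algebra.
From mathcomp Require Import all_classical all_reals all_analysis.

Set Implicit Arguments.
Unset Strict Implicit.
Unset Printing Implicit Defensive.

Import Order.TTheory GRing.Theory Num.Theory.
Import numFieldNormedType.Exports.

Local Open Scope classical_set_scope.
Local Open Scope ring_scope.

Section Plane.
Variable R : realType.

Definition radius (x : R * R) : R := Num.sqrt (x.1 ^+ 2 + x.2 ^+ 2).

Definition annulus (r1 r2 : R) : set (R * R) :=
  [set x | r1 < radius x < r2].

Definition leb2 := (@lebesgue_measure R \x @lebesgue_measure R)%E.

Definition circ (r t : R) : R * R := (r * cos t, r * sin t).

Definition angles : set R := `[0, 2 * pi[%classic.

(* integral over the circle of radius r against arc length, ds = r dt *)
Definition circle_int (r : R) (w : R * R -> R) : R :=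
  r * \int[@lebesgue_measure R]_(t in angles) w (circ r t).

Definition dot (x y : R * R) : R := x.1 * y.1 + x.2 * y.2.

Definition grad (f : R * R -> R) (x : R * R) : R * R :=
  ('D_((1, 0) : R * R) f x, 'D_((0, 1) : R * R) f x).

(* f is of class C^k on the open set U *)
Fixpoint Ck_on (U : set (R * R)) (k : nat) (f : R * R -> R) : Prop :=
  (forall x, U x -> {for x, continuous f}) /\
  if k is k'.+1 then
    [/\ forall x, U x -> derivable f x (1, 0) /\ derivable f x (0, 1),
        Ck_on U k' ('D_((1, 0) : R * R) f) &
        Ck_on U k' ('D_((0, 1) : R * R) f)]
  else True.

Definition test_function (Om : set (R * R)) (phi : R * R -> R) : Prop :=
  [/\ forall k, Ck_on setT k phi,
      compact (closure [set x | phi x != 0]) &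
      closure [set x | phi x != 0] `<=` Om].

Definition C1_closure (Om : set (R * R)) (phi : R * R -> R) : Prop :=
  exists U : set (R * R), [/\ open U, closure Om `<=` U & Ck_on U 1 phi].

Definition square_integrable d (T : measurableType d)
    (mu : {measure set T -> \bar R}) (D : set T) (f : T -> R) : Prop :=
  measurable_fun D f /\ mu.-integrable D (fun x => (f x ^+ 2)%:E).

Definition L2_dom (Om : set (R * R)) (f : R * R -> R) : Prop :=
  square_integrable leb2 Om f.

Definition L2_circle (r : R) (w : R * R -> R) : Prop :=
  square_integrable (@lebesgue_measure R) angles (w \o circ r).

Definition weak_gradient (Om : set (R * R)) (u : R * R -> R)
    (G : R * R -> R * R) : Prop :=
  forall phi, test_function Om phi ->
    (\int[leb2]_(x in Om) (u x * (grad phi x).1)) =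
      - (\int[leb2]_(x in Om) ((G x).1 * phi x)) /\
    (\int[leb2]_(x in Om) (u x * (grad phi x).2)) =
      - (\int[leb2]_(x in Om) ((G x).2 * phi x)).

(* w is the trace on both boundary circles of u, whose gradient is G: the
   common limit in H^1 x L^2(boundary) of C^1 functions up to the boundary and
   of their restrictions.  The integrals are taken in the extended reals so
   that a divergent one is not read as 0. *)
Definition trace_of (r1 r2 : R) (u : R * R -> R) (G : R * R -> R * R)
    (w : R * R -> R) : Prop :=
  exists phi : nat -> R * R -> R,
  [/\ forall n, C1_closure (annulus r1 r2) (phi n),
      (\int[leb2]_(x in annulus r1 r2) ((phi n x - u x) ^+ 2)%:E)%E
        @[n --> \oo] --> 0%E,
      (\int[leb2]_(x in annulus r1 r2)
          (dot (grad (phi n) x - G x) (grad (phi n) x - G x))%:E)%E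
        @[n --> \oo] --> 0%E &
      forall r, r = r1 \/ r = r2 ->
        (\int[lebesgue_measure]_(t in angles)
            ((phi n (circ r t) - w (circ r t)) ^+ 2)%:E)%E
          @[n --> \oo] --> 0%E].

(* u is in H^1 of the annulus, with weak gradient G and boundary trace w *)
Definition H1 (r1 r2 : R) (u : R * R -> R) (G : R * R -> R * R)
    (w : R * R -> R) : Prop :=
  let Om := annulus r1 r2 in
  [/\ L2_dom Om u,
      L2_dom Om (fst \o G) /\ L2_dom Om (snd \o G),
      weak_gradient Om u G,
      L2_circle r1 w /\ L2_circle r2 w &
      trace_of r1 r2 u G w].

Definition ae_on_circle (r c : R) (w : R * R -> R) : Prop :=
  {ae @lebesgue_measure R, forall t, angles t -> w (circ r t) = c}.

(* - Lap u = g, u = b on the inner circle, - du/dn = q on the outer one *)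
Definition is_state (r1 r2 g q b : R) (u : R * R -> R) : Prop :=
  exists G w, [/\ H1 r1 r2 u G w,
    ae_on_circle r1 b w &
    forall v Gv wv, H1 r1 r2 v Gv wv -> ae_on_circle r1 0 wv ->
      (\int[leb2]_(x in annulus r1 r2) dot (G x) (Gv x)) =
      (\int[leb2]_(x in annulus r1 r2) (g * v x))
      - circle_int r2 (fun x => q * wv x)].

(* - Lap u = g, - du/dn = alpha (u - b) on the inner circle,
   - du/dn = q on the outer one *)
Definition is_state_alpha (r1 r2 alpha g q b : R) (u : R * R -> R) : Prop :=
  exists G w, H1 r1 r2 u G w /\
    forall v Gv wv, H1 r1 r2 v Gv wv ->
      (\int[leb2]_(x in annulus r1 r2) dot (G x) (Gv x))
      + alpha * circle_int r1 (fun x => w x * wv x) =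
      (\int[leb2]_(x in annulus r1 r2) (g * v x))
      - circle_int r2 (fun x => q * wv x)
      + alpha * circle_int r1 (fun x => b * wv x).

(* The states are unique up to a null set; the default value is only there to
   make the choice total. *)
Definition state (r1 r2 g q b : R) : R * R -> R :=
  xget (fun=> 0) [set u | is_state r1 r2 g q b u].

Definition state_alpha (r1 r2 alpha g q b : R) : R * R -> R :=
  xget (fun=> 0) [set u | is_state_alpha r1 r2 alpha g q b u].

Definition sqnormH (r1 r2 : R) (f : R * R -> R) : R :=
  \int[leb2]_(x in annulus r1 r2) (f x ^+ 2).

(* squared norm of L^2 of the circle of radius r *)
Definition sqnormC (r : R) (f : R * R -> R) : R :=
  circle_int r (fun x => f x ^+ 2).

(* S maps the data (g, q, b) to the corresponding state *)
Section Costs.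
Variables (S : R -> R -> R -> R * R -> R) (r1 r2 zd : R).

Definition cost1 (M1 q b g : R) : R :=
  1 / 2 * sqnormH r1 r2 (fun x => S g q b x - zd)
  + M1 / 2 * sqnormH r1 r2 (fun=> g).

Definition cost2 (M2 g b q : R) : R :=
  1 / 2 * sqnormH r1 r2 (fun x => S g q b x - zd)
  + M2 / 2 * sqnormC r2 (fun=> q).

Definition cost3 (M3 g q b : R) : R :=
  1 / 2 * sqnormH r1 r2 (fun x => S g q b x - zd)
  + M3 / 2 * sqnormC r1 (fun=> b).

Definition cost4 (M4 M5 b : R) (gq : R * R) : R :=
  1 / 2 * sqnormH r1 r2 (fun x => S gq.1 gq.2 b x - zd)
  + M4 / 2 * sqnormH r1 r2 (fun=> gq.1)
  + M5 / 2 * sqnormC r2 (fun=> gq.2).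

End Costs.

Definition unique_minimizer (T : Type) (J : T -> R) (x : T) : Prop :=
  forall y, y <> x -> J x < J y.

Definition at_infty : filter_on R :=
  FilterType (pinfty_nbhs R) _.

Record coeffs : Type :=
  Coeffs { E1 : R; E2 : R; E3 : R; E4 : R; E5 : R; E6 : R }.

Definition coeffs_dir (r1 r2 : R) : coeffs :=
  let rho := r2 / r1 in
  let L := ln (r2 / r1) in
  {| E1 := 1 / 8 * (- (1 / 12) + 5 / 8 * rho ^+ 2
             + rho ^+ 4 * (L - 5 / 4)
             + rho ^+ 6 * (L ^+ 2 - 3 / 2 * L + 17 / 24));
     E2 := 1 / 4 * (- rho ^+ 2 + rho ^+ 4 * (2 * L ^+ 2 - 2 * L + 1));
     E3 := 1 / 2 * (- 1 + rho ^+ 2);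
     E4 := 1 / 4 * (- (3 / 8) * rho + rho ^+ 3 * (3 / 2 - L)
             + rho ^+ 5 * (- 2 * L ^+ 2 + 5 / 2 * L - 9 / 8));
     E5 := 1 / 2 * (- (1 / 4) + rho ^+ 2 + rho ^+ 4 * (L - 3 / 4));
     E6 := - (1 / 2 * rho + rho ^+ 3 * (L - 1 / 2)) |}.

Definition coeffs_rob (r1 r2 alpha : R) : coeffs :=
  let rho := r2 / r1 in
  let L := ln (r2 / r1) in
  let eps := 1 / (alpha * r1) in
  {| E1 := 1 / 8 * (- (1 / 12) + eps / 2 - eps ^+ 2
             + rho ^+ 2 * (5 / 8 - 5 / 2 * eps + 3 * eps ^+ 2)
             + rho ^+ 4 * (L - 5 / 4 + eps * (7 / 2 - 2 * L) - 3 * eps ^+ 2)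
             + rho ^+ 6 * (L ^+ 2 - 3 / 2 * L + 17 / 24 - 3 / 2 * eps
                           + 2 * eps * L + eps ^+ 2));
     E2 := 1 / 4 * (- rho ^+ 2 * (1 + 2 * eps ^+ 2 - 2 * eps)
             + rho ^+ 4 * (2 * L ^+ 2 - 2 * L + 1 + 2 * eps ^+ 2
                           + eps * (4 * L - 2)));
     E3 := 1 / 2 * (- 1 + rho ^+ 2);
     E4 := 1 / 4 * (rho * (- (3 / 8) + 3 / 2 * eps - 2 * eps ^+ 2)
             + rho ^+ 3 * (3 / 2 - L + eps * (2 * L - 4) + 4 * eps ^+ 2)
             + rho ^+ 5 * (- 2 * L ^+ 2 + 5 / 2 * L - 9 / 8 - 4 * eps * L
                           + 5 / 2 * eps - 2 * eps ^+ 2));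
     E5 := 1 / 2 * (- (1 / 4) + eps + rho ^+ 2 * (1 - 2 * eps)
             + rho ^+ 4 * (L - 3 / 4 + eps));
     E6 := - (rho * (1 / 2 - eps) + rho ^+ 3 * (L - 1 / 2 + eps)) |}.

Section Optima.
Variables (c : coeffs) (r1 r2 zd : R).
Let e1 := E1 c. Let e2 := E2 c. Let e3 := E3 c.
Let e4 := E4 c. Let e5 := E5 c. Let e6 := E6 c.

Definition g_op (M1 q b : R) : R :=
  - ((e4 * q * r1 + e5 * (b - zd)) /
     (2 * r1 ^+ 2 * (e1 + e3 * (M1 / r1 ^+ 4)))).

Definition J1_op (M1 q b : R) : R :=
  pi * r1 ^+ 2 / (4 * (e1 + e3 * (M1 / r1 ^+ 4))) *
  (4 * (e1 + e3 * (M1 / r1 ^+ 4)) *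
     (e2 * q ^+ 2 * r1 ^+ 2 + e3 * (b - zd) ^+ 2 + e6 * q * r1 * (b - zd))
   - (e4 * q * r1 + e5 * (b - zd)) ^+ 2).

Definition q_op (M2 g b : R) : R :=
  - ((e4 * g * r1 ^+ 2 + e6 * (b - zd)) /
     (2 * r1 * (e2 + M2 * r2 / r1 ^+ 4))).

Definition J2_op (M2 g b : R) : R :=
  pi * r1 ^+ 2 / (4 * (e2 + M2 * r2 / r1 ^+ 4)) *
  (4 * (e2 + M2 * r2 / r1 ^+ 4) *
     (e1 * g ^+ 2 * r1 ^+ 4 + e3 * (b - zd) ^+ 2
      + e5 * g * r1 ^+ 2 * (b - zd))
   - (e4 * g * r1 ^+ 2 + e6 * (b - zd)) ^+ 2).

Definition b_op (M3 g q : R) : R :=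
  - ((e5 * g * r1 ^+ 2 + e6 * q * r1 - 2 * e3 * zd) /
     (2 * (e3 + M3 / r1))).

Definition J3_op (M3 g q : R) : R :=
  pi * r1 ^+ 2 / (4 * (e3 + M3 / r1)) *
  (4 * (e3 + M3 / r1) *
     (e1 * g ^+ 2 * r1 ^+ 4 + e2 * q ^+ 2 * r1 ^+ 2 + e3 * zd ^+ 2
      + e4 * g * q * r1 ^+ 3 - e5 * g * r1 ^+ 2 * zd - e6 * q * r1 * zd)
   - (- 2 * e3 * zd + e5 * g * r1 ^+ 2 + e6 * q * r1) ^+ 2).

Definition den4 (M4 M5 : R) : R :=
  4 * (e1 + e3 * (M4 / r1 ^+ 4)) * (e2 + M5 * r2 / r1 ^+ 4) - e4 ^+ 2.

Definition Delta2 (M4 M5 : R) : R :=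
  (e4 * e6 - 2 * e5 * (e2 + M5 * r2 / r1 ^+ 4)) / den4 M4 M5.

Definition Pi2 (M4 M5 : R) : R :=
  (e4 * e5 - 2 * e6 * (e1 + e3 * (M4 / r1 ^+ 4))) / den4 M4 M5.

Definition gq_op (M4 M5 b : R) : R * R :=
  ((b - zd) / r1 ^+ 2 * Delta2 M4 M5, (b - zd) / r1 * Pi2 M4 M5).

Definition J4_op (M4 M5 b : R) : R :=
  pi * r1 ^+ 2 * (b - zd) ^+ 2 / den4 M4 M5 *
  (4 * e3 * (e1 + e3 * (M4 / r1 ^+ 4)) * (e2 + M5 * r2 / r1 ^+ 4)
   - e6 ^+ 2 * (e1 + e3 * (M4 / r1 ^+ 4))
   - e5 ^+ 2 * (e2 + M5 * r2 / r1 ^+ 4)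
   - e3 * e4 ^+ 2 + e4 * e5 * e6).

End Optima.
End Plane.

(* Main.v *)
Require Import Defs.
From HB Require Import structures.
From mathcomp Require Import all_boot all_order all_algebra.
From mathcomp Require Import all_classical all_reals all_analysis.
From mathcomp Require Import measurable_realfun ring lra.

Set Implicit Arguments.
Unset Strict Implicit.
Unset Printing Implicit Defensive.

Import Order.TTheory GRing.Theory Num.Theory.
Import numFieldNormedType.Exports.

Local Open Scope classical_set_scope.
Local Open Scope ring_scope.

(** The equations on the annulus have constant data, so their solutions are
explicit radial functions. With k1 = - g/2 and k2 = g r2^2/2 - q r2, the function
    u = c0 + k1/2 |x|^2 + k2/2 ln |x|^2
satisfies - Lap u = g and - du/dn = q on the outer circle, and the constant c0
adjusts its value on the inner circle: b in the Dirichlet problem, and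
b + (k1 r1 + k2/r1) / alpha in the Robin problem ([boundary_state],
[robin_value]).

The states are defined variationally, so two things have to be proved about this
function: that it solves the weak problem, and that solutions are unique up to a
null set. Both rest on one identity, [radial_divergence]: for psi of class C^1 up
to the boundary, the integral of (a + c/|x|^2) x . grad psi + 2 a psi is a
difference of integrals of psi over the two circles. In polar coordinates it is
the fundamental theorem of calculus on each ray. Polar coordinates are themselves
obtained by one-dimensional substitutions ([right_half_plane_polar]), each of
which follows from the uniqueness of Lebesgue measure ([ge0_substitution]).

Taking a = k1 and c = k2 gives Green's formula for the radial function against
C^1 functions; the trace being a limit of such functions, the formula extends to
H1 ([green_H1]), so that the explicit functions are solutions
([is_state_boundary], [is_state_alpha_boundary]). Taking psi = phi^2, a = 1/2 and
c = - r2^2/2 cancels the outer boundary term and gives a Poincare inequality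
([poincare_C1]), whence uniqueness ([H1_null], [is_state_unique],
[is_state_alpha_unique]). The costs can therefore be computed with the explicit
functions.

Integrating (u - zd)^2 r over a ray gives
    ||u - zd||^2 = 2 pi r1^2 Q (g, q, b - zd),
where Q is the quadratic form with coefficients E_1, ..., E_6
([tracking_dir], [tracking_rob]). Since the left-hand side is a squared norm, Q is
nonnegative; hence E_1, E_2 >= 0 and E_4^2 <= 4 E_1 E_2, and adding the penalties
makes all the denominators positive. The optimal controls and values then come
from completing the square.

Finally, the Robin coefficients are quadratic polynomials in
eps = 1/(alpha r1) whose constant terms are the Dirichlet coefficients. The
functions at distance O(1/alpha) of their limits are stable under the field
operations ([O_inv]), so each optimal quantity, a rational expression in the
E_i whose denominator has a positive limit, converges at that rate. *)

(** * Change of variables on the line *)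

Section density.
Local Open Scope ereal_scope.
Context d1 d2 (X : measurableType d1) (Y : measurableType d2) (R : realType).
Variables (mu : {measure set X -> \bar R}) (D : set X) (F : X -> Y).
Variable w : X -> R.
Hypothesis mD : measurable D.
Hypothesis mF : measurable_fun setT F.
Hypothesis mw : measurable_fun D w.
Let mwE : measurable_fun D (fun x => (w x)%:E).
Proof. exact/measurable_EFinP. Qed.
Hypothesis w0 : forall x, (0 <= w x)%R.

(** The image by [F] of the measure of density [w] on [D]. *)
Definition pushdensity (A : set Y) : \bar R :=
  \int[mu]_(x in D `&` F @^-1` A) (w x)%:E.

Let mpre A : measurable A -> measurable (F @^-1` A).
Proof. by move=> mA; rewrite -(setTI (_ @^-1` _)); exact: mF. Qed.

Let pushdensity0 : pushdensity set0 = 0.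
Proof. by rewrite /pushdensity preimage_set0 setI0 integral_set0. Qed.

Let pushdensity_ge0 A : 0 <= pushdensity A.
Proof. by apply: integral_ge0 => x _; rewrite lee_fin. Qed.

Let pushdensity_sigma_additive : semi_sigma_additive pushdensity.
Proof.
move=> A mA tA mUA.
rewrite /pushdensity preimage_bigcup setI_bigcupr ge0_integral_bigcup//.
- by apply: is_cvg_nneseries => n _ _; apply: integral_ge0 => x _; rewrite lee_fin.
- by move=> k; apply: measurableI => //; exact: mpre.
- apply: measurable_funS mwE => //; rewrite -setI_bigcupr.
  exact: subIsetl.
- by move=> x _; rewrite lee_fin.
- by move=> i j _ _ [x [[_ Ai] [_ Aj]]]; apply: tA => //; exists (F x).
Qed.

HB.instance Definition _ := isMeasure.Build _ _ _ pushdensity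
  pushdensity0 pushdensity_ge0 pushdensity_sigma_additive.

Import HBNNSimple.

(** Both sides are monotone limits over simple functions, and on an indicator
the identity is the definition of the image measure. *)
Lemma ge0_integral_pushdensity (f : Y -> \bar R) :
  measurable_fun setT f -> (forall y, 0 <= f y) ->
  \int[pushdensity]_y f y = \int[mu]_(x in D) (f (F x) * (w x)%:E).
Proof.
move=> mf f0; pose h := nnsfun_approx measurableT mf.
have mhF n : measurable_fun D (fun x => (h n (F x))%:E).
  by apply/measurable_EFinP/measurable_funTS; exact: measurableT_comp.
transitivity (limn (fun n => \int[pushdensity]_y (h n y)%:E)).
  rewrite -monotone_convergence//.
  - by apply: eq_integral => y _; apply/esym/cvg_lim => //; exact: cvg_nnsfun_approx.
  - by move=> n; exact/measurable_EFinP/measurable_funP.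
  - by move=> n y _; rewrite lee_fin.
  - by move=> y _ m n mn; rewrite lee_fin; exact/lefP/nd_nnsfun_approx.
transitivity (limn (fun n => \int[mu]_(x in D) ((h n (F x))%:E * (w x)%:E))); last first.
  rewrite -monotone_convergence//.
  - apply: eq_integral => x _; apply/cvg_lim => //.
    by apply: cvgeZr => //; exact: cvg_nnsfun_approx.
  - by move=> n; apply: emeasurable_funM.
  - by move=> n x Dx; rewrite mule_ge0// lee_fin//.
  - move=> x Dx m n mn; apply: lee_wpmul2r; rewrite lee_fin//.
    exact/lefP/nd_nnsfun_approx.
apply: congr_lim; apply/funext => n.
transitivity (\sum_(y \in range (h n)) y%:E * pushdensity (h n @^-1` [set y])).
  under eq_integral do rewrite fimfunE -fsumEFin//.
  rewrite ge0_integral_fsum//; last 2 first.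
  - by move=> y; exact/measurable_EFinP/measurable_funM.
  - by move=> y x _; rewrite nnfun_muleindic_ge0.
  by apply: eq_fsbigr => r _; rewrite integralZl_indic_nnsfun// integral_indic// setIT.
under [RHS]eq_integral do
  (rewrite fimfunE -fsumEFin// ge0_mule_fsuml; last by move=> y; rewrite nnfun_muleindic_ge0).
rewrite ge0_integral_fsum//; last 2 first.
- move=> y; apply: emeasurable_funM => //; apply/measurable_EFinP.
  by apply: measurable_funM => //; apply/measurable_funTS; exact: measurableT_comp.
- by move=> y x Dx; rewrite mule_ge0 ?nnfun_muleindic_ge0 ?lee_fin.
apply: eq_fsbigr => r; rewrite inE => -[t _ <-].
under eq_integral do rewrite EFinM -muleA.
rewrite ge0_integralZl//.
- congr (_ * _); rewrite /pushdensity integral_mkcondr.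
  apply: eq_integral => x xD; rewrite muleC patchE indicE.
  rewrite (_ : (x \in F @^-1` _) = (F x \in h n @^-1` [set h n t])) ?inE//.
  by case: ifPn => _; rewrite ?mule1 ?mule0.
- apply: emeasurable_funM => //; apply/measurable_EFinP/measurable_funTS.
  by apply: measurableT_comp.
- by move=> x Dx; rewrite mule_ge0// lee_fin//.
- by rewrite lee_fin.
Qed.

End density.

Section substitution.
Local Open Scope ereal_scope.
Variable R : realType.
Notation leb := (@lebesgue_measure R).

(** Change of variables with no differentiability assumption: the hypothesis on
the half-open intervals says that the image by [F] of the measure of density [w]
gives each of them its length, and Lebesgue measure is the only such measure. *)
Lemma ge0_substitution (D : set R) (F w : R -> R) (f : R -> \bar R) :
  measurable D -> measurable_fun setT F -> measurable_fun D w ->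
  (forall x, 0 <= w x)%R ->
  (forall a b, (a < b)%R ->
    \int[leb]_(x in D `&` F @^-1` `]a, b]) (w x)%:E = (b - a)%:E) ->
  measurable_fun setT f -> (forall y, 0 <= f y) ->
  \int[leb]_y f y = \int[leb]_(x in D) (f (F x) * (w x)%:E).
Proof.
move=> mD mF mw w0 hI mf f0.
rewrite -(@ge0_integral_pushdensity _ _ _ (measurableTypeR R) _ leb)//.
apply: eq_measure_integral => A mA _; apply: lebesgue_measure_unique => // X.
move=> [[a b]] _ <- /=; rewrite /pushdensity lebesgue_measure_itv/= lte_fin.
case: ifPn => [ab|]; first by rewrite hI// EFinB.
rewrite -leNgt => ba; rewrite set_itv_ge ?bnd_simp -?leNgt//.
by rewrite preimage_set0 setI0 integral_set0.
Qed.

Lemma ge0_integral_dilation (k : R) (f : R -> \bar R) : (0 < k)%R ->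
  measurable_fun setT f -> (forall y, 0 <= f y) ->
  \int[leb]_y f y = \int[leb]_x (f (k * x)%R * k%:E).
Proof.
move=> k0 mf f0; apply: (@ge0_substitution setT ( *%R k) (fun=> k)) => //.
  by move=> x /=; rewrite ltW.
move=> a b ab; rewrite setTI integral_cst//=; last first.
  by rewrite -[X in measurable X]setTI; exact: mulrl_measurable.
rewrite (_ : _ @^-1` _ = `](a / k)%R, (b / k)%R]%classic); last first.
  apply/seteqP; split => x /=; rewrite !in_itv/= ltr_pdivrMr// ler_pdivlMr//.
    by rewrite mulrC.
  by rewrite mulrC.
rewrite lebesgue_measure_itv/= lte_fin ltr_pM2r ?invr_gt0// ab.
by rewrite -EFinB -EFinM -mulrBl mulrCA divff ?mulr1// gt_eqF.
Qed.

Lemma ge0_integral_translation (c : R) (f : R -> \bar R) :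
  measurable_fun setT f -> (forall y, 0 <= f y) ->
  \int[leb]_y f y = \int[leb]_x f (x + c)%R.
Proof.
move=> mf f0; rewrite (@ge0_substitution setT (+%R^~ c) (fun=> 1%R))//.
- by apply: eq_integral => x _; rewrite mule1.
- by apply: measurable_funD.
- move=> a b ab; rewrite setTI (_ : _ @^-1` _ = `](a - c)%R, (b - c)%R]%classic).
    rewrite integral_cst//= mul1e lebesgue_measure_itv/= lte_fin ltrD2r ab.
    by rewrite -EFinB; congr (_%:E); ring.
  by apply/seteqP; split => x /=; rewrite !in_itv/= ltrBlDr lerBrDr.
Qed.

Lemma ge0_integral_reflection (f : R -> \bar R) :
  measurable_fun setT f -> (forall y, 0 <= f y) ->
  \int[leb]_y f y = \int[leb]_x f (- x)%R.
Proof.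
move=> mf f0; rewrite (@ge0_substitution setT -%R (fun=> 1%R))//.
- by apply: eq_integral => x _; rewrite mule1.
- move=> a b ab; rewrite setTI (_ : _ @^-1` _ = `[(- b)%R, (- a)%R[%classic).
    rewrite integral_cst//= mul1e lebesgue_measure_itv/= lte_fin ltrN2 ab.
    by rewrite -EFinB; congr (_%:E); ring.
  by apply/seteqP; split => x /=; rewrite !in_itv/=; lra.
Qed.

Definition right_angles : set R := `](- (pi / 2))%R, (pi / 2)%R[%classic.

Lemma cos_gt0_right (t : R) : right_angles t -> (0 < cos t)%R.
Proof. by rewrite /right_angles/= in_itv/= => /cos_gt0_pihalf. Qed.

Lemma measurable_right_angles : measurable right_angles.
Proof. exact: measurable_itv. Qed.

Lemma measurable_cos : measurable_fun setT (@cos R).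
Proof. by apply: continuous_measurable_fun; exact: continuous_cos. Qed.

Lemma measurable_sin : measurable_fun setT (@sin R).
Proof. by apply: continuous_measurable_fun; exact: continuous_sin. Qed.

Lemma inv_measurable : measurable_fun setT (@GRing.inv R).
Proof.
rewrite -(setvU [set 0%R]); apply/measurable_funU.
- exact: measurableC.
- by [].
split; last exact: measurable_fun_set1.
apply: open_continuous_measurable_fun.
  by rewrite openC; exact: closed_eq.
by move=> x; rewrite inE/= => /eqP x0; apply: inv_continuous.
Qed.

Lemma measurable_inv_cos2 : measurable_fun setT (fun t : R => (cos t) ^- 2)%R.
Proof.
apply: (measurableT_comp inv_measurable).
by apply: measurable_funX; exact: measurable_cos.
Qed.

Lemma measurable_tan : measurable_fun setT (@tan R).
Proof.
apply: measurable_funM; first exact: measurable_sin.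
by apply: (measurableT_comp inv_measurable); exact: measurable_cos.
Qed.

(** The fundamental theorem of calculus with all hypotheses on the closed
interval, which also covers [a = b]. *)
Lemma integral_is_derive (F f : R -> R) (a b : R) : (a <= b)%R ->
  (forall x, (a <= x <= b)%R -> is_derive x 1%R F (f x)) ->
  (forall x, (a <= x <= b)%R -> {for x, continuous f}) ->
  \int[leb]_(x in `[a, b]) (f x)%:E = (F b - F a)%:E.
Proof.
rewrite le_eqVlt => /predU1P[->|ab] dF cf.
  by rewrite set_itv1 integral_set1 subrr.
have cF x : (a <= x <= b)%R -> {for x, continuous F}.
  move=> /dF [dFx _]; apply: differentiable_continuous.
  exact/derivable1_diffP.
rewrite (@continuous_FTC2 _ f F)//.
- apply: continuous_in_subspaceT => x; rewrite inE/= in_itv/=.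
  exact: cf.
- split.
  + move=> x; rewrite in_itv/= => /andP[ax xb].
    by apply: ex_derive; apply: dF; rewrite !ltW.
  + by apply: cvg_at_right_filter; apply: cF; rewrite lexx ltW.
  + by apply: cvg_at_left_filter; apply: cF; rewrite lexx ltW.
- move=> x; rewrite in_itv/= derive1E => /andP[ax xb].
  by apply: derive_val; apply: dF; rewrite !ltW.
Qed.

(** The substitution y = tan t, of density tan' = 1 / cos^2: [atan] turns the
preimage of an interval into an interval. *)
Lemma ge0_integral_tan (f : R -> \bar R) :
  measurable_fun setT f -> (forall y, 0 <= f y) ->
  \int[leb]_y f y =
  \int[leb]_(t in right_angles) (f (tan t) * ((cos t) ^- 2)%:E).
Proof.
move=> mf f0; apply: ge0_substitution => //.
- exact: measurable_right_angles.
- exact: measurable_tan.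
- by apply: measurable_funTS; exact: measurable_inv_cos2.
- by move=> x; rewrite invr_ge0 sqr_ge0.
move=> a b ab.
have -> : right_angles `&` tan @^-1` `]a, b] = `]atan a, atan b]%classic.
  have atD (x : R) : atan x \in `](- (pi / 2))%R, (pi / 2)%R[.
    by rewrite in_itv/= atan_gtNpi2 atan_ltpi2.
  have tanD (t : R) : t \in `](- (pi / 2))%R, (pi / 2)%R[ ->
      ((a < tan t <= b) = (atan a < t <= atan b))%R.
    move=> tD; rewrite -(ltr_tan (atD a) tD) atanK; congr (_ && _).
    by rewrite !leNgt -(ltr_tan (atD b) tD) atanK.
  apply/seteqP; split => t /=.
    by case=> tD; rewrite !in_itv/= tanD.
  rewrite in_itv/= => tab.
  have tD : t \in `](- (pi / 2))%R, (pi / 2)%R[.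
    have /andP[ta tb] := tab; rewrite in_itv/=.
    by rewrite (lt_trans (atan_gtNpi2 _) ta) (le_lt_trans tb (atan_ltpi2 _)).
  by rewrite in_itv/= tanD.
have atab : (atan a <= atan b)%R by apply: le_atan; exact: ltW.
have cospos t : (atan a <= t <= atan b)%R -> cos t != 0%R.
  move=> /andP[ta tb]; rewrite gt_eqF// cos_gt0_right// /right_angles/= in_itv/=.
  by rewrite (lt_le_trans (atan_gtNpi2 _) ta) (le_lt_trans tb (atan_ltpi2 _)).
rewrite integral_itv_obnd_cbnd; last first.
  by apply/measurable_EFinP/measurable_funTS; exact: measurable_inv_cos2.
rewrite -{2}(atanK b) -{2}(atanK a); apply: (@integral_is_derive tan) => //.
- by move=> x /cospos; exact: is_derive_tan.
- move=> x /cospos cx; apply: continuousV; first by rewrite expf_eq0.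
  apply: (continuous_comp (f := cos) (g := fun y => y ^+ 2)%R).
    exact: continuous_cos.
  exact: exprn_continuous.
Qed.

End substitution.

(** * Polar coordinates in the plane *)

Section polar.
Local Open Scope ereal_scope.
Variable R : realType.
Notation leb := (@lebesgue_measure R).

(** The product version, applied to the extension of [h] by 0. *)
Lemma fubini_tonelli_in d1 d2 (T1 : measurableType d1) (T2 : measurableType d2)
    (m1 : {sigma_finite_measure set T1 -> \bar R})
    (m2 : {sigma_finite_measure set T2 -> \bar R})
    (A : set T1) (B : set T2) (h : T1 * T2 -> \bar R) :
  measurable A -> measurable B -> measurable_fun (A `*` B) h ->
  (forall x y, A x -> B y -> 0 <= h (x, y)) ->
  \int[m1]_(x in A) \int[m2]_(y in B) h (x, y) =
  \int[m2]_(y in B) \int[m1]_(x in A) h (x, y).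
Proof.
move=> mA mB mh h0; pose H := h \_ (A `*` B).
have H0 z : 0 <= H z.
  rewrite /H patchE; case: ifPn => //; rewrite inE; case: z => x y [/= Ax By].
  exact: h0.
have mH : measurable_fun setT H.
  by apply/(measurable_restrictT h) => //; exact: measurableX.
have patchX x y : H (x, y) = ((fun y => h (x, y)) \_ B \_ (fun=> A x)) y.
  rewrite /H !patchE in_setX; have [xA|xA] := boolP (x \in A); rewrite /=.
    by rewrite [in RHS]mem_set//; exact: set_mem.
  by rewrite [in RHS]memNset// => /mem_set; apply/negP.
transitivity (\int[m1]_x \int[m2]_y H (x, y)).
  rewrite integral_mkcond; apply: eq_integral => x _.
  rewrite patchE; case: ifPn => xA.
    rewrite integral_mkcond; apply: eq_integral => y _.
    by rewrite /H !patchE in_setX xA.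
  rewrite integral0_eq// => y _.
  by rewrite /H patchE in_setX (negbTE xA).
rewrite (fubini_tonelli (m1 := m1) (m2 := m2) H mH H0).
rewrite [RHS]integral_mkcond; apply: eq_integral => y _.
rewrite [RHS]patchE; case: ifPn => yB.
  rewrite [RHS]integral_mkcond; apply: eq_integral => x _.
  by rewrite /H !patchE in_setX yB andbT.
rewrite integral0_eq// => x _.
by rewrite /H patchE in_setX (negbTE yB) andbF.
Qed.

Implicit Type f : R * R -> \bar R.

Lemma measurable_circ : measurable_fun setT (fun p : R * R => circ p.2 p.1).
Proof.
apply: measurable_fun_pair; apply: measurable_funM => //;
  apply: measurableT_comp => //.
- exact: measurable_cos.
- exact: measurable_sin.
Qed.

Definition rays : set R := `]0%R, +oo[%classic.

Lemma measurable_rays : measurable rays.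
Proof. exact: measurable_itv. Qed.

Definition radial_integral f (t : R) : \bar R :=
  \int[leb]_(r in rays) (f (circ r t) * r%:E).

(** For fixed x > 0 the substitutions y = x s and s = tan t turn the inner
integral into one over the angle; after exchanging the integrals, x = r cos t
at fixed t gives the density r. *)
Lemma right_half_plane_polar f :
  measurable_fun setT f -> (forall z, 0 <= f z) ->
  \int[leb]_(x in rays) \int[leb]_y f (x, y) =
  \int[leb]_(t in @right_angles R) radial_integral f t.
Proof.
move=> mf f0.
(* the integrand after y = x tan t *)
pose h (z : R * R) := f (z.1, z.1 * tan z.2)%R * (z.1 * (cos z.2) ^- 2)%:E.
transitivity (\int[leb]_(x in rays) \int[leb]_(t in @right_angles R) h (x, t)).
  apply: eq_integral => x; rewrite inE /rays/= in_itv/= andbT => x0.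
  have mfx : measurable_fun setT (fun y => f (x, y)).
    exact: (measurableT_comp mf (pair1_measurable x)).
  rewrite (ge0_integral_dilation x0)// ge0_integral_tan; last 2 first.
  - apply: emeasurable_funM => //.
    by apply: (measurableT_comp mfx); exact: mulrl_measurable.
  - by move=> y; rewrite mule_ge0// lee_fin ltW.
  by apply: eq_integral => t _; rewrite /h /= EFinM muleA.
rewrite (@fubini_tonelli_in _ _ _ _ leb leb rays (@right_angles R) h); last 4 first.
- exact: measurable_rays.
- exact: measurable_right_angles.
- apply/measurable_funTS; apply: emeasurable_funM.
    apply: (measurableT_comp mf); apply: measurable_fun_pair => //.
    apply: measurable_funM => //.
    by apply: measurableT_comp => //; exact: measurable_tan.
  apply/measurable_EFinP; apply: measurable_funM => //.
  apply: (measurableT_comp (f := fun t : R => (cos t) ^- 2)%R) => //.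
  exact: measurable_inv_cos2.
- move=> x t; rewrite /rays /= in_itv/= andbT => x0 _.
  by rewrite /h mule_ge0// lee_fin mulr_ge0 ?invr_ge0 ?sqr_ge0 ?ltW.
apply: eq_integral => t; rewrite inE => /cos_gt0_right ct.
rewrite integral_mkcond (ge0_integral_dilation ct); last 2 first.
- apply/(measurable_restrictT (fun x => h (x, t))); first exact: measurable_rays.
  apply: measurable_funTS; apply: emeasurable_funM.
    apply: (measurableT_comp mf); apply: measurable_fun_pair => /=; first exact: measurable_id.
    exact: mulrr_measurable.
  by apply/measurable_EFinP => /=; exact: mulrr_measurable.
- apply: erestrict_ge0 => x; rewrite /rays /= in_itv/= andbT => x0.
  by rewrite /h mule_ge0// lee_fin mulr_ge0 ?invr_ge0 ?sqr_ge0 ?ltW.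
rewrite /radial_integral [RHS]integral_mkcond; apply: eq_integral => r _.
rewrite !patchE !mem_setE !in_itv/= !andbT pmulr_rgt0//.
case: ifPn => r0; last by rewrite mul0e.
rewrite /h /= -muleA -EFinM; congr (f _ * _%:E).
  congr pair; first exact: mulrC.
  by rewrite /tan; field; rewrite gt_eqF.
by field; rewrite gt_eqF.
Qed.

Lemma measurable_radial_integral f :
  measurable_fun setT f -> (forall z, 0 <= f z) ->
  measurable_fun setT (radial_integral f).
Proof.
move=> mf f0.
pose H := (fun z : R * R => f (circ z.2 z.1) * z.2%:E) \_ (setT `*` rays).
have -> : radial_integral f = (fun t => \int[leb]_r H (t, r)).
  apply/funext => t; rewrite /radial_integral integral_mkcond.
  by apply: eq_integral => r _; rewrite /H !patchE in_setX in_setT.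
apply: (measurable_fun_fubini_tonelli_F (m2 := leb)).
- apply/(measurable_restrictT (fun z : R * R => f (circ z.2 z.1) * z.2%:E)).
    by apply: measurableX => //; exact: measurable_rays.
  apply/measurable_funTS; apply: emeasurable_funM.
    exact: (measurableT_comp mf measurable_circ).
  exact/measurable_EFinP.
- apply: erestrict_ge0 => -[t r] [_]; rewrite /rays/= in_itv/= andbT => r0.
  by rewrite mule_ge0// lee_fin ltW.
Qed.

Lemma radial_integral_ge0 f t : (forall z, 0 <= f z) -> 0 <= radial_integral f t.
Proof.
move=> f0; apply: integral_ge0 => r; rewrite /rays/= in_itv/= andbT => r0.
by rewrite mule_ge0// lee_fin ltW.
Qed.

Lemma ge0_integral_itv_split (h : R -> \bar R) (a b c : R) :
  (a <= b)%R -> (b <= c)%R ->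
  measurable_fun setT h -> (forall t, 0 <= h t) ->
  \int[leb]_(t in `[a, c[) h t =
  \int[leb]_(t in `[a, b[) h t + \int[leb]_(t in `[b, c[) h t.
Proof.
move=> ab bc mh h0; rewrite -ge0_integral_setU//.
- by rewrite -itv_bndbnd_setU// bnd_simp.
- exact: measurable_funTS.
- apply/disj_setPS => t [/=]; rewrite !in_itv/= => /andP[_ tb] /andP[].
  by rewrite leNgt tb.
Qed.

Lemma ge0_integral_itv_translation (h : R -> \bar R) (a b c : R) :
  measurable_fun setT h -> (forall t, 0 <= h t) ->
  \int[leb]_(t in `[a, b[) h (t + c)%R =
  \int[leb]_(t in `[(a + c)%R, (b + c)%R[) h t.
Proof.
move=> mh h0; rewrite [RHS]integral_mkcond (ge0_integral_translation c).
- rewrite [LHS]integral_mkcond; apply: eq_integral => t _.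
  by rewrite !patchE !mem_setE !in_itv/= lerD2r ltrD2r.
- by apply/(measurable_restrictT h) => //; exact: measurable_funTS.
- exact: erestrict_ge0.
Qed.

(** The right and left half planes are the angles around 0 and around pi; by
periodicity they recombine into one period, starting at 0. *)
Lemma ge0_integral_angles (h : R -> \bar R) :
  measurable_fun setT h -> (forall t, 0 <= h t) ->
  (forall t, h (t + 2 * pi)%R = h t) ->
  \int[leb]_(t in @right_angles R) h t +
  \int[leb]_(t in @right_angles R) h (t + pi)%R =
  \int[leb]_(t in @angles R) h t.
Proof.
move=> mh h0 hpi; have pi0 := @pi_gt0 R.
have mhs (c : R) : measurable_fun setT (fun t : R => h (t + c)%R).
  by apply: (measurableT_comp mh); exact: measurable_funD.
rewrite /right_angles !integral_itv_obnd_cbnd; [|exact: measurable_funTS..].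
rewrite (@ge0_integral_itv_split h _ 0%R); [|lra..|by []|by []].
under [X in X + _ + _]eq_integral do rewrite -hpi.
rewrite !ge0_integral_itv_translation//.
rewrite addeAC [in LHS]addeC /angles.
rewrite [RHS](@ge0_integral_itv_split h _ (pi / 2)%R); [|lra..|by []|by []].
rewrite [X in _ = _ + X](@ge0_integral_itv_split h _ (pi / 2 + pi)%R); [|lra..|by []|by []].
congr (_ + _); rewrite addeC add0r.
have -> : (- (pi / 2) + pi = pi / 2 :> R)%R by field.
by have -> : (- (pi / 2) + 2 * pi = pi / 2 + pi :> R)%R by field.
Qed.

Lemma ge0_integral_two_rays (F : R -> \bar R) :
  measurable_fun setT F -> (forall x, 0 <= F x) ->
  \int[leb]_x F x =
  \int[leb]_(x in rays) F x + \int[leb]_(x in rays) F (- x)%R.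
Proof.
move=> mF F0; have mrays := measurable_rays.
rewrite -(setUv rays) ge0_integral_setU//.
- congr (_ + _); rewrite /rays setCitvr.
  rewrite -integral_itv_bndo_bndc; last exact: measurable_funTS.
  rewrite [LHS]integral_mkcond ge0_integral_reflection.
  + rewrite [RHS]integral_mkcond; apply: eq_integral => x _.
    by rewrite !patchE !mem_setE !in_itv/= oppr_lt0 andbT.
  + by apply/(measurable_restrictT F) => //; exact: measurable_funTS.
  + by move=> x; apply: erestrict_ge0.
- exact: measurableC.
- by rewrite setUv.
- exact/disj_setPCl.
Qed.

(** The right half plane is [right_half_plane_polar]; the left one is the same
statement for the reflected function z |-> f (-z), whose polar angle is shifted
by pi. *)
Lemma ge0_integral_polar f :
  measurable_fun setT f -> (forall z, 0 <= f z) ->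
  \int[@leb2 R]_z f z = \int[leb]_(t in @angles R) radial_integral f t.
Proof.
move=> mf f0; rewrite (fubini_tonelli1 (m1 := leb) (m2 := leb) f mf f0).
rewrite /fubini_F.
pose F x := \int[leb]_y f (x, y).
have mF : measurable_fun setT F by exact: (measurable_fun_fubini_tonelli_F (m2 := leb)).
have F0 x : 0 <= F x by exact: integral_ge0.
rewrite -/F.
rewrite -ge0_integral_angles; last 3 first.
- exact: measurable_radial_integral.
- by move=> t; exact: radial_integral_ge0.
- move=> t; apply: eq_integral => r _.
  by rewrite /circ mulr_natl cosD2pi sinD2pi.
rewrite -right_half_plane_polar//.
under [X in _ = _ + X]eq_integral => t _.
  rewrite (_ : radial_integral f (t + pi)%R =
     radial_integral (fun z => f (- z.1, - z.2)%R) t); last first.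
    by apply: eq_integral => r _; rewrite /circ /= cosDpi sinDpi !mulrN.
  over.
rewrite -right_half_plane_polar//; last first.
  apply: (measurableT_comp mf).
  by apply: measurable_fun_pair; exact: measurableT_comp.
rewrite (ge0_integral_two_rays mF F0).
congr (_ + _); apply: eq_integral => x _.
rewrite /F ge0_integral_reflection//.
exact: (measurableT_comp mf (pair1_measurable (- x)%R)).
Qed.
End polar.

Section polar_signed.
Local Open Scope ereal_scope.
Variable R : realType.
Notation leb := (@lebesgue_measure R).
Implicit Type f : R * R -> \bar R.

(** The density of the polar parametrisation with respect to the product
measure, in the order (angle, radius). *)
Definition polar_density f : R * R -> \bar R :=
  (fun z => f (circ z.2 z.1) * z.2%:E) \_ (@angles R `*` @rays R).

Lemma measurable_angles : measurable (@angles R).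
Proof. exact: measurable_itv. Qed.

Lemma measurable_polar_density f :
  measurable_fun setT f -> measurable_fun setT (polar_density f).
Proof.
move=> mf.
apply/(measurable_restrictT (fun z : R * R => f (circ z.2 z.1) * z.2%:E)).
  by apply: measurableX; [exact: measurable_angles|exact: measurable_rays].
apply: measurable_funTS; apply: emeasurable_funM.
  exact: (measurableT_comp mf (@measurable_circ R)).
exact/measurable_EFinP.
Qed.

Lemma polar_densityE f t r : polar_density f (t, r) =
  if (t \in @angles R) && (r \in @rays R) then f (circ r t) * r%:E else 0.
Proof. by rewrite /polar_density patchE in_setX. Qed.

Lemma rays_ge0 (r : R) : r \in @rays R -> (0 <= r)%R.
Proof. by rewrite inE /rays/= in_itv/= andbT => /ltW. Qed.

Lemma polar_density_ge0 f z : (forall z, 0 <= f z) -> 0 <= polar_density f z.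
Proof.
case: z => t r f0; rewrite polar_densityE; case: ifPn => // /andP[_ /rays_ge0 r0].
by rewrite mule_ge0// lee_fin.
Qed.

Lemma integral_polar_density f t : t \in @angles R ->
  \int[leb]_r polar_density f (t, r) = radial_integral f t.
Proof.
move=> tA; rewrite /radial_integral [RHS]integral_mkcond; apply: eq_integral => r _.
by rewrite polar_densityE patchE tA.
Qed.

Lemma integral_polar_densityN f t : t \notin @angles R ->
  \int[leb]_r polar_density f (t, r) = 0.
Proof.
move=> tA; apply: integral0_eq => r _; by rewrite polar_densityE (negbTE tA).
Qed.

Lemma ge0_integral_polar_density f :
  measurable_fun setT f -> (forall z, 0 <= f z) ->
  \int[@leb2 R]_z polar_density f z = \int[@leb2 R]_z f z.
Proof.
move=> mf f0.
rewrite (fubini_tonelli1 (m1 := leb) (m2 := leb) _ (measurable_polar_density mf)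
  (fun z => polar_density_ge0 z f0)).
rewrite (ge0_integral_polar mf f0) [RHS]integral_mkcond.
apply: eq_integral => t _; rewrite /fubini_F patchE; case: ifPn => tA.
  exact: integral_polar_density.
exact: integral_polar_densityN.
Qed.

Lemma polar_density_funepos f : (polar_density f)^\+ = polar_density f^\+.
Proof.
apply/funext => -[t r]; rewrite funeposE !polar_densityE.
case: ifPn => [/andP[_ /rays_ge0 r0]|_]; last by rewrite maxxx.
by rewrite funeposE maxe_pMl ?lee_fin// mul0e.
Qed.

Lemma polar_density_funeneg f : (polar_density f)^\- = polar_density f^\-.
Proof.
apply/funext => -[t r]; rewrite funenegE !polar_densityE.
case: ifPn => [/andP[_ /rays_ge0 r0]|_]; last by rewrite oppe0 maxxx.
by rewrite funenegE maxe_pMl ?lee_fin// mul0e mulNe.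
Qed.

Lemma polar_density_abse f : abse \o polar_density f = polar_density (abse \o f).
Proof.
apply/funext => -[t r] /=; rewrite !polar_densityE.
case: ifPn => [/andP[_ /rays_ge0 r0]|_]; last by rewrite abse0.
by rewrite abseM/= (ger0_norm r0).
Qed.

(** The nonnegative case, applied to the positive and negative parts: since
r >= 0 they commute with the passage to [polar_density]. *)
Lemma integral_polar f : (@leb2 R).-integrable setT f ->
  \int[@leb2 R]_z f z = \int[leb]_(t in @angles R) radial_integral f t.
Proof.
move=> intf; have mf := measurable_int _ intf.
have mfp := measurable_funepos mf; have mfn := measurable_funeneg mf.
transitivity (\int[@leb2 R]_z polar_density f z).
  rewrite [LHS]integralE [RHS]integralE polar_density_funepos polar_density_funeneg.
  by rewrite !ge0_integral_polar_density.
rewrite -(integral12_prod_meas1 (m1 := leb) (m2 := leb)).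
  rewrite [RHS]integral_mkcond.
  apply: eq_integral => t _; rewrite /fubini_F patchE; case: ifPn => tA.
    exact: integral_polar_density.
  exact: integral_polar_densityN.
apply/integrableP; split; first exact: measurable_polar_density.
have -> : \int[@leb2 R]_z `|polar_density f z| =
    \int[@leb2 R]_z polar_density (abse \o f) z.
  by rewrite -polar_density_abse.
rewrite ge0_integral_polar_density; [|exact: measurableT_comp|by move=> z /=; exact: abse_ge0].
by move/integrableP : intf => [].
Qed.

End polar_signed.

Section annulus.
Variable R : realType.
Variables r1 r2 : R.
Hypotheses (r1_gt0 : 0 < r1) (r1_lt_r2 : r1 < r2).
Notation leb := (@lebesgue_measure R).
Notation Om := (annulus r1 r2).

Local Notation radius := Defs.radius.

Lemma radius_circ (r t : R) : 0 <= r -> radius (circ r t) = r.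
Proof.
move=> r0; rewrite /radius /circ /= !exprMn -mulrDr cos2Dsin2 mulr1.
by rewrite sqrtr_sqr ger0_norm.
Qed.

Lemma measurable_radius : measurable_fun setT (@radius R).
Proof.
apply: (measurableT_comp (f := @Num.sqrt R)).
  by apply: continuous_measurable_fun; exact: sqrt_continuous.
by apply: measurable_funD; apply: measurable_funX.
Qed.

Lemma measurable_annulus : measurable (Om : set (R * R)).
Proof.
have -> : Om = @radius R @^-1` `]r1, r2[ by apply/seteqP; split=> x /=; rewrite in_itv.
by rewrite -[X in measurable X]setTI; exact: measurable_radius.
Qed.

Lemma radial_integral_annulus (f : R * R -> \bar R) (t : R) :
  radial_integral (f \_ Om) t =
  (\int[leb]_(r in `]r1, r2[) (f (circ r t) * r%:E))%E.
Proof.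
rewrite /radial_integral integral_mkcond [RHS]integral_mkcond.
apply: eq_integral => r _; rewrite !patchE.
have -> : (r \in @rays R) = (0 < r) by rewrite /rays mem_setE in_itv/= andbT.
have -> : (r \in `]r1, r2[%classic) = (r1 < r < r2) by rewrite mem_setE in_itv.
case: ifPn => r0; last first.
  by case: ifPn => // /andP[r1r _]; rewrite (lt_trans r1_gt0 r1r) in r0.
rewrite (_ : (circ r t \in Om) = (r1 < r < r2)).
  by case: ifPn => //; rewrite mul0e.
by apply/idP/idP; rewrite in_setE /annulus /= radius_circ// ltW.
Qed.

Lemma integral_annulus_polar (f : R * R -> \bar R) :
  (@leb2 R).-integrable Om f ->
  (\int[@leb2 R]_(x in Om) f x =
   \int[leb]_(t in @angles R) \int[leb]_(r in `]r1, r2[) (f (circ r t) * r%:E))%E.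
Proof.
move=> intf; rewrite integral_mkcond integral_polar; last first.
  by apply/integrable_restrict; rewrite ?setTI//; exact: measurable_annulus.
by apply: eq_integral => t _; exact: radial_integral_annulus.
Qed.

End annulus.

(** * Differential calculus in the plane *)

Section plane_calculus.
Variable R : realType.
Implicit Types (x y v : R * R) (f : R * R -> R).

Section pointwise_derivation.
Variables (V : normedModType R) (p w : V) (phi chi : V -> R) (df dg : R).
Hypotheses (Hf : is_derive p w phi df) (Hg : is_derive p w chi dg).

(** The usual rules of differentiation for functions written pointwise, in a
form in which derivatives can be assembled by application. *)
Lemma is_derive_addE : is_derive p w (fun z => phi z + chi z) (df + dg).
Proof. exact: is_deriveD. Qed.

Lemma is_derive_mulE : is_derive p w (fun z => phi z * chi z) (phi p * dg + chi p * df).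
Proof. exact: is_deriveM. Qed.

Lemma is_derive_subE : is_derive p w (fun z => phi z - chi z) (df - dg).
Proof. exact: is_deriveB. Qed.

Lemma is_derive_scaleE k : is_derive p w (fun z => k * phi z) (k * df).
Proof. exact: is_deriveZ. Qed.

Lemma is_derive_sqrE : is_derive p w (fun z => phi z ^+ 2) (2 * phi p * df).
Proof.
have -> : (fun z => phi z ^+ 2) = phi * phi by apply/funext => z; rewrite expr2.
have := is_deriveM Hf Hf; rewrite /GRing.scale/= -mulr2n.
by rewrite -mulrA mulr_natl.
Qed.

(** Directional derivatives are derivatives along a line, which brings the
one-dimensional chain rule to functions on a normed space. *)
Lemma is_derive_line (psi : V -> R) (d : R) :
  is_derive p w psi d <-> is_derive (0 : R) (1 : R) (fun h : R => psi (h *: w + p)) d.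
Proof.
have E : (fun h : R => h^-1 *: ((psi \o shift p) (h *: w) - psi p)) =
  (fun h : R => h^-1 *: (((fun h : R => psi (h *: w + p)) \o shift 0) (h *: (1 : R)) -
     psi (0 *: w + p))).
  by apply/funext => h /=; rewrite scale0r add0r addr0 /GRing.scale/= mulr1.
split=> -[dpsi <-]; apply: DeriveDef.
- by rewrite /derivable -E.
- by rewrite /derive -E.
- by rewrite /derivable E.
- by rewrite /derive E.
Qed.

Lemma is_derive_lnE : 0 < phi p -> is_derive p w (fun z => ln (phi z)) ((phi p)^-1 * df).
Proof.
move=> p0; apply/is_derive_line.
apply: (is_derive1_comp (f := @ln R) (g := fun h : R => phi (h *: w + p))).
  by rewrite scale0r add0r; exact: is_derive1_ln.
exact/is_derive_line.
Qed.

End pointwise_derivation.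

Lemma near_box x (P : set (R * R)) :
  nbhs x P <-> exists2 d : R, 0 < d &
    forall y, `|y.1 - x.1| < d -> `|y.2 - x.2| < d -> P y.
Proof.
split => [/nbhs_ballP[d /= d0 xP]|[d d0 xP]].
  exists d => // y y1 y2; apply: xP.
  by split; rewrite /= -ball_normE /= distrC.
apply/nbhs_ballP; exists d => //= y [].
by rewrite -!ball_normE /= => y1 y2; apply: xP; rewrite distrC.
Qed.

Lemma rat_between (a b : R) : a < b -> exists q : rat, a < ratr q < b.
Proof.
by move=> ab; have [q] := rat_in_itvoo ab; rewrite in_itv/=; exists q.
Qed.

(** An open set is the countable union of the boxes with rational corners that
it contains. *)
Lemma open_measurable_plane (A : set (R * R)) : open A -> measurable A.
Proof.
move=> oA.
pose box (q : (rat * rat) * (rat * rat)) : set (R * R) :=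
  `](ratr q.1.1 : R), ratr q.1.2[%classic `*` `](ratr q.2.1 : R), ratr q.2.2[%classic.
have -> : A = \bigcup_q (if `[< box q `<=` A >] then box q else set0).
  apply/seteqP; split => [x Ax|x [q _]]; last first.
    by case: ifPn => // /asboolP; apply.
  have /near_box[d d0 xd] : nbhs x A by exact: open_nbhs_nbhs.
  have [a1 /andP[xa1 a1x]] := @rat_between (x.1 - d) x.1 ltac:(lra).
  have [b1 /andP[xb1 b1x]] := @rat_between x.1 (x.1 + d) ltac:(lra).
  have [a2 /andP[xa2 a2x]] := @rat_between (x.2 - d) x.2 ltac:(lra).
  have [b2 /andP[xb2 b2x]] := @rat_between x.2 (x.2 + d) ltac:(lra).
  exists ((a1, b1), (a2, b2)) => //.
  have -> : `[< box ((a1, b1), (a2, b2)) `<=` A >].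
    apply/asboolP => y [/=]; rewrite !in_itv/= => /andP[y1 y1'] /andP[y2 y2'].
    by apply: xd; rewrite ltr_norml; apply/andP; split; lra.
  by split; rewrite /= in_itv/= ?a1x ?a2x.
apply: countable_bigcupT_measurable => // q.
case: ifPn => // _; apply: measurableX; exact: measurable_itv.
Qed.

Lemma continuous_measurable_plane (U : set (R * R)) f : open U ->
  (forall x, U x -> {for x, continuous f}) -> measurable_fun U f.
Proof.
move=> oU cf; apply: (measurability _ (RGenOInfty.measurableE R)) => //.
move=> _ [_ [a ->] <-]; apply: open_measurable_plane.
rewrite openE => x [Ux fx]; rewrite /interior.
have nU : nbhs x U by exact: open_nbhs_nbhs.
have nfx : nbhs x (f @^-1` `]a, +oo[).
  apply: (cf _ Ux); move: fx; rewrite /= in_itv/= andbT => /lt_nbhsr.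
  by apply: filterS => y ay; rewrite /= in_itv/= ay.
exact: filterI.
Qed.

(** The mean value theorem with an increment of either sign, and at the price of
locating the intermediate point only up to the size of the increment. *)
Lemma MVT_signed (g dg : R -> R) (a s : R) :
  (forall z, `|z - a| <= `|s| -> is_derive z 1 g (dg z)) ->
  exists2 z, `|z - a| <= `|s| & g (a + s) - g a = s * dg z.
Proof.
move=> dgz.
have cg (u w : R) : (forall z, u <= z <= w -> `|z - a| <= `|s|) ->
    {within `[u, w], continuous g}.
  move=> H; apply: derivable_within_continuous => z; rewrite in_itv/= => /H.
  by move=> /dgz[].
have [s0|s0] := leP 0 s.
  have H z : a <= z <= a + s -> `|z - a| <= `|s|.
    by move=> /andP[az zs]; rewrite (ger0_norm s0) ler_norml; lra.
  have as0 : a <= a + s by lra.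
  have [z|z zI E] := @MVT_segment _ g dg a (a + s) as0 _ (cg _ _ H).
    by rewrite in_itv/= => /andP[z1 z2]; apply: dgz; apply: H; rewrite !ltW.
  exists z; first by apply: H; move: zI; rewrite in_itv.
  by rewrite E; ring.
have H z : a + s <= z <= a -> `|z - a| <= `|s|.
  by move=> /andP[az zs]; rewrite (ltr0_norm s0) ler_norml; lra.
have as0 : a + s <= a by lra.
have [z|z zI E] := @MVT_segment _ g dg (a + s) a as0 _ (cg _ _ H).
  by rewrite in_itv/= => /andP[z1 z2]; apply: dgz; apply: H; rewrite !ltW.
exists z; first by apply: H; move: zI; rewrite in_itv.
by rewrite -opprB E; ring.
Qed.

Lemma is_derive_slice1 f x (d : R) :
  is_derive x ((1, 0) : R * R) f d -> is_derive x.1 1 (fun z => f (z, x.2)) d.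
Proof.
have E : (fun h : R => h^-1 *: ((f \o shift x) (h *: ((1, 0) : R * R)) - f x)) =
    (fun h : R => h^-1 *: (((fun z => f (z, x.2)) \o shift x.1) (h *: (1 : R)) -
      f (x.1, x.2))).
  apply/funext => h /=; congr (_ *: (f _ - _)); last by case: x.
  by case: x => x1 x2; congr pair; rewrite /= scaler0 add0r.
move=> [df dE]; apply: DeriveDef; first by rewrite /derivable -E.
by rewrite -dE /derive -E.
Qed.

Lemma is_derive_slice2 f x (d : R) :
  is_derive x ((0, 1) : R * R) f d -> is_derive x.2 1 (fun z => f (x.1, z)) d.
Proof.
have E : (fun h : R => h^-1 *: ((f \o shift x) (h *: ((0, 1) : R * R)) - f x)) =
    (fun h : R => h^-1 *: (((fun z => f (x.1, z)) \o shift x.2) (h *: (1 : R)) -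
      f (x.1, x.2))).
  apply/funext => h /=; congr (_ *: (f _ - _)); last by case: x.
  by case: x => x1 x2; congr pair; rewrite /= scaler0 add0r.
move=> [df dE]; apply: DeriveDef; first by rewrite /derivable -E.
by rewrite -dE /derive -E.
Qed.

(** Continuous partial derivatives give all the directional derivatives: move
first along the second coordinate, then along the first, and apply the mean value
theorem on each side of the rectangle. The radial derivative is the direction
that is needed. *)
Lemma C1_is_derive f (D1 D2 : R * R -> R) x v :
  (\forall y \near x, is_derive y ((1, 0) : R * R) f (D1 y) /\
                      is_derive y ((0, 1) : R * R) f (D2 y)) ->
  {for x, continuous D1} -> {for x, continuous D2} ->
  is_derive x v f (v.1 * D1 x + v.2 * D2 x).
Proof.
move=> /near_box[d d0 dF] cD1 cD2.
suff H : (fun h : R => h^-1 *: ((f \o shift x) (h *: v) - f x)) @ 0^' -->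
    (v.1 * D1 x + v.2 * D2 x).
  apply: DeriveDef; first by apply/cvg_ex; eexists; exact: H.
  exact: cvg_lim H.
apply/cvgrPdist_lt => e e0.
(* Each partial derivative varies by less than e / N on a box of size m, and
   |h| N < m puts the rectangle with corners x and x + h v in that box. *)
pose N := `|v.1| + `|v.2| + 1.
have N0 : 0 < N by rewrite ltr_wpDl// addr_ge0.
have eN : 0 < e / N by rewrite divr_gt0.
have /near_box[d1 d10 H1] : \forall y \near x, `|D1 x - D1 y| < e / N.
  by move/cvgrPdist_lt : cD1 => /(_ _ eN).
have /near_box[d2 d20 H2] : \forall y \near x, `|D2 x - D2 y| < e / N.
  by move/cvgrPdist_lt : cD2 => /(_ _ eN).
pose m := Num.min d (Num.min d1 d2).
have m0 : 0 < m by rewrite !lt_min d0 d10.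
near=> h.
have hN : `|h| * N < m.
  rewrite -ltr_pdivlMr//; near: h; apply: dnbhs0_lt; exact: divr_gt0.
have h0 : h != 0 by near: h; exact: nbhs_dnbhs_neq.
have hv1 : `|h * v.1| < m.
  rewrite normrM (le_lt_trans _ hN)// ler_wpM2l// /N.
  by have := normr_ge0 v.2; lra.
have hv2 : `|h * v.2| < m.
  rewrite normrM (le_lt_trans _ hN)// ler_wpM2l// /N.
  by have := normr_ge0 v.1; lra.
have := hv1; rewrite /m !lt_min => /and3P[hv1d hv1d1 hv1d2].
have := hv2; rewrite /m !lt_min => /and3P[hv2d hv2d1 hv2d2].
(* The horizontal side is taken at the height x.2 + h v.2, the vertical one at
   the abscissa x.1. *)
have [z1 z1d E1] := @MVT_signed (fun z => f (z, x.2 + h * v.2))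
    (fun z => D1 (z, x.2 + h * v.2)) x.1 (h * v.1) (fun z Hz =>
    @is_derive_slice1 f (z, x.2 + h * v.2) _ (dF (z, x.2 + h * v.2)
      (le_lt_trans Hz hv1d) ltac:(by rewrite /= addrAC subrr add0r)).1).
have [z2 z2d E2] := @MVT_signed (fun z => f (x.1, z))
    (fun z => D2 (x.1, z)) x.2 (h * v.2) (fun z Hz =>
    @is_derive_slice2 f (x.1, z) _ (dF (x.1, z)
      ltac:(by rewrite /= subrr normr0) (le_lt_trans Hz hv2d)).2).
have -> : h^-1 *: ((f \o shift x) (h *: v) - f x) =
    v.1 * D1 (z1, x.2 + h * v.2) + v.2 * D2 (x.1, z2).
  have -> : (f \o shift x) (h *: v) - f x =
      h * (v.1 * D1 (z1, x.2 + h * v.2) + v.2 * D2 (x.1, z2)).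
    rewrite mulrDr !mulrA -E1 -E2 addrA subrK /=.
    by case: (x) => ? ?; case: (v) => ? ?; rewrite /=; congr (f (_, _) - _); rewrite addrC.
  by rewrite /GRing.scale/= mulrA mulVf// mul1r.
have B1 : `|D1 x - D1 (z1, x.2 + h * v.2)| < e / N.
  by apply: H1 => /=; [exact: le_lt_trans hv1d1|rewrite addrAC subrr add0r].
have B2 : `|D2 x - D2 (x.1, z2)| < e / N.
  by apply: H2 => /=; [rewrite subrr normr0|exact: le_lt_trans hv2d2].
have -> : v.1 * D1 x + v.2 * D2 x -
   (v.1 * D1 (z1, x.2 + h * v.2) + v.2 * D2 (x.1, z2)) =
   v.1 * (D1 x - D1 (z1, x.2 + h * v.2)) + v.2 * (D2 x - D2 (x.1, z2)) by ring.
rewrite (le_lt_trans (ler_normD _ _))// !normrM.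
have : (`|v.1| + `|v.2|) * (e / N) < e.
  by rewrite mulrCA gtr_pMr// ltr_pdivrMr// mul1r /N; lra.
apply: le_lt_trans; rewrite mulrDl lerD// ler_wpM2l// ltW//.
Unshelve. all: by end_near. Qed.

End plane_calculus.

(** * Continuous functions on the closed annulus and the radial divergence identity *)

Section annulus_functions.
Variable R : realType.
Variables r1 r2 : R.
Hypotheses (r1_gt0 : 0 < r1) (r1_lt_r2 : r1 < r2).
Notation leb := (@lebesgue_measure R).
Notation Om := (annulus r1 r2).
Local Notation radius := (@Defs.radius R).
Implicit Types (f : R * R -> R) (x : R * R).

Let r2_gt0 : 0 < r2. Proof. exact: lt_trans r1_lt_r2. Qed.

Definition sqr_radius x : R := x.1 ^+ 2 + x.2 ^+ 2.

Lemma sqr_radiusE x : sqr_radius x = radius x ^+ 2.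
Proof. by rewrite sqr_sqrtr// addr_ge0// sqr_ge0. Qed.

Lemma radius_ge0 x : 0 <= radius x.
Proof. exact: sqrtr_ge0. Qed.

Lemma continuous_fst_plane x : {for x, continuous (fun y : R * R => y.1)}.
Proof. exact: cvg_fst. Qed.

Lemma continuous_snd_plane x : {for x, continuous (fun y : R * R => y.2)}.
Proof. exact: cvg_snd. Qed.

Lemma continuous_sqr_radius : continuous sqr_radius.
Proof.
by move=> x; apply: cvgD; apply: cvgM => //;
  solve [exact: continuous_fst_plane|exact: continuous_snd_plane].
Qed.

Lemma continuous_radius : continuous radius.
Proof.
move=> x; apply: (continuous_comp (f := sqr_radius) (g := Num.sqrt)).
  exact: continuous_sqr_radius.
exact: sqrt_continuous.
Qed.

Definition closed_annulus : set (R * R) := [set x | r1 <= radius x <= r2].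

Lemma annulus_closed_annulus : Om `<=` closed_annulus.
Proof. by move=> x /andP[? ?]; rewrite /closed_annulus/= !ltW. Qed.

Lemma open_annulus : open Om.
Proof.
have -> : Om = radius @^-1` `]r1, r2[ by apply/seteqP; split=> x /=; rewrite in_itv.
move/continuousP : continuous_radius; apply; exact: interval_open.
Qed.

Lemma closed_closed_annulus : closed closed_annulus.
Proof.
have -> : closed_annulus = radius @^-1` `[r1, r2].
  by apply/seteqP; split=> x /=; rewrite in_itv.
move/continuous_closedP : continuous_radius; apply; exact: interval_closed.
Qed.

Lemma le_coord_radius x : `|x.1| <= radius x /\ `|x.2| <= radius x.
Proof.
split; rewrite -sqrtr_sqr ler_wsqrtr//.
  by rewrite lerDl sqr_ge0.
by rewrite lerDr sqr_ge0.
Qed.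

Lemma compact_closed_annulus : compact closed_annulus.
Proof.
apply: (@subclosed_compact _ _ (`[- r2, r2]%classic `*` `[- r2, r2]%classic)).
- exact: closed_closed_annulus.
- by apply: compact_setX; exact: segment_compact.
move=> x /andP[_ xr2]; have [x1 x2] := le_coord_radius x.
by split; rewrite /= in_itv/= -ler_norml (le_trans _ xr2).
Qed.

Lemma circ_closed_annulus r t : r1 <= r <= r2 -> closed_annulus (circ r t).
Proof.
by move=> /andP[r1r rr2]; rewrite /closed_annulus /= radius_circ ?r1r// (le_trans _ r1r)// ltW.
Qed.

(** A point of the closed annulus is pulled a little towards the middle circle
along its ray, which puts it inside the open annulus. *)
Lemma closed_annulus_closure : closed_annulus `<=` closure Om.
Proof.
move=> x /andP[r1x xr2] B /near_box[d d0 xB].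
have rx0 : 0 < radius x by exact: lt_le_trans r1x.
pose c := (r1 + r2) / 2.
pose m := Num.min (1 / 2) (d / (2 * r2)).
have m0 : 0 < m by rewrite lt_min divr_gt0//= divr_gt0// mulr_gt0.
have m1 : m <= 1 / 2 by rewrite ge_min lexx.
have mm : m * r2 < d.
  apply: (@le_lt_trans _ _ (d / 2)); last by lra.
  apply: (@le_trans _ _ (d / (2 * r2) * r2)).
    by rewrite ler_pM2r// ge_min lexx orbT.
  by rewrite invfM mulrA mulfVK ?gt_eqF// ltW.
have cr1 : r1 < c by rewrite /c; move: (r1_lt_r2); lra.
have cr2 : c < r2 by rewrite /c; move: (r1_lt_r2); lra.
clearbody m c.
have m1' : 0 < 1 - m by lra.
have sx1 : r1 < radius x + m * (c - radius x).
  have : r1 * (1 - m) <= radius x * (1 - m) by rewrite ler_pM2r.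
  have : m * r1 < m * c by rewrite ltr_pM2l.
  lra.
have sx2 : radius x + m * (c - radius x) < r2.
  have : radius x * (1 - m) <= r2 * (1 - m) by rewrite ler_pM2r.
  have : m * c < m * r2 by rewrite ltr_pM2l.
  lra.
(* The scaling s moves the radius of x to radius x + m (c - radius x), where c is
   the radius of the middle circle. *)
pose s := 1 + m * (c - radius x) / radius x.
have s0 : 0 < s.
  rewrite /s -[X in X + _](divff (lt0r_neq0 rx0)) -mulrDl divr_gt0//.
  exact: lt_trans sx1.
have sr : s * radius x = radius x + m * (c - radius x).
  by rewrite /s mulrDl mul1r mulfVK// gt_eqF.
have rs : radius (s * x.1, s * x.2) = s * radius x.
  by rewrite /radius /= !exprMn -mulrDr sqrtrM ?sqr_ge0// sqrtr_sqr gtr0_norm.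
exists (s * x.1, s * x.2); split.
  by rewrite /annulus /= rs sr sx1.
have H z : `|z| <= radius x -> `|s * z - z| < d.
  move=> zr.
  have -> : s * z - z = m * ((c - radius x) * ((radius x)^-1 * z)).
    by rewrite /s; ring.
  rewrite normrM (gtr0_norm m0) normrM.
  have zr1 : `|(radius x)^-1 * z| <= 1.
    by rewrite normrM normfV (gtr0_norm rx0) ler_pdivrMl// mulr1.
  have cx : `|c - radius x| <= r2 by rewrite ler_norml; move: (r1_gt0); lra.
  apply: le_lt_trans mm; rewrite ler_wpM2l ?(ltW m0)//.
  by rewrite -[X in _ <= X]mulr1 ler_pM.
have [x1 x2] := le_coord_radius x.
by apply: xB => /=; exact: H.
Qed.

Lemma closure_annulus : closure Om = closed_annulus.
Proof.
apply/seteqP; split; last exact: closed_annulus_closure.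
rewrite closureE => x; apply; split; first exact: closed_closed_annulus.
exact: annulus_closed_annulus.
Qed.

Lemma leb2_annulus_fin : (@leb2 R Om < +oo)%E.
Proof.
apply: (@le_lt_trans _ _ (@leb2 R (`[- r2, r2]%classic `*` `[- r2, r2]%classic))).
  apply: le_measure; rewrite ?inE.
  - exact: measurable_annulus.
  - by apply: measurableX; exact: measurable_itv.
  move=> x /andP[_ /ltW xr2]; have [x1 x2] := le_coord_radius x.
  by split; rewrite /= in_itv/= -ler_norml (le_trans _ xr2).
rewrite /leb2 product_measure1E; [|exact: measurable_itv..].
by rewrite /= lebesgue_measure_itv /= lte_fin; case: ifPn => _; rewrite -?EFinB ?mule0// -EFinM ltry.
Qed.

Definition continuous_on_annulus f :=
  forall x, closed_annulus x -> {for x, continuous f}.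

Lemma continuous_on_annulus_measurable f :
  continuous_on_annulus f -> measurable_fun Om f.
Proof.
move=> cf; apply: continuous_measurable_plane; first exact: open_annulus.
by move=> x /annulus_closed_annulus; exact: cf.
Qed.

Lemma continuous_on_annulus_bounded f : continuous_on_annulus f ->
  exists2 M, 0 < M & forall x, closed_annulus x -> `|f x| <= M.
Proof.
move=> cf.
have cK : {within closed_annulus, continuous f}.
  by apply: continuous_in_subspaceT => x; rewrite inE; exact: cf.
have [M [_ HM]] := compact_bounded (continuous_compact cK compact_closed_annulus).
exists (`|M| + 1); first by rewrite ltr_wpDl.
move=> x Kx; apply: HM; last by exists x.
by rewrite (le_lt_trans (ler_norm M))// ltrDl.
Qed.

Lemma continuous_on_annulus_integrable f :
  continuous_on_annulus f -> (@leb2 R).-integrable Om (EFin \o f).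
Proof.
move=> cf; apply: measurable_bounded_integrable.
- exact: measurable_annulus.
- exact: leb2_annulus_fin.
- exact: continuous_on_annulus_measurable.
have [M M0 HM] := continuous_on_annulus_bounded cf.
exists M; split; first exact: num_real.
move=> M' MM' x /annulus_closed_annulus /HM /le_trans; apply; exact: ltW.
Qed.

Lemma continuous_circ_radial t r : {for r, continuous (fun s : R => circ s t)}.
Proof.
apply: (@cvg_pair _ _ _ (nbhs r) (nbhs (r * cos t)) (nbhs (r * sin t)) _ _ _
  (fun s : R => s * cos t) (fun s : R => s * sin t)).
  by apply: cvgM; [exact: cvg_id|exact: cvg_cst].
by apply: cvgM; [exact: cvg_id|exact: cvg_cst].
Qed.

Lemma continuous_circ_angular r t : {for t, continuous (fun s : R => circ r s)}.
Proof.
apply: (@cvg_pair _ _ _ (nbhs t) (nbhs (r * cos t)) (nbhs (r * sin t)) _ _ _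
  (fun s : R => r * cos s) (fun s : R => r * sin s)).
  by apply: cvgM; [exact: cvg_cst|exact: continuous_cos].
by apply: cvgM; [exact: cvg_cst|exact: continuous_sin].
Qed.

Lemma angles_fin : (leb (@angles R) < +oo)%E.
Proof.
by rewrite lebesgue_measure_itv /= lte_fin; case: ifPn => _; rewrite -?EFinB ltry.
Qed.

Lemma continuous_on_annulus_circ f r : r1 <= r <= r2 ->
  continuous_on_annulus f -> continuous (f \o circ r).
Proof.
move=> rr cf t; apply: continuous_comp; first exact: continuous_circ_angular.
by apply: cf; exact: circ_closed_annulus.
Qed.

Lemma continuous_on_annulus_circ_integrable f r : r1 <= r <= r2 ->
  continuous_on_annulus f ->
  leb.-integrable (@angles R) (fun t => (f (circ r t))%:E).
Proof.
move=> rr cf; apply: measurable_bounded_integrable.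
- exact: measurable_angles.
- exact: angles_fin.
- apply: measurable_funTS; apply: continuous_measurable_fun.
  exact: continuous_on_annulus_circ.
have [M M0 HM] := continuous_on_annulus_bounded cf.
exists M; split; first exact: num_real.
move=> M' MM' t _ /=; rewrite (le_trans (HM _ _)) ?(ltW MM')//.
exact: circ_closed_annulus.
Qed.

(** C^1 up to the boundary, with explicit partial derivatives: they are required
to exist near each point of the closed annulus, so that differentiation along a
ray makes sense at the two boundary radii as well. *)
Definition C1_annulus (psi D1 D2 : R * R -> R) : Prop :=
  [/\ forall x, closed_annulus x -> \forall y \near x,
        is_derive y ((1, 0) : R * R) psi (D1 y) /\
        is_derive y ((0, 1) : R * R) psi (D2 y),
      continuous_on_annulus psi, continuous_on_annulus D1 &
      continuous_on_annulus D2].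

Lemma C1_annulus_is_derive_radial psi D1 D2 r t : C1_annulus psi D1 D2 ->
  r1 <= r <= r2 -> is_derive r 1 (fun s => psi (circ s t))
    (cos t * D1 (circ r t) + sin t * D2 (circ r t)).
Proof.
move=> [dpsi _ cD1 cD2] rr.
have Kr : closed_annulus (circ r t) by exact: circ_closed_annulus.
have [d dE] := @C1_is_derive R psi D1 D2 (circ r t) (cos t, sin t)
  (dpsi _ Kr) (cD1 _ Kr) (cD2 _ Kr).
have E : (fun h : R => h^-1 *: ((psi \o shift (circ r t)) (h *: (cos t, sin t)) -
            psi (circ r t))) =
    (fun h : R => h^-1 *: (((fun s => psi (circ s t)) \o shift r) (h *: (1 : R)) -
      psi (circ r t))).
  apply/funext => h /=; congr (_ *: (psi _ - _)).
  by rewrite /circ /=; congr pair; rewrite /= mulrDl /GRing.scale/= mulr1.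
apply: DeriveDef; first by rewrite /derivable -E.
by move: dE; rewrite /derive E.
Qed.

Lemma closed_annulus_sqr_radius_gt0 x : closed_annulus x -> 0 < sqr_radius x.
Proof.
move=> /andP[r1x _]; rewrite sqr_radiusE exprn_gt0//; exact: lt_le_trans r1x.
Qed.

Lemma sqr_radius_circ r t : sqr_radius (circ r t) = r ^+ 2.
Proof. by rewrite /sqr_radius /circ /= !exprMn -mulrDr cos2Dsin2 mulr1. Qed.

Lemma continuous_on_annulus_cst k : continuous_on_annulus (fun=> k).
Proof. by move=> x _; exact: cvg_cst. Qed.

Lemma continuous_on_annulusD f g : continuous_on_annulus f ->
  continuous_on_annulus g -> continuous_on_annulus (fun x => f x + g x).
Proof. by move=> cf cg x Kx; apply: cvgD; [exact: cf|exact: cg]. Qed.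

Lemma continuous_on_annulusB f g : continuous_on_annulus f ->
  continuous_on_annulus g -> continuous_on_annulus (fun x => f x - g x).
Proof. by move=> cf cg x Kx; apply: cvgB; [exact: cf|exact: cg]. Qed.

Lemma continuous_on_annulusM f g : continuous_on_annulus f ->
  continuous_on_annulus g -> continuous_on_annulus (fun x => f x * g x).
Proof. by move=> cf cg x Kx; apply: cvgM; [exact: cf|exact: cg]. Qed.

Lemma continuous_on_annulusX f n : continuous_on_annulus f ->
  continuous_on_annulus (fun x => f x ^+ n).
Proof.
move=> cf x Kx; apply: (continuous_comp (f := f) (g := fun y => y ^+ n)).
  exact: cf.
exact: exprn_continuous.
Qed.

Lemma continuous_on_annulus_fst : continuous_on_annulus fst.
Proof. by move=> x _; exact: continuous_fst_plane. Qed.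

Lemma continuous_on_annulus_snd : continuous_on_annulus snd.
Proof. by move=> x _; exact: continuous_snd_plane. Qed.

Lemma continuous_on_annulus_div_sqr_radius k :
  continuous_on_annulus (fun x => k / sqr_radius x).
Proof.
move=> x Kx; apply: cvgM; first exact: cvg_cst.
apply: cvgV; first by rewrite gt_eqF// closed_annulus_sqr_radius_gt0.
exact: continuous_sqr_radius.
Qed.

(** The inner integral of polar coordinates, when a primitive is known. *)
Lemma integral_ray f (H : R -> R) t : continuous_on_annulus f ->
  (forall r, r1 <= r <= r2 -> is_derive r 1 H (f (circ r t) * r)) ->
  (\int[leb]_(r in `]r1, r2[) ((f (circ r t))%:E * r%:E) = (H r2 - H r1)%:E)%E.
Proof.
move=> cf dH.
have cfr r : r1 <= r <= r2 -> {for r, continuous (fun r => f (circ r t) * r)}.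
  move=> rr; apply: cvgM; last exact: cvg_id.
  apply: (continuous_comp (f := fun s => circ s t) (g := f)).
    exact: continuous_circ_radial.
  by apply: cf; exact: circ_closed_annulus.
transitivity (\int[leb]_(r in `[r1, r2]) (f (circ r t) * r)%:E)%E.
  rewrite [RHS](@integral_itv_bndoo R r1 r2 _ true false).
    by apply: eq_integral => r _; rewrite EFinM.
  apply/measurable_EFinP; apply: open_continuous_measurable_fun.
    exact: interval_open.
  move=> r; rewrite inE/= in_itv/= => /andP[r1r rr2].
  by apply: cfr; rewrite !ltW.
exact: (@integral_is_derive R H _ r1 r2 (ltW r1_lt_r2) dH cfr).
Qed.

(** The divergence theorem for the field psi (a + c / |x|^2) x, whose divergence
is the integrand because c x / |x|^2 is divergence free off the origin. On each
ray the integrand times r is the derivative of (a r^2 + c) psi, so that polar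
coordinates reduce the identity to the fundamental theorem of calculus. The two
constants serve different purposes: in Green's formula they are dictated by the
radial function, in the Poincare inequality they are chosen so that the outer
boundary term vanishes. *)
Lemma radial_divergence (a c : R) psi D1 D2 : C1_annulus psi D1 D2 ->
  \int[@leb2 R]_(x in Om)
     ((a + c / sqr_radius x) * (x.1 * D1 x + x.2 * D2 x) + 2 * a * psi x) =
  (a * r2 ^+ 2 + c) * \int[leb]_(t in @angles R) psi (circ r2 t) -
  (a * r1 ^+ 2 + c) * \int[leb]_(t in @angles R) psi (circ r1 t).
Proof.
move=> C1psi; have [dpsi cpsi cD1 cD2] := C1psi.
pose F x := (a + c / sqr_radius x) * (x.1 * D1 x + x.2 * D2 x) + 2 * a * psi x.
have cF : continuous_on_annulus F.
  apply: continuous_on_annulusD.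
    apply: continuous_on_annulusM.
      apply: continuous_on_annulusD; first exact: continuous_on_annulus_cst.
      exact: continuous_on_annulus_div_sqr_radius.
    apply: continuous_on_annulusD; apply: continuous_on_annulusM.
    - exact: continuous_on_annulus_fst.
    - exact: cD1.
    - exact: continuous_on_annulus_snd.
    - exact: cD2.
  apply: continuous_on_annulusM; last exact: cpsi.
  exact: continuous_on_annulus_cst.
have r11 : r1 <= r1 <= r2 by rewrite lexx ltW.
have r22 : r1 <= r2 <= r2 by rewrite lexx ltW.
pose P (t r : R) := (a * r ^+ 2 + c) * psi (circ r t).
have inner t : (\int[leb]_(r in `]r1, r2[) ((F (circ r t))%:E * r%:E))%E =
    (P t r2 - P t r1)%:E.
  apply: integral_ray => // r rr; have r0 : r != 0.
    by rewrite gt_eqF// (lt_le_trans r1_gt0)//; case/andP: rr.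
  have dp := @C1_annulus_is_derive_radial _ _ _ r t C1psi rr.
  have dq := is_derive_addE
    (is_derive_scaleE (is_derive_sqrE (is_derive_id r (1 : R))) a)
    (is_derive_cst c r (1 : R)).
  have := is_derive_mulE dq dp; congr (is_derive _ _ _ _).
  by rewrite /F sqr_radius_circ /circ /=; field.
rewrite /Rintegral (integral_annulus_polar r1_gt0); last first.
  exact: continuous_on_annulus_integrable.
transitivity (\int[leb]_(t in @angles R) (P t r2 - P t r1)).
  by congr fine; apply: eq_integral => t _; exact: inner.
have mA := @measurable_angles R.
have intpsi r : r1 <= r <= r2 ->
    leb.-integrable (@angles R) (EFin \o (fun t => psi (circ r t))).
  by move=> rr; exact: continuous_on_annulus_circ_integrable.
have intP r : r1 <= r <= r2 -> leb.-integrable (@angles R) (EFin \o P^~ r).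
  move=> /intpsi psii.
  rewrite (_ : EFin \o P^~ r = fun t =>
    ((a * r ^+ 2 + c)%:E * (EFin \o (fun t => psi (circ r t))) t)%E).
    exact: integrableZl.
  by apply/funext => t /=; rewrite /P EFinM.
rewrite RintegralB; [|exact: mA|exact: intP|exact: intP].
by rewrite !RintegralZl; do ?[exact: mA|exact: intpsi].
Qed.

End annulus_functions.

(** * Square integrable functions *)

Lemma cvg_seq_unique (R : realType) (u w : nat -> R) (a b : R) :
  (forall n, u n = w n) -> u @ \oo --> a -> w @ \oo --> b -> a = b.
Proof.
move=> /funext -> ua wb.
by rewrite -(cvg_lim (@Rhausdorff R) ua) -(cvg_lim (@Rhausdorff R) wb).
Qed.

Section square_integrable_functions.
Context d (T : measurableType d) (R : realType).
Variables (mu : {measure set T -> \bar R}) (D : set T).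
Hypothesis mD : measurable D.
Implicit Types f g h : T -> R.
Local Notation sqi := (square_integrable mu D).

(** From |f g| <= f^2 + g^2. *)
Lemma sqi_mul_integrable f g : sqi f -> sqi g ->
  mu.-integrable D (EFin \o (fun x => f x * g x)).
Proof.
move=> [mf if2] [mg ig2].
have := integrableD mD if2 ig2; apply: le_integrable => //.
  by apply/measurable_EFinP; exact: measurable_funM.
move=> x _ /=; rewrite lee_fin [leRHS]ger0_norm ?addr_ge0 ?sqr_ge0//.
have := sqr_ge0 (f x - g x); have := sqr_ge0 (f x + g x).
by move=> ? ?; rewrite ler_norml; apply/andP; split; nra.
Qed.

Lemma sqi_sub f g : sqi f -> sqi g -> sqi (fun x => f x - g x).
Proof.
move=> [mf if2] [mg ig2]; split; first exact: measurable_funB.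
have := @integrableZl _ _ _ _ _ mD (2 : R) _ (integrableD mD if2 ig2); apply: le_integrable => //.
  by apply/measurable_EFinP; apply: measurable_funX; exact: measurable_funB.
move=> x _ /=; rewrite lee_fin !ger0_norm ?sqr_ge0 ?mulr_ge0 ?addr_ge0 ?sqr_ge0//.
by have := sqr_ge0 (f x + g x); nra.
Qed.

Lemma sqi_scale f k : sqi f -> sqi (fun x => k * f x).
Proof.
move=> [mf if2]; split; first exact: measurable_funM.
have := @integrableZl _ _ _ _ _ mD (k ^+ 2) _ if2; apply: eq_integrable => //.
by move=> x _ /=; rewrite exprMn.
Qed.

Lemma sqi_add f g : sqi f -> sqi g -> sqi (fun x => f x + g x).
Proof.
move=> sf /(sqi_scale (-1)) sg; have := sqi_sub sf sg.
by congr sqi; apply/funext => x; ring.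
Qed.

Definition inner f g : R := \int[mu]_(x in D) (f x * g x).

Lemma innerC f g : inner f g = inner g f.
Proof. by congr fine; apply: eq_integral => x _; rewrite mulrC. Qed.

Lemma innerBr f g h : sqi f -> sqi g -> sqi h ->
  inner f (fun x => g x - h x) = inner f g - inner f h.
Proof.
move=> sf sg sh; rewrite /inner -RintegralB//; last 2 first.
- exact: sqi_mul_integrable.
- exact: sqi_mul_integrable.
by apply: eq_Rintegral => x _; rewrite mulrBr.
Qed.

Lemma innerDr f g h : sqi f -> sqi g -> sqi h ->
  inner f (fun x => g x + h x) = inner f g + inner f h.
Proof.
move=> sf sg sh; rewrite /inner -RintegralD//; last 2 first.
- exact: sqi_mul_integrable.
- exact: sqi_mul_integrable.
by apply: eq_Rintegral => x _; rewrite mulrDr.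
Qed.

Lemma innerZr f g k : sqi f -> sqi g ->
  inner f (fun x => k * g x) = k * inner f g.
Proof.
move=> sf sg; rewrite /inner -RintegralZl//; last exact: sqi_mul_integrable.
by apply: eq_Rintegral => x _; rewrite mulrCA.
Qed.

Lemma innerZZ f g k l : sqi f -> sqi g ->
  inner (fun x => k * f x) (fun x => l * g x) = k * l * inner f g.
Proof.
move=> sf sg; have skf := sqi_scale k sf.
by rewrite innerZr// innerC innerZr// innerC mulrA (mulrC l).
Qed.

Lemma inner_ge0 f : 0 <= inner f f.
Proof. by apply: Rintegral_ge0 => x _; exact: sqr_ge0. Qed.

Lemma inner_sub f g : sqi f -> sqi g ->
  inner (fun x => f x - g x) (fun x => f x - g x) =
  inner f f - 2 * inner f g + inner g g.
Proof.
move=> sf sg; have sfg := sqi_sub sf sg.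
rewrite innerBr// ![inner (fun x => f x - g x) _]innerC !innerBr//.
by rewrite (innerC g f); ring.
Qed.

Lemma inner_subC f g : inner (fun x => f x - g x) (fun x => f x - g x) =
  inner (fun x => g x - f x) (fun x => g x - f x).
Proof. by apply: eq_Rintegral => x _; ring. Qed.

(** Nonnegativity of the norm of s f - t g at well chosen s and t. *)
Lemma inner_cauchy_schwarz f g : sqi f -> sqi g ->
  inner f g ^+ 2 <= inner f f * inner g g.
Proof.
move=> sf sg.
have H (s t : R) : 0 <= s ^+ 2 * inner f f - 2 * s * t * inner f g + t ^+ 2 * inner g g.
  have := inner_ge0 (fun x => s * f x - t * g x).
  rewrite inner_sub; [|exact: sqi_scale|exact: sqi_scale].
  rewrite !innerZZ//.
  by congr (_ <= _); ring.
have [A0|A0] := eqVneq (inner f f) 0.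
  rewrite A0 mul0r; have [->|B0] := eqVneq (inner f g) 0; first by rewrite expr0n.
  (* If f has norm 0, the form is affine in s; this value makes it equal to -1. *)
  have := H ((inner g g + 1) / (2 * inner f g)) 1; rewrite A0.
  have -> : (inner g g + 1) / (2 * inner f g) = (inner g g + 1) / 2 / inner f g.
    by field.
  rewrite mulr0 add0r mulr1 expr1n mul1r -mulrA mulfVK//; lra.
have Apos : 0 < inner f f by rewrite lt_neqAle eq_sym A0 inner_ge0.
have := H (inner f g) (inner f f).
by rewrite -(pmulr_rge0 _ Apos) => K; rewrite -subr_ge0 -(pmulr_rge0 _ Apos); nra.
Qed.

Lemma inner_le_sub f g : sqi f -> sqi g ->
  inner f f <= 2 * inner (fun x => g x - f x) (fun x => g x - f x) + 2 * inner g g.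
Proof.
move=> sf sg; rewrite inner_sub//.
have := inner_ge0 (fun x => f x - 2 * g x).
rewrite inner_sub//; last exact: sqi_scale.
rewrite innerZZ// innerZr// (innerC g f).
lra.
Qed.

(** Stated with extended real integrals, where a divergent one is not read
as 0, as in the definition of the trace. *)
Definition L2_cvg (fn : nat -> T -> R) f : Prop :=
  (\int[mu]_(x in D) ((fn n x - f x) ^+ 2)%:E)%E @[n --> \oo] --> 0%E.

Lemma L2_cvg_dominated (fn : nat -> T -> R) f (h : nat -> T -> R) :
  (forall n, measurable_fun D (fn n)) -> measurable_fun D f ->
  (forall n, measurable_fun D (h n)) ->
  (forall n x, D x -> (fn n x - f x) ^+ 2 <= h n x) ->
  (\int[mu]_(x in D) (h n x)%:E)%E @[n --> \oo] --> 0%E -> L2_cvg fn f.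
Proof.
move=> mfn mf mh le_h h0.
apply: (squeeze_cvge _ (@cvg_cst _ 0%E _ _ _) h0).
near=> n; apply/andP; split.
  by apply: integral_ge0 => x _; rewrite lee_fin sqr_ge0.
apply: ge0_le_integral => //.
- by move=> x _; rewrite lee_fin sqr_ge0.
- by apply/measurable_EFinP; apply: measurable_funX; exact: measurable_funB.
- exact/measurable_EFinP.
- by move=> x Dx; rewrite lee_fin; exact: le_h.
Unshelve. all: by end_near. Qed.

Lemma inner_integral f : sqi f ->
  (\int[mu]_(x in D) (f x ^+ 2)%:E)%E = (inner f f)%:E.
Proof.
move=> [mf if2]; rewrite /inner /Rintegral fineK//.
exact: integrable_fin_num.
Qed.

(** For square integrable functions the extended and the real formulations of
convergence agree; this lemma and the next pass from one to the other. *)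
Lemma L2_cvg_inner fn f : sqi f -> (forall n, sqi (fn n)) -> L2_cvg fn f ->
  inner (fun x => fn n x - f x) (fun x => fn n x - f x) @[n --> \oo] --> (0 : R).
Proof.
move=> sf sfn H.
rewrite (_ : (fun n => _) = fine \o
    (fun n => \int[mu]_(x in D) ((fn n x - f x) ^+ 2)%:E)%E).
  exact: fine_cvg H.
by apply/funext => n; rewrite /= (inner_integral (sqi_sub (sfn n) sf)).
Qed.

Lemma L2_cvgP (fn : nat -> T -> R) f : sqi f -> (forall n, sqi (fn n)) ->
  inner (fun x => fn n x - f x) (fun x => fn n x - f x) @[n --> \oo] --> (0 : R) ->
  L2_cvg fn f.
Proof.
move=> sf sfn H; rewrite /L2_cvg.
rewrite (_ : (fun n => _) = EFin \o
    (fun n => inner (fun x => fn n x - f x) (fun x => fn n x - f x))).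
  by apply: cvg_EFin => //; exact: nearW.
by apply/funext => n; rewrite /= (inner_integral (sqi_sub (sfn n) sf)).
Qed.

Lemma L2_cvg_cst f g : (forall x, D x -> f x = g x) -> L2_cvg (fun=> f) g.
Proof.
move=> fg; rewrite /L2_cvg.
rewrite (_ : (fun=> _) = (fun=> 0%E)); first exact: cvg_cst.
apply/funext => _; apply: integral0_eq => x Dx.
by rewrite fg// subrr expr0n.
Qed.

Lemma L2_cvg_eq (fn gn : nat -> T -> R) f :
  (forall n x, D x -> fn n x = gn n x) -> L2_cvg gn f -> L2_cvg fn f.
Proof.
move=> fg; rewrite /L2_cvg.
have E n : (\int[mu]_(x in D) ((fn n x - f x) ^+ 2)%:E =
    \int[mu]_(x in D) ((gn n x - f x) ^+ 2)%:E)%E.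
  by apply: eq_integral => x; rewrite inE => Dx; rewrite fg.
by under [in X in _ -> X]eq_fun do rewrite E.
Qed.

Lemma L2_cvg_sub (fn gn : nat -> T -> R) f g :
  (forall n, sqi (fn n)) -> (forall n, sqi (gn n)) -> sqi f -> sqi g ->
  L2_cvg fn f -> L2_cvg gn g ->
  L2_cvg (fun n x => fn n x - gn n x) (fun x => f x - g x).
Proof.
move=> sfn sgn sf sg /(L2_cvg_inner sf sfn) f0 /(L2_cvg_inner sg sgn) g0.
apply: L2_cvgP; [exact: sqi_sub|by move=> n; exact: sqi_sub|].
have := cvgM (cvg_cst (2 : R)) f0 => /(_ _ _) f1.
have := cvgM (cvg_cst (2 : R)) g0 => /(_ _ _) g1.
have := cvgD f1 g1 => /(_ _); rewrite mulr0 addr0 => fg.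
apply: (squeeze_cvgr _ (cvg_cst 0) fg); near=> n; rewrite inner_ge0/=.
have s1 := sqi_sub (sfn n) sf; have s2 := sqi_sub (sgn n) sg.
have -> : inner (fun x => fn n x - gn n x - (f x - g x))
    (fun x => fn n x - gn n x - (f x - g x)) =
    inner (fun x => (fn n x - f x) - (gn n x - g x)) (fun x => (fn n x - f x) - (gn n x - g x)).
  by apply: eq_Rintegral => x _; ring.
apply: (le_trans (inner_le_sub (sqi_sub s1 s2) s1)).
have -> : inner (fun x => fn n x - f x - (fn n x - f x - (gn n x - g x)))
    (fun x => fn n x - f x - (fn n x - f x - (gn n x - g x))) =
    inner (fun x => gn n x - g x) (fun x => gn n x - g x).
  by apply: eq_Rintegral => x _; ring.
by rewrite addrC.
Unshelve. all: by end_near. Qed.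

(** By Cauchy-Schwarz, convergence in norm implies weak convergence; this is
what transfers integral identities from C^1 functions to H1. *)
Lemma L2_cvg_pairing fn f h : sqi h -> sqi f -> (forall n, sqi (fn n)) ->
  L2_cvg fn f -> inner h (fn n) @[n --> \oo] --> inner h f.
Proof.
move=> sh sf sfn /(L2_cvg_inner sf sfn) e0.
apply/cvgrPdist_le => e e_gt0.
have H0 := inner_ge0 h.
have : 0 < e ^+ 2 / (inner h h + 1) by rewrite divr_gt0 ?exprn_gt0// ltr_wpDl.
move/cvgrPdist_le : e0 => /[apply]; apply: filterS => n.
rewrite sub0r normrN ger0_norm ?inner_ge0// => en.
rewrite -innerBr//; set B := inner h _.
suff : B ^+ 2 <= e ^+ 2 by move=> ?; rewrite ler_norml; apply/andP; split; nra.
have sd : sqi (fun x => f x - fn n x) by exact: sqi_sub.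
apply: (le_trans (inner_cauchy_schwarz sh sd)).
have -> : inner (fun x => f x - fn n x) (fun x => f x - fn n x) =
    inner (fun x => fn n x - f x) (fun x => fn n x - f x).
  by apply: eq_Rintegral => x _; ring.
move: en; rewrite ler_pdivlMr ?ltr_wpDl// => en.
have := inner_ge0 (fun x => fn n x - f x); nra.
Qed.

End square_integrable_functions.

(** * Green's formula for radial fields against H1 functions *)

Section sobolev_annulus.
Variable R : realType.
Variables r1 r2 : R.
Hypotheses (r1_gt0 : 0 < r1) (r1_lt_r2 : r1 < r2).
Notation leb := (@lebesgue_measure R).
Notation Om := (annulus r1 r2).
Local Notation e1 := ((1, 0) : R * R).
Local Notation e2 := ((0, 1) : R * R).
Implicit Types (f v : R * R -> R) (G : R * R -> R * R) (x : R * R).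

Local Notation sqi := (square_integrable (@leb2 R) Om).
Local Notation inner2 := (inner (@leb2 R) Om).
Local Notation innerA := (inner leb (@angles R)).

Let r22 : r1 <= r2 <= r2. Proof. by rewrite lexx ltW. Qed.
Let r11 : r1 <= r1 <= r2. Proof. by rewrite lexx ltW. Qed.
Let mOm : measurable (Om : set (measurableTypeR R * measurableTypeR R)).
Proof. exact: measurable_annulus. Qed.
Let mA : measurable (@angles R : set (measurableTypeR R)).
Proof. exact: measurable_angles. Qed.

Lemma sqi_continuous f : continuous_on_annulus r1 r2 f -> sqi f.
Proof.
move=> cf; split; first exact: continuous_on_annulus_measurable.
apply: (@continuous_on_annulus_integrable R r1 r2 (fun x => f x ^+ 2)).
exact: continuous_on_annulusX.
Qed.

Lemma L2_circle_continuous f r : r1 <= r <= r2 ->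
  continuous_on_annulus r1 r2 f -> L2_circle r f.
Proof.
move=> rr cf; split.
  apply: measurable_funTS; apply: continuous_measurable_fun.
  exact: continuous_on_annulus_circ cf.
apply: (continuous_on_annulus_circ_integrable (f := fun x => f x ^+ 2) r1_gt0 rr).
exact: continuous_on_annulusX.
Qed.

Lemma C1_closure_C1_annulus f : C1_closure Om f ->
  C1_annulus r1 r2 f ('D_e1 f) ('D_e2 f).
Proof.
move=> [U [oU OmU [/= cf [df [cD1 _] [cD2 _]]]]].
have KU x : closed_annulus r1 r2 x -> U x.
  by move=> Kx; apply: OmU; rewrite closure_annulus.
split.
- move=> x /KU Ux.
  have : nbhs x U by exact: open_nbhs_nbhs.
  by apply: filterS => y /df[d1 d2]; split; [exact: (DeriveDef d1 erefl)|exact: (DeriveDef d2 erefl)].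
- by move=> x /KU; exact: cf.
- by move=> x /KU; exact: cD1.
- by move=> x /KU; exact: cD2.
Qed.

Lemma annulus_C1_derivable f D1 D2 x : C1_annulus r1 r2 f D1 D2 -> Om x ->
  is_derive x e1 f (D1 x) /\ is_derive x e2 f (D2 x).
Proof.
by move=> [df _ _ _] /annulus_closed_annulus /df /nbhs_singleton.
Qed.

(** The trace is defined with the sum of the squares of the partial derivatives;
each of them is dominated by the sum. *)
Lemma H1_approx_closure v G w : H1 r1 r2 v G w ->
  exists phi : nat -> R * R -> R,
  [/\ forall n, C1_closure Om (phi n),
      L2_cvg (@leb2 R) Om phi v,
      L2_cvg (@leb2 R) Om (fun n => 'D_e1 (phi n)) (fst \o G),
      L2_cvg (@leb2 R) Om (fun n => 'D_e2 (phi n)) (snd \o G) &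
      forall r, r = r1 \/ r = r2 ->
        L2_cvg leb (@angles R) (fun n => phi n \o circ r) (w \o circ r)].
Proof.
move=> [sv [sG1 sG2] _ _ [phi [C1phi phiv phiG phiw]]].
have C1 n := C1_closure_C1_annulus (C1phi n).
pose h (n : nat) x : R := ('D_e1 (phi n) x - (G x).1) ^+ 2 + ('D_e2 (phi n) x - (G x).2) ^+ 2.
have phih : (\int[@leb2 R]_(x in Om) (h n x)%:E)%E @[n --> \oo] --> 0%E.
  have hE n : (\int[@leb2 R]_(x in Om) (h n x)%:E)%E = (\int[@leb2 R]_(x in Om)
      (dot (grad (phi n) x - G x) (grad (phi n) x - G x))%:E)%E.
    by apply: eq_integral => x _; rewrite /h !expr2.
  by under eq_fun do rewrite hE.
have mG1 : measurable_fun (Om : set (measurableTypeR R * measurableTypeR R)) (fst \o G) by case: sG1.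
have mG2 : measurable_fun (Om : set (measurableTypeR R * measurableTypeR R)) (snd \o G) by case: sG2.
have mD1 n : measurable_fun (Om : set (measurableTypeR R * measurableTypeR R)) ('D_e1 (phi n)).
  by have [_ _ cD1 _] := C1 n; exact: continuous_on_annulus_measurable.
have mD2 n : measurable_fun (Om : set (measurableTypeR R * measurableTypeR R)) ('D_e2 (phi n)).
  by have [_ _ _ cD2] := C1 n; exact: continuous_on_annulus_measurable.
have mh n : measurable_fun (Om : set (measurableTypeR R * measurableTypeR R)) (h n).
  apply: (measurable_funD (f := fun x => ('D_e1 (phi n) x - (G x).1) ^+ 2));
    apply: measurable_funX.
    exact: (measurable_funB (mD1 n) mG1).
  exact: (measurable_funB (mD2 n) mG2).
exists phi; split => //.
- apply: (L2_cvg_dominated (h := h) mOm mD1 mG1 mh); last exact: phih.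
  by move=> n x _; rewrite /h lerDl sqr_ge0.
- apply: (L2_cvg_dominated (h := h) mOm mD2 mG2 mh); last exact: phih.
  by move=> n x _; rewrite /h lerDr sqr_ge0.
Qed.

Lemma H1_approx v G w : H1 r1 r2 v G w ->
  exists phi : nat -> R * R -> R,
  [/\ forall n, C1_annulus r1 r2 (phi n) ('D_e1 (phi n)) ('D_e2 (phi n)),
      L2_cvg (@leb2 R) Om phi v,
      L2_cvg (@leb2 R) Om (fun n => 'D_e1 (phi n)) (fst \o G),
      L2_cvg (@leb2 R) Om (fun n => 'D_e2 (phi n)) (snd \o G) &
      forall r, r = r1 \/ r = r2 ->
        L2_cvg leb (@angles R) (fun n => phi n \o circ r) (w \o circ r)].
Proof.
move=> /H1_approx_closure[phi [C1phi ? ? ? ?]]; exists phi; split => // n.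
exact: C1_closure_C1_annulus.
Qed.

Lemma H1_sqi v G w : H1 r1 r2 v G w -> [/\ sqi v, sqi (fst \o G), sqi (snd \o G),
  square_integrable leb (@angles R) (w \o circ r1) &
  square_integrable leb (@angles R) (w \o circ r2)].
Proof. by move=> [? [? ?] _ [? ?] _]. Qed.

Lemma sqi_circ f r : r1 <= r <= r2 -> continuous_on_annulus r1 r2 f ->
  square_integrable leb (@angles R) (f \o circ r).
Proof. exact: L2_circle_continuous. Qed.

Lemma innerA_cst (f : R -> R) : innerA (fun=> 1) f = \int[leb]_(t in @angles R) f t.
Proof. by apply: eq_Rintegral => t _; rewrite mul1r. Qed.

Lemma sqi_cst_angles (k : R) : square_integrable leb (@angles R) (fun=> k).
Proof.
apply: (@sqi_circ (fun=> k) r1 r11); exact: continuous_on_annulus_cst.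
Qed.

(** The gradient of k1/2 |x|^2 + k2/2 ln |x|^2 is this weight times x. *)
Definition radial_weight (k1 k2 : R) x : R := k1 + k2 / sqr_radius x.

Lemma continuous_radial_weight k1 k2 :
  continuous_on_annulus r1 r2 (radial_weight k1 k2).
Proof.
apply: continuous_on_annulusD; first exact: continuous_on_annulus_cst.
exact: continuous_on_annulus_div_sqr_radius.
Qed.

(** [radial_divergence] with the weight of a radial function: the derivative
along the weighted x is the product of the two gradients, and 2 k1 is the
Laplacian. *)
Lemma green_C1 k1 k2 phi D1 D2 : C1_annulus r1 r2 phi D1 D2 ->
  inner2 (fun x => radial_weight k1 k2 x * x.1) D1 +
  inner2 (fun x => radial_weight k1 k2 x * x.2) D2 +
  inner2 (fun=> 2 * k1) phi =
  (k1 * r2 ^+ 2 + k2) * innerA (fun=> 1) (phi \o circ r2) -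
  (k1 * r1 ^+ 2 + k2) * innerA (fun=> 1) (phi \o circ r1).
Proof.
move=> C1phi; have [_ cphi cD1 cD2] := C1phi.
rewrite !innerA_cst /comp -(radial_divergence r1_gt0 r1_lt_r2 k1 k2 C1phi).
have ck : continuous_on_annulus r1 r2 (fun=> 2 * k1) by exact: continuous_on_annulus_cst.
have cfst : continuous_on_annulus r1 r2 fst by exact: continuous_on_annulus_fst.
have csnd : continuous_on_annulus r1 r2 snd by exact: continuous_on_annulus_snd.
have cw := @continuous_radial_weight k1 k2.
have c1 := continuous_on_annulusM (continuous_on_annulusM cw cfst) cD1.
have c2 := continuous_on_annulusM (continuous_on_annulusM cw csnd) cD2.
have c3 := continuous_on_annulusM ck cphi.
have i1 := continuous_on_annulus_integrable c1.
have i2 := continuous_on_annulus_integrable c2.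
have i3 := continuous_on_annulus_integrable c3.
have i12 := continuous_on_annulus_integrable (continuous_on_annulusD c1 c2).
rewrite /inner -RintegralD; [|exact: mOm|exact: i1|exact: i2].
rewrite -RintegralD; [|exact: mOm|exact: i12|exact: i3].
by apply: eq_Rintegral => x _; rewrite /radial_weight; ring.
Qed.

(** Every term is a pairing with a fixed bounded function, hence passes to the
limit along the C^1 functions that define the trace. *)
Lemma green_H1 k1 k2 v G w : H1 r1 r2 v G w ->
  inner2 (fun x => radial_weight k1 k2 x * x.1) (fst \o G) +
  inner2 (fun x => radial_weight k1 k2 x * x.2) (snd \o G) +
  inner2 (fun=> 2 * k1) v =
  (k1 * r2 ^+ 2 + k2) * innerA (fun=> 1) (w \o circ r2) -
  (k1 * r1 ^+ 2 + k2) * innerA (fun=> 1) (w \o circ r1).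
Proof.
move=> Hv; have [sv sG1 sG2 sw1 sw2] := H1_sqi Hv.
have [phi [C1phi cv c1 c2 cw]] := H1_approx Hv.
have cw1 := cw r1 (or_introl erefl); have cw2 := cw r2 (or_intror erefl).
have ck : continuous_on_annulus r1 r2 (fun=> 2 * k1) by exact: continuous_on_annulus_cst.
have cfst : continuous_on_annulus r1 r2 fst by exact: continuous_on_annulus_fst.
have csnd : continuous_on_annulus r1 r2 snd by exact: continuous_on_annulus_snd.
have crw := @continuous_radial_weight k1 k2.
have sh1 := sqi_continuous (continuous_on_annulusM crw cfst).
have sh2 := sqi_continuous (continuous_on_annulusM crw csnd).
have s3 := sqi_continuous ck.
have sA := sqi_cst_angles 1.
have sphi n : sqi (phi n) by have [_ ? _ _] := C1phi n; exact: sqi_continuous.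
have sD1 n : sqi ('D_e1 (phi n)) by have [_ _ ? _] := C1phi n; exact: sqi_continuous.
have sD2 n : sqi ('D_e2 (phi n)) by have [_ _ _ ?] := C1phi n; exact: sqi_continuous.
have sc1 n : square_integrable leb (@angles R) (phi n \o circ r1).
  by have [_ ? _ _] := C1phi n; exact: sqi_circ.
have sc2 n : square_integrable leb (@angles R) (phi n \o circ r2).
  by have [_ ? _ _] := C1phi n; exact: sqi_circ.
have l1 := L2_cvg_pairing mOm sh1 sG1 sD1 c1.
have l2 := L2_cvg_pairing mOm sh2 sG2 sD2 c2.
have l3 := L2_cvg_pairing mOm s3 sv sphi cv.
have l4 := L2_cvg_pairing mA sA sw2 sc2 cw2.
have l5 := L2_cvg_pairing mA sA sw1 sc1 cw1.
have lhs := cvgD (cvgD l1 l2) l3.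
have rhs := cvgB (cvgM (cvg_cst (k1 * r2 ^+ 2 + k2)) l4)
  (cvgM (cvg_cst (k1 * r1 ^+ 2 + k2)) l5).
refine (cvg_seq_unique _ (lhs _ _) (rhs _ _ _ _ _)) => n.
exact: (green_C1 k1 k2 (C1phi n)).
Qed.

End sobolev_annulus.

(** * A Poincare inequality *)

Section poincare.
Variable R : realType.
Variables r1 r2 : R.
Hypotheses (r1_gt0 : 0 < r1) (r1_lt_r2 : r1 < r2).
Notation leb := (@lebesgue_measure R).
Notation Om := (annulus r1 r2).
Local Notation e1 := ((1, 0) : R * R).
Local Notation e2 := ((0, 1) : R * R).
Implicit Types (f v : R * R -> R) (G : R * R -> R * R) (x : R * R).

Local Notation sqi := (square_integrable (@leb2 R) Om).
Local Notation inner2 := (inner (@leb2 R) Om).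
Local Notation innerA := (inner leb (@angles R)).

Let r11 : r1 <= r1 <= r2. Proof. by rewrite lexx ltW. Qed.
Let r2_gt0 : 0 < r2. Proof. exact: lt_trans r1_lt_r2. Qed.
Let mOm : measurable (Om : set (measurableTypeR R * measurableTypeR R)).
Proof. exact: measurable_annulus. Qed.
Let mA : measurable (@angles R : set (measurableTypeR R)).
Proof. exact: measurable_angles. Qed.

Definition poincare_const : R := (r2 ^+ 2 / r1 ^+ 2) ^+ 2 * r2 ^+ 2.

Lemma C1_annulus_sqr phi D1 D2 : C1_annulus r1 r2 phi D1 D2 ->
  C1_annulus r1 r2 (fun x => phi x ^+ 2) (fun x => 2 * phi x * D1 x)
    (fun x => 2 * phi x * D2 x).
Proof.
move=> [dphi cphi cD1 cD2].
have c2 : continuous_on_annulus r1 r2 (fun=> 2 : R) by exact: continuous_on_annulus_cst.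
split.
- move=> x /dphi; apply: filterS => y [d1 d2].
  by split; exact: is_derive_sqrE.
- exact: continuous_on_annulusX.
- exact: (continuous_on_annulusM (continuous_on_annulusM c2 cphi) cD1).
- exact: (continuous_on_annulusM (continuous_on_annulusM c2 cphi) cD2).
Qed.

(** The pointwise estimate behind the Poincare inequality. The weight is
1/2 (1 - r2^2 / |x|^2), bounded on the annulus; Cauchy-Schwarz for the radial
derivative and Young's inequality absorb half of the term in p^2. *)
Lemma radial_young (s x1 x2 p d1 d2 : R) : s = x1 ^+ 2 + x2 ^+ 2 ->
  r1 ^+ 2 <= s <= r2 ^+ 2 ->
  1 / 2 * p ^+ 2 - poincare_const / 2 * (d1 ^+ 2 + d2 ^+ 2) <=
  (1 / 2 + - (r2 ^+ 2 / 2) / s) * (x1 * (2 * p * d1) + x2 * (2 * p * d2)) +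
    2 * (1 / 2) * p ^+ 2.
Proof.
move=> sE /andP[r1s sr2].
have r1sq : 0 < r1 ^+ 2 by rewrite exprn_gt0.
have s0 : 0 < s by exact: lt_le_trans r1s.
set k := r2 ^+ 2 / s - 1.
have -> : (1 / 2 + - (r2 ^+ 2 / 2) / s) * (x1 * (2 * p * d1) + x2 * (2 * p * d2)) =
    - (k * p * (x1 * d1 + x2 * d2)).
  by rewrite /k; field; rewrite gt_eqF.
have k0 : 0 <= k by rewrite /k subr_ge0 ler_pdivlMr// mul1r.
have kle : k <= r2 ^+ 2 / r1 ^+ 2.
  rewrite /k lerBlDr; apply: (@le_trans _ _ (r2 ^+ 2 / r1 ^+ 2)).
    by rewrite ler_pM2l ?exprn_gt0// lef_pV2.
  by rewrite lerDl.
have ks : k ^+ 2 * s <= poincare_const.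
  by rewrite /poincare_const ler_pM ?sqr_ge0 ?(ltW s0)// ler_pXn2r// nnegrE// (le_trans k0).
have cs : (x1 * d1 + x2 * d2) ^+ 2 <= s * (d1 ^+ 2 + d2 ^+ 2).
  by rewrite sE -subr_ge0 [X in 0 <= X](_ : _ = (x1 * d2 - x2 * d1) ^+ 2) ?sqr_ge0//; ring.
set q := x1 * d1 + x2 * d2 in cs *; set m := d1 ^+ 2 + d2 ^+ 2 in cs *.
have m0 : 0 <= m by rewrite addr_ge0 ?sqr_ge0.
have kq : k ^+ 2 * q ^+ 2 <= poincare_const * m.
  apply: (@le_trans _ _ (k ^+ 2 * (s * m))); first by rewrite ler_wpM2l ?sqr_ge0.
  by rewrite mulrA ler_wpM2r.
have := sqr_ge0 (p - k * q); rewrite sqrrB exprMn => y.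
lra.
Qed.

(** [radial_divergence] for phi^2 with a = 1/2 and c = - r2^2/2: these values
cancel the contribution of the outer circle, where nothing is known of phi, and
the right-hand side is controlled by the inner circle. [radial_young] bounds
the left-hand side from below. *)
Lemma poincare_C1 phi D1 D2 : C1_annulus r1 r2 phi D1 D2 ->
  inner2 phi phi <= (r2 ^+ 2 - r1 ^+ 2) * innerA (phi \o circ r1) (phi \o circ r1) +
    poincare_const * (inner2 D1 D1 + inner2 D2 D2).
Proof.
move=> C1phi; have [_ cphi cD1 cD2] := C1phi.
have [_ cp2 cd1 cd2] := C1_annulus_sqr C1phi.
have := radial_divergence r1_gt0 r1_lt_r2 (1 / 2) (- (r2 ^+ 2 / 2)) (C1_annulus_sqr C1phi).
have -> : 1 / 2 * r2 ^+ 2 + - (r2 ^+ 2 / 2) = 0 by field.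
rewrite mul0r sub0r.
have -> : \int[leb]_(t in @angles R) phi (circ r1 t) ^+ 2 =
   innerA (phi \o circ r1) (phi \o circ r1).
  by apply: eq_Rintegral => t _; rewrite expr2.
have cfst : continuous_on_annulus r1 r2 fst by exact: continuous_on_annulus_fst.
have csnd : continuous_on_annulus r1 r2 snd by exact: continuous_on_annulus_snd.
have ck : continuous_on_annulus r1 r2 (fun=> 2 * (1 / 2) : R) by exact: continuous_on_annulus_cst.
have cw : continuous_on_annulus r1 r2 (radial_weight (1 / 2) (- (r2 ^+ 2 / 2))).
  exact: continuous_radial_weight.
have cF := continuous_on_annulusD (continuous_on_annulusM cw
  (continuous_on_annulusD (continuous_on_annulusM cfst cd1) (continuous_on_annulusM csnd cd2)))
  (continuous_on_annulusM ck cp2).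
have iF := continuous_on_annulus_integrable cF.
have ch : continuous_on_annulus r1 r2 (fun=> 1 / 2 : R) by exact: continuous_on_annulus_cst.
have cK : continuous_on_annulus r1 r2 (fun=> poincare_const / 2) by exact: continuous_on_annulus_cst.
have cDD := continuous_on_annulusD (continuous_on_annulusM cD1 cD1) (continuous_on_annulusM cD2 cD2).
have cpp := continuous_on_annulusM cphi cphi.
have iG := continuous_on_annulus_integrable (continuous_on_annulusB
  (continuous_on_annulusM ch cpp) (continuous_on_annulusM cK cDD)).
have ipp := continuous_on_annulus_integrable cpp.
have ihp := continuous_on_annulus_integrable (continuous_on_annulusM ch cpp).
have iKD := continuous_on_annulus_integrable (continuous_on_annulusM cK cDD).
have iDD := continuous_on_annulus_integrable cDD.
have i1 := continuous_on_annulus_integrable (continuous_on_annulusM cD1 cD1).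
have i2 := continuous_on_annulus_integrable (continuous_on_annulusM cD2 cD2).
set I := \int[_]_(_ in _) _ => IE.
have : 1 / 2 * inner2 phi phi - poincare_const / 2 * (inner2 D1 D1 + inner2 D2 D2) <= I.
  rewrite /inner -RintegralD; [|exact: mOm|exact: i1|exact: i2].
  rewrite -[X in X - _ <= _]RintegralZl; [|exact: mOm|exact: ipp].
  rewrite -[X in _ - X <= _]RintegralZl; [|exact: mOm|exact: iDD].
  rewrite -RintegralB; [|exact: mOm|exact: ihp|exact: iKD].
  apply: le_Rintegral; [exact: mOm|exact: iG|exact: iF|].
  move=> x Omx; rewrite -!expr2; apply: radial_young => //.
  rewrite -/(sqr_radius x) sqr_radiusE.
  have /andP[r1x xr2] := Omx.
  by rewrite !ler_pXn2r ?nnegrE ?(ltW r1_gt0) ?(ltW r2_gt0) ?radius_ge0 ?ltW.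
rewrite IE; set A := innerA _ _; set B := inner2 _ _; set C := inner2 _ _ + _.
lra.
Qed.

(** The uniqueness principle for both boundary conditions. Each approximating
C^1 function satisfies [poincare_C1], and all the terms on the right tend
to 0. *)
Lemma H1_null d G w : H1 r1 r2 d G w ->
  inner2 (fst \o G) (fst \o G) + inner2 (snd \o G) (snd \o G) = 0 ->
  innerA (w \o circ r1) (w \o circ r1) = 0 ->
  inner2 d d = 0.
Proof.
move=> Hd G0 w0.
have [sd sG1 sG2 sw1 sw2] := H1_sqi Hd.
have [phi [C1phi cv c1 c2 cw]] := H1_approx r1_gt0 r1_lt_r2 Hd.
have cw1 := cw r1 (or_introl erefl).
have sphi n : sqi (phi n) by have [_ ? _ _] := C1phi n; exact: sqi_continuous.
have sD1 n : sqi ('D_e1 (phi n)) by have [_ _ ? _] := C1phi n; exact: sqi_continuous.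
have sD2 n : sqi ('D_e2 (phi n)) by have [_ _ _ ?] := C1phi n; exact: sqi_continuous.
have sc1 n : square_integrable leb (@angles R) (phi n \o circ r1).
  have [_ cphi _ _] := C1phi n; exact: (sqi_circ r1_gt0 r11 cphi).
have l0 := L2_cvg_inner mOm sd sphi cv.
have l1 := L2_cvg_inner mOm sG1 sD1 c1.
have l2 := L2_cvg_inner mOm sG2 sD2 c2.
have l3 := L2_cvg_inner mA sw1 sc1 cw1.
have K0 : 0 <= poincare_const by rewrite /poincare_const mulr_ge0 ?sqr_ge0.
have A0 : 0 <= r2 ^+ 2 - r1 ^+ 2.
  by rewrite subr_ge0 ler_pXn2r ?nnegrE ?ltW.
apply/eqP; rewrite eq_le inner_ge0 andbT.
(* By the parallelogram inequality, the norm of d is bounded by that of phi n and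
   their distance; the gradient and trace of phi n are in turn bounded by their
   distances to G and w, which are null. *)
pose E n : R := 2 * inner2 (fun x => phi n x - d x) (fun x => phi n x - d x) +
  2 * ((r2 ^+ 2 - r1 ^+ 2) * (2 * innerA (fun t => (phi n \o circ r1) t - (w \o circ r1) t)
                                        (fun t => (phi n \o circ r1) t - (w \o circ r1) t)) +
       poincare_const *
         (2 * inner2 (fun x => 'D_e1 (phi n) x - (fst \o G) x)
                     (fun x => 'D_e1 (phi n) x - (fst \o G) x) +
          2 * inner2 (fun x => 'D_e2 (phi n) x - (snd \o G) x)
                     (fun x => 'D_e2 (phi n) x - (snd \o G) x))).
have lE : E @ \oo --> (2 * 0 + 2 * ((r2 ^+ 2 - r1 ^+ 2) * (2 * 0) +
   poincare_const * (2 * 0 + 2 * 0)) : R).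
  apply: cvgD; first exact: (cvgM (cvg_cst _) l0).
  apply: (cvgM (cvg_cst _)); apply: cvgD.
    by apply: (cvgM (cvg_cst _)); exact: (cvgM (cvg_cst _) l3).
  apply: (cvgM (cvg_cst _)); apply: cvgD; first exact: (cvgM (cvg_cst _) l1).
  exact: (cvgM (cvg_cst _) l2).
move: lE; rewrite !(mulr0, addr0) => lE.
have dE n : inner2 d d <= E n.
  have h0 := inner_le_sub mOm sd (sphi n).
  have h1 := inner_le_sub mOm (sD1 n) sG1.
  have h2 := inner_le_sub mOm (sD2 n) sG2.
  have h3 := inner_le_sub mA (sc1 n) sw1.
  have h4 := poincare_C1 (C1phi n).
  rewrite w0 mulr0 addr0 inner_subC in h3.
  rewrite inner_subC in h1; rewrite inner_subC in h2.
  apply: (le_trans h0); rewrite /E lerD2l ler_wpM2l//.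
  apply: (le_trans h4); apply: lerD; apply: ler_wpM2l => //.
  by apply: (le_trans (lerD h1 h2)); rewrite addrACA -[X in _ + X <= _]mulrDr G0 mulr0 addr0.
exact: (ler_cvg_to (cvg_cst _) lE (nearW _ dE)).
Qed.

End poincare.

(** * Differences of H1 functions *)

Section H1_linear.
Variable R : realType.
Variables r1 r2 : R.
Hypotheses (r1_gt0 : 0 < r1) (r1_lt_r2 : r1 < r2).
Notation leb := (@lebesgue_measure R).
Notation Om := (annulus r1 r2).
Local Notation e1 := ((1, 0) : R * R).
Local Notation e2 := ((0, 1) : R * R).
Implicit Types (f u v phi psi : R * R -> R) (G : R * R -> R * R) (x : R * R).

Local Notation sqi := (square_integrable (@leb2 R) Om).

Let r11 : r1 <= r1 <= r2. Proof. by rewrite lexx ltW. Qed.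
Let r22 : r1 <= r2 <= r2. Proof. by rewrite lexx ltW. Qed.
Let mOm : measurable (Om : set (measurableTypeR R * measurableTypeR R)).
Proof. exact: measurable_annulus. Qed.
Let mA : measurable (@angles R : set (measurableTypeR R)).
Proof. exact: measurable_angles. Qed.

(** Needed because the derivative operator is a choice of limit: partial
derivatives are identified with explicit functions only on an open set. *)
Lemma near_eq_continuous (T : topologicalType) (f g : T -> R) (x : T) :
  (\forall y \near x, f y = g y) -> {for x, continuous g} -> {for x, continuous f}.
Proof.
move=> fg cg; rewrite /prop_for /continuous_at (nbhs_singleton fg).
apply: cvg_trans cg; apply: near_eq_cvg.
by apply: filterS fg => y ->.
Qed.

Lemma C1_closure_sub phi psi : C1_closure Om phi -> C1_closure Om psi ->
  C1_closure Om (fun x => phi x - psi x).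
Proof.
move=> [U [oU OmU [/= cphi [dphi [cD1 _] [cD2 _]]]]].
move=> [V [oV OmV [/= cpsi [dpsi [cE1 _] [cE2 _]]]]].
have oUV : open (U `&` V) by exact: openI.
have nUV x : (U `&` V) x -> nbhs x (U `&` V) by move=> ?; exact: open_nbhs_nbhs.
exists (U `&` V); split => //; first by rewrite subsetI.
have DE i x : derivable phi x i -> derivable psi x i ->
    is_derive x i (fun x => phi x - psi x) ('D_i phi x - 'D_i psi x).
  move=> dp dq.
  exact: (is_derive_subE (DeriveDef dp erefl) (DeriveDef dq erefl)).
split; first by move=> x [Ux Vx]; apply: cvgB; [exact: cphi|exact: cpsi].
split.
- move=> x [/dphi[p1 p2] /dpsi[q1 q2]].
  by split; [exact: (ex_derive (is_derive := DE _ _ p1 q1))|exact: (ex_derive (is_derive := DE _ _ p2 q2))].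
- split=> // x UVx; have [Ux Vx] := UVx.
  apply: (@near_eq_continuous _ _ (fun x => 'D_e1 phi x - 'D_e1 psi x)).
    by have := nUV x UVx; apply: filterS => y [/dphi[p1 p2] /dpsi[q1 q2]];
      exact: (derive_val (is_derive := DE _ _ p1 q1)).
  by apply: cvgB; [exact: cD1|exact: cE1].
- split=> // x UVx; have [Ux Vx] := UVx.
  apply: (@near_eq_continuous _ _ (fun x => 'D_e2 phi x - 'D_e2 psi x)).
    by have := nUV x UVx; apply: filterS => y [/dphi[p1 p2] /dpsi[q1 q2]];
      exact: (derive_val (is_derive := DE _ _ p2 q2)).
  by apply: cvgB; [exact: cD2|exact: cE2].
Qed.

Lemma test_function_continuous phi : test_function Om phi ->
  [/\ continuous_on_annulus r1 r2 phi, continuous_on_annulus r1 r2 ('D_e1 phi) &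
      continuous_on_annulus r1 r2 ('D_e2 phi)].
Proof.
move=> [/(_ 1%N) [/= cphi [_ [c1 _] [c2 _]]] _ _].
by split => x _; [exact: cphi|exact: c1|exact: c2].
Qed.

Lemma weak_gradient_sub v Gv u Gu : sqi v -> sqi (fst \o Gv) -> sqi (snd \o Gv) ->
  sqi u -> sqi (fst \o Gu) -> sqi (snd \o Gu) ->
  weak_gradient Om v Gv -> weak_gradient Om u Gu ->
  weak_gradient Om (fun x => v x - u x) (fun x => Gv x - Gu x).
Proof.
move=> sv sGv1 sGv2 su sGu1 sGu2 Hv Hu phi tphi.
have [cphi cD1 cD2] := test_function_continuous tphi.
have sphi := sqi_continuous cphi.
have sD1 := sqi_continuous cD1.
have sD2 := sqi_continuous cD2.
have [v1 v2] := Hv _ tphi; have [u1 u2] := Hu _ tphi.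
have L f g h : sqi f -> sqi g -> sqi h ->
   \int[@leb2 R]_(x in Om) ((g x - h x) * f x) =
   \int[@leb2 R]_(x in Om) (g x * f x) - \int[@leb2 R]_(x in Om) (h x * f x).
  move=> sf sg sh; have := innerBr mOm sf sg sh; rewrite !(innerC (@leb2 R) Om f).
  by rewrite /inner.
have LG1 : \int[@leb2 R]_(x in Om) ((Gv x - Gu x).1 * phi x) =
    \int[@leb2 R]_(x in Om) ((Gv x).1 * phi x) - \int[@leb2 R]_(x in Om) ((Gu x).1 * phi x).
  exact: (L phi (fst \o Gv) (fst \o Gu)).
have LG2 : \int[@leb2 R]_(x in Om) ((Gv x - Gu x).2 * phi x) =
    \int[@leb2 R]_(x in Om) ((Gv x).2 * phi x) - \int[@leb2 R]_(x in Om) ((Gu x).2 * phi x).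
  exact: (L phi (snd \o Gv) (snd \o Gu)).
split.
- by rewrite (L _ _ _ sD1 sv su) v1 u1 LG1 opprB opprK addrC.
- by rewrite (L _ _ _ sD2 sv su) v2 u2 LG2 opprB opprK addrC.
Qed.

(** The converse of [H1_approx_closure]: approximation of each partial derivative
gives approximation of the gradient. *)
Lemma trace_of_intro v G w (phi : nat -> R * R -> R) :
  sqi (fst \o G) -> sqi (snd \o G) ->
  (forall n, C1_closure Om (phi n)) ->
  L2_cvg (@leb2 R) Om phi v ->
  L2_cvg (@leb2 R) Om (fun n => 'D_e1 (phi n)) (fst \o G) ->
  L2_cvg (@leb2 R) Om (fun n => 'D_e2 (phi n)) (snd \o G) ->
  (forall r, r = r1 \/ r = r2 ->
    L2_cvg leb (@angles R) (fun n => phi n \o circ r) (w \o circ r)) ->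
  trace_of r1 r2 v G w.
Proof.
move=> sG1 sG2 C1phi cv c1 c2 cw; exists phi; split => //.
have C1 n := C1_closure_C1_annulus r1_gt0 r1_lt_r2 (C1phi n).
have mG1 : measurable_fun (Om : set (measurableTypeR R * measurableTypeR R)) (fst \o G) by case: sG1.
have mG2 : measurable_fun (Om : set (measurableTypeR R * measurableTypeR R)) (snd \o G) by case: sG2.
have mD1 n : measurable_fun (Om : set (measurableTypeR R * measurableTypeR R)) ('D_e1 (phi n)).
  by have [_ _ cD1 _] := C1 n; exact: continuous_on_annulus_measurable.
have mD2 n : measurable_fun (Om : set (measurableTypeR R * measurableTypeR R)) ('D_e2 (phi n)).
  by have [_ _ _ cD2] := C1 n; exact: continuous_on_annulus_measurable.
have hE n : (\int[@leb2 R]_(x in Om)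
      (dot (grad (phi n) x - G x) (grad (phi n) x - G x))%:E)%E =
    (\int[@leb2 R]_(x in Om) (('D_e1 (phi n) x - (fst \o G) x) ^+ 2)%:E +
     \int[@leb2 R]_(x in Om) (('D_e2 (phi n) x - (snd \o G) x) ^+ 2)%:E)%E.
  rewrite -ge0_integralD.
  - by apply: eq_integral => x _; rewrite !expr2.
  - exact: mOm.
  - by move=> x _; rewrite lee_fin sqr_ge0.
  - apply/measurable_EFinP; apply: measurable_funX; exact: (measurable_funB (mD1 n) mG1).
  - by move=> x _; rewrite lee_fin sqr_ge0.
  - apply/measurable_EFinP; apply: measurable_funX; exact: (measurable_funB (mD2 n) mG2).
under eq_fun do rewrite hE.
have H := cvgeD _ c1 c2.
by rewrite adde0 in H; apply: H.
Qed.

(** The difference of two solutions is an admissible test function, which is how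
uniqueness is proved. *)
Lemma H1_sub v Gv wv u Gu wu : H1 r1 r2 v Gv wv -> H1 r1 r2 u Gu wu ->
  H1 r1 r2 (fun x => v x - u x) (fun x => Gv x - Gu x) (fun x => wv x - wu x).
Proof.
move=> Hv Hu.
have [sv sGv1 sGv2 swv1 swv2] := H1_sqi Hv.
have [su sGu1 sGu2 swu1 swu2] := H1_sqi Hu.
have [_ _ wgv _ _] := Hv.
have [_ _ wgu _ _] := Hu.
split.
- exact: sqi_sub.
- by split; [exact: (sqi_sub mOm sGv1 sGu1)|exact: (sqi_sub mOm sGv2 sGu2)].
- exact: weak_gradient_sub.
- by split; [exact: (sqi_sub mA swv1 swu1)|exact: (sqi_sub mA swv2 swu2)].
have [phi [C1phi cphi c1 c2 cw]] := H1_approx_closure r1_gt0 r1_lt_r2 Hv.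
have [psi [C1psi cpsi d1 d2 dw]] := H1_approx_closure r1_gt0 r1_lt_r2 Hu.
have A n := C1_closure_C1_annulus r1_gt0 r1_lt_r2 (C1phi n).
have B n := C1_closure_C1_annulus r1_gt0 r1_lt_r2 (C1psi n).
apply: (@trace_of_intro _ _ _ (fun n x => phi n x - psi n x)).
- exact: (sqi_sub mOm sGv1 sGu1).
- exact: (sqi_sub mOm sGv2 sGu2).
- by move=> n; exact: C1_closure_sub.
- apply: L2_cvg_sub => //.
  + by move=> n; have [_ ? _ _] := A n; exact: sqi_continuous.
  + by move=> n; have [_ ? _ _] := B n; exact: sqi_continuous.
- have E n x : Om x -> 'D_e1 (fun x => phi n x - psi n x) x =
      'D_e1 (phi n) x - 'D_e1 (psi n) x.
    move=> /[dup] /(annulus_C1_derivable (A n))[p1 _] /(annulus_C1_derivable (B n))[q1 _].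
    exact: (derive_val (is_derive := is_derive_subE p1 q1)).
  apply: L2_cvg_eq; first exact: E.
  apply: (L2_cvg_sub mOm _ _ _ _ c1 d1).
  + by move=> n; have [_ _ ? _] := A n; exact: sqi_continuous.
  + by move=> n; have [_ _ ? _] := B n; exact: sqi_continuous.
  + exact: sGv1.
  + exact: sGu1.
- have E n x : Om x -> 'D_e2 (fun x => phi n x - psi n x) x =
      'D_e2 (phi n) x - 'D_e2 (psi n) x.
    move=> /[dup] /(annulus_C1_derivable (A n))[_ p1] /(annulus_C1_derivable (B n))[_ q1].
    exact: (derive_val (is_derive := is_derive_subE p1 q1)).
  apply: L2_cvg_eq; first exact: E.
  apply: (L2_cvg_sub mOm _ _ _ _ c2 d2).
  + by move=> n; have [_ _ _ ?] := A n; exact: sqi_continuous.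
  + by move=> n; have [_ _ _ ?] := B n; exact: sqi_continuous.
  + exact: sGv2.
  + exact: sGu2.
- move=> r rr.
  have r12 : r1 <= r <= r2 by case: rr => ->.
  apply: (@L2_cvg_sub _ _ _ leb (@angles R) mA (fun n => phi n \o circ r)
    (fun n => psi n \o circ r)).
  + by move=> n; have [_ ca _ _] := A n; exact: (sqi_circ r1_gt0 r12 ca).
  + by move=> n; have [_ ca _ _] := B n; exact: (sqi_circ r1_gt0 r12 ca).
  + by case: rr => ->.
  + by case: rr => ->.
  + exact: cw.
  + exact: dw.
Qed.

End H1_linear.

(** * Explicit radial functions *)

Section radial_state.
Variable R : realType.
Variables r1 r2 : R.
Hypotheses (r1_gt0 : 0 < r1) (r1_lt_r2 : r1 < r2).
Notation leb := (@lebesgue_measure R).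
Notation Om := (annulus r1 r2).
Local Notation e1 := ((1, 0) : R * R).
Local Notation e2 := ((0, 1) : R * R).
Implicit Types (f u v phi psi : R * R -> R) (G : R * R -> R * R) (x : R * R).

Let r2_gt0 : 0 < r2. Proof. exact: lt_trans r1_lt_r2. Qed.
Let mOm : measurable (Om : set (measurableTypeR R * measurableTypeR R)).
Proof. exact: measurable_annulus. Qed.

(** The radial functions whose Laplacian is constant, here 2 k1; written with
the square of the radius to stay differentiable without a square root. *)
Definition radial_state (c0 k1 k2 : R) x : R :=
  c0 + k1 / 2 * sqr_radius x + k2 / 2 * ln (sqr_radius x).

Lemma is_derive_fst x (w : R * R) : is_derive x w (fun y : R * R => y.1) w.1.
Proof.
apply/is_derive_line.
have := is_derive_addE (is_derive_mulE (is_derive_id (0 : R) (1 : R))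
  (is_derive_cst w.1 (0 : R) (1 : R))) (is_derive_cst x.1 (0 : R) (1 : R)).
by rewrite /= mul0r mulr1 add0r addr0.
Qed.

Lemma is_derive_snd x (w : R * R) : is_derive x w (fun y : R * R => y.2) w.2.
Proof.
apply/is_derive_line.
have := is_derive_addE (is_derive_mulE (is_derive_id (0 : R) (1 : R))
  (is_derive_cst w.2 (0 : R) (1 : R))) (is_derive_cst x.2 (0 : R) (1 : R)).
by rewrite /= mul0r mulr1 add0r addr0.
Qed.

Lemma is_derive_sqr_radius x (w : R * R) :
  is_derive x w (@sqr_radius R) (2 * (x.1 * w.1 + x.2 * w.2)).
Proof.
have := is_derive_addE (is_derive_sqrE (is_derive_fst x w))
  (is_derive_sqrE (is_derive_snd x w)).
by congr is_derive; ring.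
Qed.

Lemma is_derive_radial_state c0 k1 k2 x (w : R * R) : 0 < sqr_radius x ->
  is_derive x w (radial_state c0 k1 k2)
    (radial_weight k1 k2 x * (x.1 * w.1 + x.2 * w.2)).
Proof.
move=> s0; have ds := is_derive_sqr_radius x w.
have := is_derive_addE (is_derive_addE (is_derive_cst c0 x w)
  (is_derive_scaleE ds (k1 / 2))) (is_derive_scaleE (is_derive_lnE ds s0) (k2 / 2)).
by congr is_derive; rewrite /radial_weight; field; rewrite gt_eqF.
Qed.

Definition radial_state_grad (k1 k2 : R) x : R * R :=
  (radial_weight k1 k2 x * x.1, radial_weight k1 k2 x * x.2).

Lemma is_derive_radial_state1 c0 k1 k2 x : 0 < sqr_radius x ->
  is_derive x e1 (radial_state c0 k1 k2) (radial_state_grad k1 k2 x).1.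
Proof.
move=> /(@is_derive_radial_state c0 k1 k2 x e1); congr is_derive.
by rewrite /= mulr1 mulr0 addr0.
Qed.

Lemma is_derive_radial_state2 c0 k1 k2 x : 0 < sqr_radius x ->
  is_derive x e2 (radial_state c0 k1 k2) (radial_state_grad k1 k2 x).2.
Proof.
move=> /(@is_derive_radial_state c0 k1 k2 x e2); congr is_derive.
by rewrite /= mulr1 mulr0 add0r.
Qed.

Lemma continuous_radial_weight_at k1 k2 x : 0 < sqr_radius x ->
  {for x, continuous (radial_weight k1 k2)}.
Proof.
move=> s0; apply: cvgD; first exact: cvg_cst.
apply: cvgM; first exact: cvg_cst.
by apply: cvgV; [rewrite gt_eqF|exact: continuous_sqr_radius].
Qed.

Lemma continuous_radial_state_at c0 k1 k2 x : 0 < sqr_radius x ->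
  {for x, continuous (radial_state c0 k1 k2)}.
Proof.
move=> s0; apply: cvgD.
  apply: cvgD; first exact: cvg_cst.
  apply: cvgM; first exact: cvg_cst.
  exact: continuous_sqr_radius.
apply: cvgM; first exact: cvg_cst.
apply: (continuous_comp (f := @sqr_radius R) (g := @ln R)).
  exact: continuous_sqr_radius.
exact: continuous_ln.
Qed.

Lemma continuous_radial_state c0 k1 k2 :
  continuous_on_annulus r1 r2 (radial_state c0 k1 k2).
Proof.
by move=> x /(closed_annulus_sqr_radius_gt0 r1_gt0); exact: continuous_radial_state_at.
Qed.

Lemma C1_closure_radial_state c0 k1 k2 :
  C1_closure Om (radial_state c0 k1 k2).
Proof.
pose U : set (R * R) := [set x | 0 < sqr_radius x].
have oU : open U.
  rewrite (_ : U = @sqr_radius R @^-1` `]0, +oo[%classic); last first.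
    by apply/seteqP; split => x; rewrite /U/= in_itv/= andbT.
  have /continuousP := @continuous_sqr_radius R; apply; exact: interval_open.
have nU x : U x -> nbhs x U by move=> ?; exact: open_nbhs_nbhs.
exists U; split => //.
  by rewrite closure_annulus//; exact: closed_annulus_sqr_radius_gt0.
split; first by move=> x; exact: continuous_radial_state_at.
split.
- move=> x Ux; split.
    exact: (ex_derive (is_derive := is_derive_radial_state1 c0 k1 k2 Ux)).
  exact: (ex_derive (is_derive := is_derive_radial_state2 c0 k1 k2 Ux)).
- split => // x Ux.
  apply: (@near_eq_continuous _ _ _ (fun x => radial_weight k1 k2 x * x.1)).
    have := nU _ Ux; apply: filterS => y Uy.
    exact: (derive_val (is_derive := is_derive_radial_state1 c0 k1 k2 Uy)).
  apply: cvgM; first exact: continuous_radial_weight_at.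
  exact: continuous_fst_plane.
- split => // x Ux.
  apply: (@near_eq_continuous _ _ _ (fun x => radial_weight k1 k2 x * x.2)).
    have := nU _ Ux; apply: filterS => y Uy.
    exact: (derive_val (is_derive := is_derive_radial_state2 c0 k1 k2 Uy)).
  apply: cvgM; first exact: continuous_radial_weight_at.
  exact: continuous_snd_plane.
Qed.

Lemma not_annulus_coord x : r2 <= `|x.1| \/ r2 <= `|x.2| -> ~ Om x.
Proof.
move=> h /andP[_ xr2]; have [x1 x2] := le_coord_radius x.
case: h => /le_trans.
  by move=> /(_ _ x1) /le_lt_trans => /(_ _ xr2); rewrite ltxx.
by move=> /(_ _ x2) /le_lt_trans => /(_ _ xr2); rewrite ltxx.
Qed.

(** A continuous function that vanishes off the annulus can be integrated over
the whole plane, in either order. *)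
Lemma integral_annulus_slices (W : R * R -> R) : continuous W ->
  (forall x, ~ Om x -> W x = 0) ->
  (\int[@leb2 R]_(x in Om) (W x)%:E = \int[leb]_x \int[leb]_y (W (x, y))%:E)%E /\
  (\int[@leb2 R]_(x in Om) (W x)%:E = \int[leb]_y \int[leb]_x (W (x, y))%:E)%E.
Proof.
move=> cW W0.
have WE : (fun x => (W x)%:E) \_ Om = (fun x => (W x)%:E).
  apply/funext => x; rewrite patchE; case: ifPn => //.
  by rewrite notin_setE => /W0 ->.
have iW : (@leb2 R).-integrable setT (fun x => (W x)%:E).
  rewrite -WE; apply/integrable_restrict; [exact: mOm|exact: measurableT|].
  rewrite setTI; apply: continuous_on_annulus_integrable.
  by move=> x _; exact: cW.
rewrite integral_mkcond WE; split.
  by rewrite -(integral12_prod_meas1 (m1 := leb) (m2 := leb) iW).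
by rewrite -(integral21_prod_meas1 (m1 := leb) (m2 := leb) iW).
Qed.

Lemma integral_line_derivative (F f : R -> R) :
  (forall z : R, is_derive z 1 F (f z)) -> continuous f ->
  (forall z, r2 <= `|z| -> F z = 0 /\ f z = 0) ->
  (\int[leb]_z (f z)%:E = 0)%E.
Proof.
move=> dF cf F0.
have -> : (\int[leb]_z (f z)%:E = \int[leb]_(z in `[(- r2)%R, r2]) (f z)%:E)%E.
  rewrite [RHS]integral_mkcond; apply: eq_integral => z _.
  rewrite patchE; case: ifPn => //; rewrite notin_setE/= in_itv/= => /negP.
  rewrite negb_and -!ltNge => zr.
  have [//|_ ->//] := F0 z; move: zr => /orP[zr|zr].
    by rewrite ler0_norm; move: (r2_gt0); lra.
  by rewrite ger0_norm; move: (r2_gt0); lra.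
rewrite (@integral_is_derive R F).
- by rewrite !(F0 _ _).1 ?subrr// ?normrN ger0_norm// ltW.
- by move: (r2_gt0); lra.
- by move=> z _; exact: cf.
Qed.

Lemma continuous_slice1 (W : R * R -> R) (y : R) : continuous W ->
  continuous (fun z : R => W (z, y)).
Proof.
move=> cW z; apply: (continuous_comp (f := fun z : R => (z, y)) (g := W)).
  apply: (@cvg_pair _ _ _ (nbhs z) (nbhs z) (nbhs y) _ _ _ id (fun=> y)).
    exact: cvg_id.
  exact: cvg_cst.
exact: cW.
Qed.

Lemma continuous_slice2 (W : R * R -> R) (y : R) : continuous W ->
  continuous (fun z : R => W (y, z)).
Proof.
move=> cW z; apply: (continuous_comp (f := fun z : R => (y, z)) (g := W)).
  apply: (@cvg_pair _ _ _ (nbhs z) (nbhs y) (nbhs z) _ _ _ (fun=> y) id).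
    exact: cvg_cst.
  exact: cvg_id.
exact: cW.
Qed.

(** The integral of a partial derivative of a compactly supported function is 0:
integrate first along the direction of the derivative. *)
Lemma integral_partial1 (Psi W : R * R -> R) :
  (forall x, is_derive x e1 Psi (W x)) -> continuous W ->
  (forall x, ~ Om x -> Psi x = 0 /\ W x = 0) ->
  \int[@leb2 R]_(x in Om) W x = 0.
Proof.
move=> dPsi cW out; rewrite /Rintegral.
have [_ ->] := integral_annulus_slices cW (fun x Hx => (out x Hx).2).
rewrite integral0_eq// => y _.
apply: (@integral_line_derivative (fun z => Psi (z, y)) (fun z => W (z, y))).
- by move=> z; exact: (is_derive_slice1 (dPsi (z, y))).
- exact: continuous_slice1.
- by move=> z zr2; apply: out; apply: not_annulus_coord; left.
Qed.

Lemma integral_partial2 (Psi W : R * R -> R) :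
  (forall x, is_derive x e2 Psi (W x)) -> continuous W ->
  (forall x, ~ Om x -> Psi x = 0 /\ W x = 0) ->
  \int[@leb2 R]_(x in Om) W x = 0.
Proof.
move=> dPsi cW out; rewrite /Rintegral.
have [-> _] := integral_annulus_slices cW (fun x Hx => (out x Hx).2).
rewrite integral0_eq// => y _.
apply: (@integral_line_derivative (fun z => Psi (y, z)) (fun z => W (y, z))).
- by move=> z; exact: (is_derive_slice2 (dPsi (y, z))).
- exact: continuous_slice2.
- by move=> z zr2; apply: out; apply: not_annulus_coord; right.
Qed.

Lemma test_function_near0 phi x : test_function Om phi -> ~ Om x ->
  \forall y \near x, phi y = 0.
Proof.
move=> [_ _ suppOm] nOmx.
have nx : ~ closure [set x | phi x != 0] x by move=> /suppOm.
have : nbhs x (~` closure [set x | phi x != 0]).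
  by apply: open_nbhs_nbhs; split => //; rewrite openC; exact: closed_closure.
apply: filterS => y ny; apply: contrapT => /eqP phiy.
by apply: ny; exact: subset_closure.
Qed.

Lemma near0_derive phi x (w : R * R) : (\forall y \near x, phi y = 0) ->
  is_derive x w phi 0.
Proof.
move=> phi0; apply: (@near_eq_is_derive _ _ _ (fun=> 0)).
  by apply: filterS phi0 => y ->.
Qed.

(** The product of the radial function, or of its gradient, with a test function
extends by 0 to the plane. The radial function is singular at the origin, which
is why points with 0 < |x| and points outside the annulus are treated
separately: near the latter the test function vanishes. *)
Lemma radial_state_test (i : R * R) (Gi : R * R -> R) u phi :
  (forall x, 0 < sqr_radius x -> is_derive x i u (Gi x)) ->
  (forall x, 0 < sqr_radius x -> {for x, continuous u}) ->
  (forall x, 0 < sqr_radius x -> {for x, continuous Gi}) ->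
  (forall x, derivable phi x i) -> continuous phi -> continuous ('D_i phi) ->
  test_function Om phi ->
  let W := fun x => u x * 'D_i phi x + phi x * Gi x in
  [/\ forall x, is_derive x i (fun x => u x * phi x) (W x), continuous W &
      forall x, ~ Om x -> u x * phi x = 0 /\ W x = 0].
Proof.
move=> du cu cG dphi cphi cD tphi W.
have D0 x : ~ Om x -> \forall y \near x, phi y = 0 /\ 'D_i phi y = 0.
  move=> /(test_function_near0 tphi) phi0.
  have := near_join phi0; apply: filterS2 phi0 => y y0 ny; split => //.
  exact: (derive_val (is_derive := near0_derive i ny)).
have s0 x : ~ 0 < sqr_radius x -> ~ Om x.
  by move=> ns Omx; apply: ns;
    apply: (closed_annulus_sqr_radius_gt0 r1_gt0 (r2 := r2)); exact: annulus_closed_annulus.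
split.
- move=> x; have [sx|/s0 nOm] := pselect (0 < sqr_radius x).
    by have := is_derive_mulE (du x sx) (DeriveDef (dphi x) erefl).
  have xD := D0 _ nOm; have [x0 Dx0] := nbhs_singleton xD.
  rewrite /W x0 Dx0 mulr0 mul0r addr0; apply: near0_derive.
  by apply: filterS xD => y [-> _]; rewrite mulr0.
- move=> x; have [sx|/s0 nOm] := pselect (0 < sqr_radius x).
    apply: cvgD; apply: cvgM; [exact: cu|exact: cD|exact: cphi|exact: cG].
  apply: (@near_eq_continuous _ _ _ (fun=> 0)); last exact: cvg_cst.
  by apply: filterS (D0 _ nOm) => y [y0 Dy0]; rewrite /W y0 Dy0 mulr0 mul0r addr0.
- move=> x /D0 xD; have [x0 Dx0] := nbhs_singleton xD.
  by rewrite /W x0 Dx0 mulr0 mul0r addr0.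
Qed.

(** Integration by parts: the integral of the derivative of u phi vanishes. *)
Lemma weak_gradient_radial_state c0 k1 k2 :
  weak_gradient Om (radial_state c0 k1 k2) (radial_state_grad k1 k2).
Proof.
move=> phi tphi; have [/(_ 1%N) [/= cphi [dphi [cD1 _] [cD2 _]]] _ _] := tphi.
have cphi' : continuous phi by move=> x; exact: cphi.
have cD1' : continuous ('D_e1 phi) by move=> x; exact: cD1.
have cD2' : continuous ('D_e2 phi) by move=> x; exact: cD2.
have cu x (sx : 0 < sqr_radius x) := @continuous_radial_state_at c0 k1 k2 x sx.
have cG1 x : 0 < sqr_radius x -> {for x, continuous (fun x => (radial_state_grad k1 k2 x).1)}.
  move=> sx; apply: cvgM; first exact: continuous_radial_weight_at.
  exact: continuous_fst_plane.
have cG2 x : 0 < sqr_radius x -> {for x, continuous (fun x => (radial_state_grad k1 k2 x).2)}.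
  move=> sx; apply: cvgM; first exact: continuous_radial_weight_at.
  exact: continuous_snd_plane.
have toK f : (forall x, 0 < sqr_radius x -> {for x, continuous f}) ->
    continuous_on_annulus r1 r2 f.
  by move=> cf x /(closed_annulus_sqr_radius_gt0 r1_gt0); exact: cf.
have toK' f : continuous f -> continuous_on_annulus r1 r2 f by move=> cf x _; exact: cf.
have split_int a b c d : continuous_on_annulus r1 r2 a -> continuous_on_annulus r1 r2 b ->
    continuous_on_annulus r1 r2 c -> continuous_on_annulus r1 r2 d ->
    \int[@leb2 R]_(x in Om) (a x * b x + c x * d x) = 0 ->
    \int[@leb2 R]_(x in Om) (a x * b x) = - \int[@leb2 R]_(x in Om) (d x * c x).
  move=> ca cb cc cd.
  have i1 := continuous_on_annulus_integrable (continuous_on_annulusM ca cb).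
  have i2 := continuous_on_annulus_integrable (continuous_on_annulusM cc cd).
  rewrite RintegralD; [|exact: mOm|exact: i1|exact: i2].
  move/eqP; rewrite addr_eq0 => /eqP ->; congr (- _).
  by apply: eq_Rintegral => x _; rewrite mulrC.
split.
- have [dW cW W0] := radial_state_test (@is_derive_radial_state1 c0 k1 k2) cu cG1
    (fun x => (dphi x Logic.I).1) cphi' cD1' tphi.
  apply: (split_int _ ('D_e1 phi) phi (fun x => (radial_state_grad k1 k2 x).1)).
  + exact: (toK _ cu).
  + exact: (toK' _ cD1').
  + exact: (toK' _ cphi').
  + exact: (toK _ cG1).
  + exact: integral_partial1 dW cW W0.
- have [dW cW W0] := radial_state_test (@is_derive_radial_state2 c0 k1 k2) cu cG2
    (fun x => (dphi x Logic.I).2) cphi' cD2' tphi.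
  apply: (split_int _ ('D_e2 phi) phi (fun x => (radial_state_grad k1 k2 x).2)).
  + exact: (toK _ cu).
  + exact: (toK' _ cD2').
  + exact: (toK' _ cphi').
  + exact: (toK _ cG2).
  + exact: integral_partial2 dW cW W0.
Qed.

End radial_state.

(** * Existence and uniqueness of the states *)

Section states.
Variable R : realType.
Variables r1 r2 : R.
Hypotheses (r1_gt0 : 0 < r1) (r1_lt_r2 : r1 < r2).
Notation leb := (@lebesgue_measure R).
Notation Om := (annulus r1 r2).
Implicit Types (u v w : R * R -> R) (G : R * R -> R * R) (x : R * R).
Local Notation sqi := (square_integrable (@leb2 R) Om).
Local Notation sqiA := (square_integrable leb (@angles R)).
Local Notation inner2 := (inner (@leb2 R) Om).
Local Notation innerA := (inner leb (@angles R)).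

Let r11 : r1 <= r1 <= r2. Proof. by rewrite lexx ltW. Qed.
Let r22 : r1 <= r2 <= r2. Proof. by rewrite lexx ltW. Qed.
Let mOm : measurable (Om : set (measurableTypeR R * measurableTypeR R)).
Proof. exact: measurable_annulus. Qed.
Let mA : measurable (@angles R : set (measurableTypeR R)).
Proof. exact: measurable_angles. Qed.

Lemma H1_radial_state c0 k1 k2 :
  H1 r1 r2 (radial_state c0 k1 k2) (radial_state_grad k1 k2) (radial_state c0 k1 k2).
Proof.
have cu : continuous_on_annulus r1 r2 (radial_state c0 k1 k2).
  exact: continuous_radial_state.
have cw : continuous_on_annulus r1 r2 (radial_weight k1 k2).
  exact: continuous_radial_weight.
have cfst : continuous_on_annulus r1 r2 fst by exact: continuous_on_annulus_fst.
have csnd : continuous_on_annulus r1 r2 snd by exact: continuous_on_annulus_snd.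
have s1 := sqi_continuous (continuous_on_annulusM cw cfst).
have s2 := sqi_continuous (continuous_on_annulusM cw csnd).
split.
- exact: sqi_continuous.
- by split.
- exact: weak_gradient_radial_state.
- by split; [exact: (L2_circle_continuous r1_gt0 r11 cu)|exact: (L2_circle_continuous r1_gt0 r22 cu)].
have C1u := C1_closure_radial_state r1_gt0 r1_lt_r2 c0 k1 k2.
apply: (@trace_of_intro _ _ _ r1_gt0 r1_lt_r2 _ _ _ (fun=> radial_state c0 k1 k2)).
- exact: s1.
- exact: s2.
- by [].
- by apply: L2_cvg_cst => x _.
- apply: L2_cvg_cst => x Omx.
  have sx := closed_annulus_sqr_radius_gt0 r1_gt0 (annulus_closed_annulus Omx).
  exact: (derive_val (is_derive := is_derive_radial_state1 c0 k1 k2 sx)).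
- apply: L2_cvg_cst => x Omx.
  have sx := closed_annulus_sqr_radius_gt0 r1_gt0 (annulus_closed_annulus Omx).
  exact: (derive_val (is_derive := is_derive_radial_state2 c0 k1 k2 sx)).
- by move=> r _; apply: L2_cvg_cst => t _.
Qed.

Lemma dot_inner G H : sqi (fst \o G) -> sqi (snd \o G) -> sqi (fst \o H) ->
  sqi (snd \o H) -> \int[@leb2 R]_(x in Om) dot (G x) (H x) =
  inner2 (fst \o G) (fst \o H) + inner2 (snd \o G) (snd \o H).
Proof.
move=> sG1 sG2 sH1 sH2; rewrite /inner -RintegralD//.
- exact: (sqi_mul_integrable mOm sG1 sH1).
- exact: (sqi_mul_integrable mOm sG2 sH2).
Qed.

Lemma circle_int_inner r (k : R) w : sqiA (w \o circ r) ->
  circle_int r (fun x => k * w x) = r * k * innerA (fun=> 1) (w \o circ r).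
Proof.
move=> sw; rewrite /circle_int -mulrA; congr (_ * _).
rewrite -(innerZr mA)//; last exact: (sqi_cst_angles r1_gt0 r1_lt_r2).
by apply: eq_Rintegral => t _; rewrite mul1r.
Qed.

Lemma circle_int_mul r v w :
  circle_int r (fun x => v x * w x) = r * innerA (v \o circ r) (w \o circ r).
Proof. by []. Qed.

(** The equation - Lap u = g fixes the coefficient of |x|^2, and
- du/dn = q on the outer circle fixes that of the logarithm: with
r u'(r) = k1 r^2 + k2, they read 2 k1 = - g and k1 r2^2 + k2 = - q r2. *)
Definition coef_sqr (g : R) : R := - g / 2.
Definition coef_log (g q : R) : R := g * r2 ^+ 2 / 2 - q * r2.
(** The constant term is such that the value on the inner circle is [beta]. *)
Definition boundary_state (g q beta : R) : R * R -> R :=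
  radial_state (beta - coef_sqr g / 2 * r1 ^+ 2 - coef_log g q / 2 * ln (r1 ^+ 2))
    (coef_sqr g) (coef_log g q).

Lemma boundary_state_circ g q beta t : boundary_state g q beta (circ r1 t) = beta.
Proof. by rewrite /boundary_state /radial_state sqr_radius_circ; ring. Qed.

(** Green's formula for the explicit function: what is left over is the flux
through the inner circle. It is killed by test functions of zero trace in the
Dirichlet problem, and balanced by the penalty term in the Robin problem. *)
Lemma boundary_state_energy g q v Gv wv : H1 r1 r2 v Gv wv ->
  \int[@leb2 R]_(x in Om) dot (radial_state_grad (coef_sqr g) (coef_log g q) x) (Gv x) =
  \int[@leb2 R]_(x in Om) (g * v x) - circle_int r2 (fun x => q * wv x)
  - (coef_sqr g * r1 ^+ 2 + coef_log g q) * innerA (fun=> 1) (wv \o circ r1).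
Proof.
move=> Hv; have [sv sG1 sG2 sw1 sw2] := H1_sqi Hv.
have [_ sH1 sH2 _ _] := H1_sqi (H1_radial_state 0 (coef_sqr g) (coef_log g q)).
rewrite dot_inner// circle_int_inner//.
have := green_H1 r1_gt0 r1_lt_r2 (coef_sqr g) (coef_log g q) Hv.
have -> : inner2 (fun=> 2 * coef_sqr g) v = - \int[@leb2 R]_(x in Om) (g * v x).
  rewrite -[RHS]mulN1r -RintegralZl//; last first.
    apply: (sqi_mul_integrable mOm (f := fun=> g)) => //.
    by apply: sqi_continuous => //; exact: continuous_on_annulus_cst.
  by apply: eq_Rintegral => x _; rewrite /coef_sqr; field.
have -> : coef_sqr g * r2 ^+ 2 + coef_log g q = - (r2 * q).
  by rewrite /coef_sqr /coef_log; field.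
move=> E; apply/eqP; rewrite -subr_eq0; move/eqP : E; rewrite -subr_eq0 => /eqP E.
apply/eqP; rewrite -[RHS]E; ring.
Qed.

Lemma ae_on_circle_inner r c w v :
  measurable_fun (@angles R : set (measurableTypeR R)) (w \o circ r) ->
  measurable_fun (@angles R : set (measurableTypeR R)) (v \o circ r) ->
  ae_on_circle r c w -> innerA (w \o circ r) (v \o circ r) = innerA (fun=> c) (v \o circ r).
Proof.
move=> mw mv wc; congr fine; apply: ae_eq_integral.
- exact: mA.
- by apply/measurable_EFinP; exact: measurable_funM.
- by apply/measurable_EFinP; exact: measurable_funM.
- apply: (@filterS _ _ (ae_filter_ringOfSetsType leb) _ _ _ wc) => t wt At.
  by rewrite /= wt.
Qed.

Lemma inner0l d (T : measurableType d) (mu : {measure set T -> \bar R}) (D : set T)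
  (f : T -> R) : inner mu D (fun=> 0) f = 0.
Proof.
rewrite /inner /Rintegral integral0_eq// => x _; by rewrite mul0r.
Qed.

Lemma is_state_boundary g q b : is_state r1 r2 g q b (boundary_state g q b).
Proof.
exists (radial_state_grad (coef_sqr g) (coef_log g q)), (boundary_state g q b).
split; first exact: H1_radial_state.
  by apply: aeW => t _; rewrite boundary_state_circ.
move=> v Gv wv Hv wv0; rewrite (boundary_state_energy g q Hv).
have [_ _ _ sw1 _] := H1_sqi Hv.
have [mA1 _] := sqi_cst_angles r1_gt0 r1_lt_r2 1; have [mw _] := sw1.
rewrite innerC (@ae_on_circle_inner r1 0 wv (fun=> 1))// inner0l.
by rewrite mulr0 subr0.
Qed.

(** The inner outward normal derivative is - u'(r1) = - (k1 r1 + k2 / r1), so that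
the Robin condition is solved by the constant
beta = b + (k1 r1 + k2 / r1) / alpha. *)
Definition robin_value (alpha g q b : R) : R :=
  b + (coef_sqr g * r1 + coef_log g q / r1) / alpha.

Lemma is_state_alpha_boundary alpha g q b : 0 < alpha ->
  is_state_alpha r1 r2 alpha g q b (boundary_state g q (robin_value alpha g q b)).
Proof.
move=> alpha0; set beta := robin_value alpha g q b.
exists (radial_state_grad (coef_sqr g) (coef_log g q)), (boundary_state g q beta).
split; first exact: H1_radial_state.
move=> v Gv wv Hv; rewrite (boundary_state_energy g q Hv).
have [_ _ _ sw1 _] := H1_sqi Hv.
rewrite [in LHS](_ : circle_int r1 (fun x => boundary_state g q beta x * wv x) =
   circle_int r1 (fun x => beta * wv x)); last first.
  by congr (_ * _); apply: eq_Rintegral => t _; rewrite boundary_state_circ.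
rewrite !(@circle_int_inner r1)//.
rewrite /beta /robin_value; set I := innerA _ _; set A := Rintegral _ _ _; set B := circle_int _ _.
by field; rewrite !gt_eqF.
Qed.

(** Expansion of the Dirichlet energy of a difference, in the form in which the
two variational equations apply to it. *)
Lemma energy_sub Gu Gv : sqi (fst \o Gu) -> sqi (snd \o Gu) ->
  sqi (fst \o Gv) -> sqi (snd \o Gv) ->
  let Gd := fun x => Gu x - Gv x in
  inner2 (fst \o Gd) (fst \o Gd) + inner2 (snd \o Gd) (snd \o Gd) =
  \int[@leb2 R]_(x in Om) dot (Gu x) (Gd x) - \int[@leb2 R]_(x in Om) dot (Gv x) (Gd x).
Proof.
move=> sGu1 sGu2 sGv1 sGv2 Gd.
have sGd1 : sqi (fst \o Gd) by exact: (sqi_sub mOm sGu1 sGv1).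
have sGd2 : sqi (snd \o Gd) by exact: (sqi_sub mOm sGu2 sGv2).
rewrite !dot_inner//.
have -> : inner2 (fst \o Gd) (fst \o Gd) =
    inner2 (fst \o Gd) (fst \o Gu) - inner2 (fst \o Gd) (fst \o Gv).
  exact: (innerBr mOm sGd1 sGu1 sGv1).
have -> : inner2 (snd \o Gd) (snd \o Gd) =
    inner2 (snd \o Gd) (snd \o Gu) - inner2 (snd \o Gd) (snd \o Gv).
  exact: (innerBr mOm sGd2 sGu2 sGv2).
rewrite (innerC _ _ (fst \o Gu)) (innerC _ _ (snd \o Gu)).
by rewrite (innerC _ _ (fst \o Gv)) (innerC _ _ (snd \o Gv)); ring.
Qed.

(** Testing both equations with the difference shows that its energy vanishes;
its trace on the inner circle is zero, so [H1_null] concludes. *)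
Lemma is_state_unique g q b u v : is_state r1 r2 g q b u -> is_state r1 r2 g q b v ->
  inner2 (fun x => u x - v x) (fun x => u x - v x) = 0.
Proof.
move=> [Gu [wu [Hu ub eu]]] [Gv [wv [Hv vb ev]]].
have Hd := H1_sub r1_gt0 r1_lt_r2 Hu Hv.
have d0 : ae_on_circle r1 0 (fun x => wu x - wv x).
  apply: (@filterS2 _ _ (ae_filter_ringOfSetsType leb) _ _ _ _ ub vb) => t ut vt At.
  by rewrite ut// vt// subrr.
have [_ sGu1 sGu2 _ _] := H1_sqi Hu; have [_ sGv1 sGv2 _ _] := H1_sqi Hv.
have [_ _ _ sd1 _] := H1_sqi Hd.
apply: (H1_null r1_gt0 r1_lt_r2 Hd).
  by rewrite energy_sub// (eu _ _ _ Hd d0) (ev _ _ _ Hd d0) subrr.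
have [md _] := sd1.
by rewrite (@ae_on_circle_inner r1 0)// inner0l.
Qed.

(** Testing with the difference gives energy + alpha |trace|^2 = 0, a sum of
nonnegative terms. *)
Lemma is_state_alpha_unique alpha g q b u v : 0 < alpha ->
  is_state_alpha r1 r2 alpha g q b u -> is_state_alpha r1 r2 alpha g q b v ->
  inner2 (fun x => u x - v x) (fun x => u x - v x) = 0.
Proof.
move=> alpha0 [Gu [wu [Hu eu]]] [Gv [wv [Hv ev]]].
have Hd := H1_sub r1_gt0 r1_lt_r2 Hu Hv.
have [_ sGu1 sGu2 su1 _] := H1_sqi Hu; have [_ sGv1 sGv2 sv1 _] := H1_sqi Hv.
have [_ _ _ sd1 _] := H1_sqi Hd.
have := eu _ _ _ Hd; rewrite -(ev _ _ _ Hd) !circle_int_mul => E.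
have EN := energy_sub sGu1 sGu2 sGv1 sGv2.
set wd := (fun x => wu x - wv x) in Hd sd1 E *.
have NA : innerA (wd \o circ r1) (wd \o circ r1) =
    innerA (wu \o circ r1) (wd \o circ r1) - innerA (wv \o circ r1) (wd \o circ r1).
  rewrite (innerC leb (@angles R) (wu \o circ r1)) (innerC leb (@angles R) (wv \o circ r1)).
  exact: (innerBr mA sd1 su1 sv1).
have sum0 : (inner2 (fst \o (fun x => Gu x - Gv x)) (fst \o (fun x => Gu x - Gv x)) +
    inner2 (snd \o (fun x => Gu x - Gv x)) (snd \o (fun x => Gu x - Gv x))) +
    alpha * r1 * innerA (wd \o circ r1) (wd \o circ r1) = 0.
  rewrite EN NA.
  set A := Rintegral _ _ _ in E *; set B := Rintegral _ _ _ in E *.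
  set C := innerA _ _ in E *; set D := innerA _ _ in E *.
  apply/eqP; rewrite [X in X == _](_ : _ = A + alpha * (r1 * C) - (B + alpha * (r1 * D))).
    by rewrite E subrr.
  by ring.
have N0 : 0 <= inner2 (fst \o (fun x => Gu x - Gv x)) (fst \o (fun x => Gu x - Gv x)) +
    inner2 (snd \o (fun x => Gu x - Gv x)) (snd \o (fun x => Gu x - Gv x)).
  by rewrite addr_ge0// inner_ge0.
have A0 : 0 <= alpha * r1 * innerA (wd \o circ r1) (wd \o circ r1).
  by rewrite mulr_ge0 ?inner_ge0// mulr_ge0 ?ltW.
move/eqP : sum0; rewrite paddr_eq0// => /andP[/eqP Ne /eqP Ae].
apply: (H1_null r1_gt0 r1_lt_r2 Hd Ne).
by move/eqP : Ae; rewrite mulf_eq0 gt_eqF ?mulr_gt0//= => /eqP.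
Qed.

(** Functions at zero distance have the same distance to a third one. *)
Lemma inner_shift u v (k : R) : sqi u -> sqi v ->
  inner2 (fun x => u x - v x) (fun x => u x - v x) = 0 ->
  inner2 (fun x => u x - k) (fun x => u x - k) =
  inner2 (fun x => v x - k) (fun x => v x - k).
Proof.
move=> su sv uv0.
have sk : sqi (fun=> k) by apply: sqi_continuous => //; exact: continuous_on_annulus_cst.
have svk := sqi_sub mOm sv sk; have sd := sqi_sub mOm su sv.
have cs := inner_cauchy_schwarz mOm svk sd.
have c0 : inner2 (fun x => v x - k) (fun x => u x - v x) = 0.
  by apply/eqP; rewrite -sqrf_eq0 eq_le sqr_ge0 andbT (le_trans cs)// uv0 mulr0.
have -> : inner2 (fun x => u x - k) (fun x => u x - k) =
    inner2 (fun x => (v x - k) + (u x - v x)) (fun x => (v x - k) + (u x - v x)).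
  by apply: eq_Rintegral => x _; ring.
have sa := sqi_add mOm svk sd.
rewrite (innerDr mOm sa svk sd) !(innerC (@leb2 R) Om (fun x => (v x - k) + (u x - v x))).
rewrite (innerDr mOm svk svk sd) (innerDr mOm sd svk sd) uv0 c0.
by rewrite (innerC (@leb2 R) Om (fun x => u x - v x)) c0 !addr0.
Qed.

Lemma sqnormH_inner f : sqnormH r1 r2 f = inner2 f f.
Proof. by apply: eq_Rintegral => x _; rewrite expr2. Qed.

Lemma sqi_boundary_state g q beta : sqi (boundary_state g q beta).
Proof. by apply: sqi_continuous => //; exact: continuous_radial_state. Qed.

(** The state is only chosen among solutions; by uniqueness its tracking cost is
that of the explicit one. *)
Lemma sqnormH_state g q b zd :
  sqnormH r1 r2 (fun x => state r1 r2 g q b x - zd) =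
  sqnormH r1 r2 (fun x => boundary_state g q b x - zd).
Proof.
have S : is_state r1 r2 g q b (state r1 r2 g q b).
  apply: (@xgetPex _ _ [set u | is_state r1 r2 g q b u]).
  by exists (boundary_state g q b); exact: is_state_boundary.
rewrite !sqnormH_inner; apply: inner_shift.
- by have [? [? [/H1_sqi[]]]] := S.
- exact: sqi_boundary_state.
- exact: (is_state_unique S (is_state_boundary g q b)).
Qed.

Lemma sqnormH_state_alpha alpha g q b zd : 0 < alpha ->
  sqnormH r1 r2 (fun x => state_alpha r1 r2 alpha g q b x - zd) =
  sqnormH r1 r2 (fun x => boundary_state g q (robin_value alpha g q b) x - zd).
Proof.
move=> alpha0; have B := is_state_alpha_boundary g q b alpha0.
have S : is_state_alpha r1 r2 alpha g q b (state_alpha r1 r2 alpha g q b).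
  apply: (@xgetPex _ _ [set u | is_state_alpha r1 r2 alpha g q b u]).
  by exists (boundary_state g q (robin_value alpha g q b)).
rewrite !sqnormH_inner; apply: inner_shift.
- by have [? [? [/H1_sqi[]]]] := S.
- exact: sqi_boundary_state.
- exact: (is_state_alpha_unique alpha0 S B).
Qed.

End states.

(** * The tracking cost as a quadratic form in the data *)

Section costs.
Variable R : realType.
Variables r1 r2 : R.
Hypotheses (r1_gt0 : 0 < r1) (r1_lt_r2 : r1 < r2).
Notation leb := (@lebesgue_measure R).
Notation Om := (annulus r1 r2).
Implicit Types (x : R * R).

Let mA : measurable (@angles R : set (measurableTypeR R)).
Proof. exact: measurable_angles. Qed.

Lemma Rintegral_angles_cst (k : R) : \int[leb]_(t in @angles R) k = 2 * pi * k.
Proof.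
rewrite Rintegral_cst; last exact: mA.
have E : leb (@angles R) = (2 * pi)%:E.
  by rewrite lebesgue_measure_itv /= lte_fin mulr_gt0 ?pi_gt0// -EFinB subr0.
by rewrite [X in fine X]E mulrC.
Qed.

Lemma Rintegral_radial (F : R * R -> R) (h H : R -> R) :
  continuous_on_annulus r1 r2 F -> (forall r t, r1 <= r <= r2 -> F (circ r t) = h r) ->
  (forall r, r1 <= r <= r2 -> is_derive r 1 H (h r * r)) ->
  \int[@leb2 R]_(x in Om) F x = 2 * pi * (H r2 - H r1).
Proof.
move=> cF Fh dH; rewrite -Rintegral_angles_cst /Rintegral.
rewrite (integral_annulus_polar r1_gt0); last exact: continuous_on_annulus_integrable.
congr fine; apply: eq_integral => t _.
by apply: (integral_ray r1_gt0 r1_lt_r2) => // r rr; rewrite Fh//; exact: dH.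
Qed.

Lemma is_derive_ln_ratio (r : R) : 0 < r ->
  is_derive r 1 (fun s : R => ln (s * r1^-1)) (r^-1).
Proof.
move=> r0.
have d := is_derive_mulE (is_derive_id r (1 : R)) (is_derive_cst r1^-1 r (1 : R)).
have := is_derive_lnE d; rewrite divr_gt0// => /(_ isT).
by congr is_derive; rewrite /=; field; rewrite !gt_eqF.
Qed.

(** A primitive of (a0 + a1 r^2 + a2 ln (r / r1))^2 r. Normalising the logarithm
at r1 makes the boundary terms at r1 polynomial. *)
Definition log_poly_primitive (a0 a1 a2 r : R) : R :=
  a0 ^+ 2 / 2 * r ^+ 2 + a1 ^+ 2 / 6 * (r ^+ 2 * (r ^+ 2 * r ^+ 2)) +
  a2 ^+ 2 / 2 * (r ^+ 2 * (ln (r * r1^-1) * ln (r * r1^-1) - ln (r * r1^-1) + 1 / 2)) +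
  a0 * a1 / 2 * (r ^+ 2 * r ^+ 2) + a0 * a2 * (r ^+ 2 * (ln (r * r1^-1) - 1 / 2)) +
  a1 * a2 / 2 * (r ^+ 2 * r ^+ 2 * (ln (r * r1^-1) - 1 / 4)).

Lemma is_derive_log_poly_primitive (a0 a1 a2 r : R) : 0 < r ->
  is_derive r 1 (log_poly_primitive a0 a1 a2)
    ((a0 + a1 * r ^+ 2 + a2 * ln (r * r1^-1)) ^+ 2 * r).
Proof.
move=> r0; have dl := is_derive_ln_ratio r0.
have dX := is_derive_sqrE (is_derive_id r (1 : R)).
have k (c : R) := is_derive_cst c r (1 : R).
have dXX := is_derive_mulE dX dX.
have := is_derive_addE (is_derive_addE (is_derive_addE (is_derive_addE (is_derive_addE
  (is_derive_scaleE dX (a0 ^+ 2 / 2))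
  (is_derive_scaleE (is_derive_mulE dX dXX) (a1 ^+ 2 / 6)))
  (is_derive_scaleE (is_derive_mulE dX (is_derive_addE
     (is_derive_subE (is_derive_mulE dl dl) dl) (k (1 / 2)))) (a2 ^+ 2 / 2)))
  (is_derive_scaleE dXX (a0 * a1 / 2)))
  (is_derive_scaleE (is_derive_mulE dX (is_derive_subE dl (k (1 / 2)))) (a0 * a2)))
  (is_derive_scaleE (is_derive_mulE dXX (is_derive_subE dl (k (1 / 4)))) (a1 * a2 / 2)).
by congr is_derive; rewrite /=; field; rewrite gt_eqF.
Qed.

Lemma sqnormH_boundary_state g q beta zd :
  sqnormH r1 r2 (fun x => boundary_state r1 r2 g q beta x - zd) =
  2 * pi * (log_poly_primitive (beta - zd - coef_sqr g / 2 * r1 ^+ 2) (coef_sqr g / 2)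
              (coef_log r2 g q) r2 -
            log_poly_primitive (beta - zd - coef_sqr g / 2 * r1 ^+ 2) (coef_sqr g / 2)
              (coef_log r2 g q) r1).
Proof.
apply: (@Rintegral_radial _ (fun r => (beta - zd - coef_sqr g / 2 * r1 ^+ 2 +
   coef_sqr g / 2 * r ^+ 2 + coef_log r2 g q * ln (r * r1^-1)) ^+ 2)).
- apply: continuous_on_annulusX; apply: continuous_on_annulusB.
    exact: continuous_radial_state.
  exact: continuous_on_annulus_cst.
- move=> r t /andP[r1r _]; have r0 : 0 < r by exact: lt_le_trans r1r.
  congr (_ ^+ 2); rewrite /boundary_state /radial_state sqr_radius_circ.
  rewrite !lnXn// lnM ?posrE ?invr_gt0// lnV ?posrE//.
  by field.
- move=> r /andP[r1r _]; have r0 : 0 < r by exact: lt_le_trans r1r.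
  exact: is_derive_log_poly_primitive.
Qed.

(** The six constants E_i are the coefficients of half the squared distance of
the state to the target, up to the factor pi r1^2, as a quadratic form in
(g r1^2, q r1, b - zd). *)
Definition tracking_form (c : coeffs R) (g q beta : R) : R :=
  E1 c * g ^+ 2 * r1 ^+ 4 + E2 c * q ^+ 2 * r1 ^+ 2 + E3 c * beta ^+ 2 +
  E4 c * g * q * r1 ^+ 3 + E5 c * g * r1 ^+ 2 * beta + E6 c * q * r1 * beta.

(** The primitive evaluated at the two radii is a polynomial identity in r1, r2
and ln (r2 / r1). *)
Lemma tracking_dir g q b zd :
  sqnormH r1 r2 (fun x => state r1 r2 g q b x - zd) =
  2 * pi * r1 ^+ 2 * tracking_form (coeffs_dir r1 r2) g q (b - zd).
Proof.
rewrite sqnormH_state// sqnormH_boundary_state.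
rewrite /log_poly_primitive divff ?gt_eqF// ln1.
rewrite /tracking_form /coeffs_dir /= /coef_sqr /coef_log.
set L := ln _; rewrite -/L.
by field; rewrite gt_eqF.
Qed.

(** As in the Dirichlet case, with b replaced by [robin_value]. *)
Lemma tracking_rob alpha g q b zd : 0 < alpha ->
  sqnormH r1 r2 (fun x => state_alpha r1 r2 alpha g q b x - zd) =
  2 * pi * r1 ^+ 2 * tracking_form (coeffs_rob r1 r2 alpha) g q (b - zd).
Proof.
move=> alpha0; rewrite sqnormH_state_alpha// sqnormH_boundary_state.
rewrite /log_poly_primitive divff ?gt_eqF// ln1.
rewrite /tracking_form /coeffs_rob /= /robin_value /coef_sqr /coef_log.
set L := ln _; rewrite -/L.
by field; rewrite !gt_eqF.
Qed.

Lemma sqnormH_cst (k : R) :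
  sqnormH r1 r2 (fun=> k) = pi * (r2 ^+ 2 - r1 ^+ 2) * k ^+ 2.
Proof.
rewrite /sqnormH; transitivity (2 * pi * (k ^+ 2 / 2 * r2 ^+ 2 - k ^+ 2 / 2 * r1 ^+ 2)).
  apply: (@Rintegral_radial _ (fun=> k ^+ 2) (fun r => k ^+ 2 / 2 * r ^+ 2)).
  - exact: continuous_on_annulus_cst.
  - by [].
  - move=> r _; have := is_derive_scaleE (is_derive_sqrE (is_derive_id r (1 : R))) (k ^+ 2 / 2).
    by congr is_derive; field.
by field.
Qed.

Lemma sqnormC_cst (r k : R) : sqnormC r (fun=> k) = 2 * pi * r * k ^+ 2.
Proof. by rewrite /sqnormC /circle_int Rintegral_angles_cst; ring. Qed.

End costs.

(** * Completing the square *)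

Section optima.
Variable R : realType.
Variables r1 r2 zd : R.
Hypotheses (r1_gt0 : 0 < r1) (r1_lt_r2 : r1 < r2).

Variables (S : R -> R -> R -> R * R -> R) (c : coeffs R).
Hypothesis track : forall g q b zd,
  sqnormH r1 r2 (fun x => S g q b x - zd) =
  2 * pi * r1 ^+ 2 * tracking_form r1 c g q (b - zd).
Hypothesis E3E : E3 c = 1 / 2 * (- 1 + (r2 / r1) ^+ 2).

Let r1n0 : r1 != 0. Proof. by rewrite gt_eqF. Qed.
Let pi0 : 0 < pi :> R. Proof. exact: pi_gt0. Qed.

(** The sign conditions on the constants E_i are not read off their formulas:
the form is a squared L2 norm. *)
Lemma tracking_form_ge0 g q beta : 0 <= tracking_form r1 c g q beta.
Proof.
have : 0 <= sqnormH r1 r2 (fun x => S g q beta x - 0).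
  by apply: Rintegral_ge0 => x _; exact: sqr_ge0.
rewrite track subr0 pmulr_rge0// mulr_gt0 ?exprn_gt0// mulr_gt0//.
Qed.

Lemma E3_gt0 : 0 < E3 c.
Proof.
rewrite E3E mulr_gt0// addrC subr_gt0 expr_gt1 ?divr_ge0 ?(ltW r1_gt0) ?(ltW (lt_trans r1_gt0 r1_lt_r2))//.
by rewrite ltr_pdivlMr// mul1r.
Qed.

Lemma E1_ge0 : 0 <= E1 c.
Proof.
have := tracking_form_ge0 (1 / r1 ^+ 2) 0 0; rewrite /tracking_form.
by congr (0 <= _); field.
Qed.

Lemma E2_ge0 : 0 <= E2 c.
Proof.
have := tracking_form_ge0 0 (1 / r1) 0; rewrite /tracking_form.
by congr (0 <= _); field.
Qed.

(** The restriction of the form to the first two variables is nonnegative. *)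
Lemma discriminant_le0 : E4 c ^+ 2 <= 4 * E1 c * E2 c.
Proof.
have H G Q : 0 <= E1 c * G ^+ 2 + E4 c * (G * Q) + E2 c * Q ^+ 2.
  have := tracking_form_ge0 (G / r1 ^+ 2) (Q / r1) 0; rewrite /tracking_form.
  by congr (0 <= _); field.
have [E10|E10] := eqVneq (E1 c) 0.
  have [->|E40] := eqVneq (E4 c) 0; first by rewrite E10 mulr0 mul0r expr0n.
  (* For E1 = 0 the form is affine in G; this value would make it equal to -1. *)
  have := H (- (E2 c + 1) / E4 c) 1; rewrite E10 mul0r add0r mulr1 mulrCA.
  by rewrite divff// mulr1; lra.
have E1p : 0 < E1 c by rewrite lt_neqAle eq_sym E10 E1_ge0.
have := H (- E4 c) (2 * E1 c) => h.
rewrite -subr_ge0 -(pmulr_rge0 _ E1p); move: h; congr (0 <= _); ring.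
Qed.

(** Each one-variable cost is put in this form; the coefficient of the square is
positive because the penalty is added to a nonnegative E_i. *)
Lemma min_of_square (J : R -> R) (x0 J0 k : R) : 0 < k ->
  (forall x, J x = J0 + k * (x - x0) ^+ 2) -> unique_minimizer J x0 /\ J x0 = J0.
Proof.
move=> k0 JE; split; last by rewrite JE subrr expr0n mulr0 addr0.
move=> y /eqP yx0; rewrite !JE subrr expr0n mulr0 addr0 ltrDl mulr_gt0//.
by rewrite exprn_even_gt0//= subr_eq0.
Qed.

Lemma den1_gt0 M : 0 < M -> 0 < E1 c + E3 c * (M / r1 ^+ 4).
Proof.
move=> M0.
by rewrite ltr_wpDl ?E1_ge0// mulr_gt0 ?E3_gt0// divr_gt0// exprn_gt0.
Qed.

Lemma den2_gt0 M : 0 < M -> 0 < E2 c + M * r2 / r1 ^+ 4.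
Proof.
move=> M0; rewrite ltr_wpDl ?E2_ge0// divr_gt0 ?exprn_gt0// mulr_gt0//.
exact: lt_trans r1_lt_r2.
Qed.

Lemma den3_gt0 M : 0 < M -> 0 < E3 c + M / r1.
Proof. by move=> M0; rewrite addr_gt0 ?E3_gt0// divr_gt0. Qed.

Lemma optimum1 M1 q b : 0 < M1 ->
  unique_minimizer (cost1 S r1 r2 zd M1 q b) (g_op c r1 zd M1 q b) /\
  cost1 S r1 r2 zd M1 q b (g_op c r1 zd M1 q b) = J1_op c r1 zd M1 q b.
Proof.
move=> M0; pose A := E1 c + E3 c * (M1 / r1 ^+ 4).
have A0 : 0 < A by exact: den1_gt0.
apply: (@min_of_square _ _ _ (pi * r1 ^+ 6 * A)).
  by rewrite mulr_gt0// mulr_gt0// exprn_gt0.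
move=> g; rewrite /cost1 track sqnormH_cst// /g_op /J1_op /= /tracking_form -/A.
(* The penalised coefficient is kept as an atom, so that the verification is a
   field identity with the denominators A and r1. *)
have -> : E1 c = A - E3 c * (M1 / r1 ^+ 4) by rewrite /A; ring.
have -> : r2 ^+ 2 = r1 ^+ 2 * (2 * E3 c + 1) by rewrite E3E; field.
clearbody A; field; rewrite r1n0 gt_eqF//.
Qed.

Lemma optimum2 M2 g b : 0 < M2 ->
  unique_minimizer (cost2 S r1 r2 zd M2 g b) (q_op c r1 r2 zd M2 g b) /\
  cost2 S r1 r2 zd M2 g b (q_op c r1 r2 zd M2 g b) = J2_op c r1 r2 zd M2 g b.
Proof.
move=> M0; pose A := E2 c + M2 * r2 / r1 ^+ 4.
have A0 : 0 < A by exact: den2_gt0.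
apply: (@min_of_square _ _ _ (pi * r1 ^+ 4 * A)).
  by rewrite mulr_gt0// mulr_gt0// exprn_gt0.
move=> q; rewrite /cost2 track sqnormC_cst// /q_op /J2_op /= /tracking_form -/A.
have -> : E2 c = A - M2 * r2 / r1 ^+ 4 by rewrite /A; ring.
clearbody A; field; rewrite r1n0 gt_eqF//.
Qed.

Lemma optimum3 M3 g q : 0 < M3 ->
  unique_minimizer (cost3 S r1 r2 zd M3 g q) (b_op c r1 zd M3 g q) /\
  cost3 S r1 r2 zd M3 g q (b_op c r1 zd M3 g q) = J3_op c r1 zd M3 g q.
Proof.
move=> M0; pose A := E3 c + M3 / r1.
have A0 : 0 < A by exact: den3_gt0.
apply: (@min_of_square _ _ _ (pi * r1 ^+ 2 * A)).
  by rewrite mulr_gt0// mulr_gt0// exprn_gt0.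
move=> b; rewrite /cost3 track sqnormC_cst// /b_op /J3_op /= /tracking_form -/A.
have -> : E3 c = A - M3 / r1 by rewrite /A; ring.
clearbody A; field; rewrite r1n0 gt_eqF//.
Qed.

(** The penalties add positive numbers to E1 and E2, which makes the nonpositive
discriminant strictly negative. *)
Lemma den4_gt0 M4 M5 : 0 < M4 -> 0 < M5 -> 0 < den4 c r1 r2 M4 M5.
Proof.
move=> M40 M50; rewrite /den4.
have m4 : 0 < E3 c * (M4 / r1 ^+ 4) by rewrite mulr_gt0 ?E3_gt0// divr_gt0// exprn_gt0.
have m5 : 0 < M5 * r2 / r1 ^+ 4.
  by rewrite divr_gt0 ?exprn_gt0// mulr_gt0// (lt_trans r1_gt0).
have := discriminant_le0; have e1 := E1_ge0; have e2 := E2_ge0.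
set m := E3 c * _ in m4 *; set n := _ / _ in m5 *.
have p1 : 0 <= E1 c * n by rewrite mulr_ge0// ltW.
have p2 : 0 <= m * E2 c by rewrite mulr_ge0// ltW.
have p3 : 0 < m * n by rewrite mulr_gt0.
have -> : 4 * (E1 c + m) * (E2 c + n) - E4 c ^+ 2 =
  (4 * E1 c * E2 c - E4 c ^+ 2) + 4 * (E1 c * n) + 4 * (m * E2 c) + 4 * (m * n) by ring.
lra.
Qed.

(** Completing the square twice, first in g and then in q; the second square has
coefficient [den4] / (4 A) up to the factor pi r1^2, where A is the penalised
coefficient of (g r1^2)^2. *)
Lemma optimum4 M4 M5 b : 0 < M4 -> 0 < M5 ->
  unique_minimizer (cost4 S r1 r2 zd M4 M5 b) (gq_op c r1 r2 zd M4 M5 b) /\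
  cost4 S r1 r2 zd M4 M5 b (gq_op c r1 r2 zd M4 M5 b) = J4_op c r1 r2 zd M4 M5 b.
Proof.
move=> M40 M50; have D0 := den4_gt0 M40 M50.
pose A := E1 c + E3 c * (M4 / r1 ^+ 4).
pose B := E2 c + M5 * r2 / r1 ^+ 4.
have A0 : 0 < A by exact: den1_gt0.
have DE : den4 c r1 r2 M4 M5 = 4 * A * B - E4 c ^+ 2 by [].
have [g0 [q0 gqE]] : exists g0 q0, gq_op c r1 r2 zd M4 M5 b = (g0, q0) by do 2 eexists.
have [g0E q0E] := (f_equal fst gqE, f_equal snd gqE).
rewrite /gq_op /= in g0E q0E.
have JE g q : cost4 S r1 r2 zd M4 M5 b (g, q) = J4_op c r1 r2 zd M4 M5 b +
    pi * r1 ^+ 2 / (4 * A) * ((2 * A * (r1 ^+ 2 * (g - g0)) + E4 c * (r1 * (q - q0))) ^+ 2 +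
      den4 c r1 r2 M4 M5 * (r1 * (q - q0)) ^+ 2).
  rewrite -g0E -q0E /Delta2 /Pi2 /J4_op DE.
  rewrite /cost4 /= track sqnormH_cst// sqnormC_cst /tracking_form -/A -/B.
  have -> : E1 c = A - E3 c * (M4 / r1 ^+ 4) by rewrite /A; ring.
  have -> : E2 c = B - M5 * r2 / r1 ^+ 4 by rewrite /B; ring.
  have -> : r2 ^+ 2 = r1 ^+ 2 * (2 * E3 c + 1) by rewrite E3E; field.
  have Dn0 : 4 * A * B - E4 c ^+ 2 != 0 by rewrite -DE gt_eqF.
  have An0 : A != 0 by rewrite gt_eqF.
  clearbody A B; field.
  by rewrite r1n0 An0 Dn0.
rewrite gqE; split; last by rewrite JE !subrr !mulr0 addr0 expr0n /= mulr0 addr0 mulr0 addr0.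
move=> [g q] gq; rewrite !JE !subrr !mulr0 addr0 expr0n /= mulr0 addr0 mulr0 addr0.
rewrite ltrDl mulr_gt0//.
  by rewrite divr_gt0 ?mulr_gt0// exprn_gt0.
have [qq|qq] := eqVneq q q0; last first.
  rewrite ltr_wpDl ?sqr_ge0// mulr_gt0// exprn_even_gt0//= mulf_eq0 negb_or r1n0/=.
  by rewrite subr_eq0.
rewrite qq subrr !mulr0 addr0 expr0n /= mulr0 addr0 exprn_even_gt0//=.
have gg : g != g0 by apply: contra_notN gq => /eqP ->; rewrite qq.
by rewrite !mulf_neq0// ?expf_neq0// ?subr_eq0// gt_eqF.
Qed.

End optima.

(** * Quantities with a limit at rate O(1/alpha) *)

Section rates.
Variable R : realType.
Implicit Types (f h : R -> R) (l m : R).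

(** Convergence with its rate in a single property, stable under the field
operations, so that one structural argument gives both the limit and the rate of
each optimal quantity. *)
Definition O_inv f l : Prop :=
  exists2 K : R, 0 <= K & \forall a \near +oo, `|f a - l| <= K * a^-1.

Lemma O_inv_cst l : O_inv (fun=> l) l.
Proof.
exists 0 => //; near=> a; rewrite subrr normr0 mul0r//.
Unshelve. all: by end_near. Qed.

Lemma O_inv_near f h l : (forall a, 0 < a -> f a = h a) -> O_inv h l -> O_inv f l.
Proof.
move=> fh [K K0 HK]; exists K => //; near=> a.
have a0 : 0 < a by near: a; exact: nbhs_pinfty_gt.
rewrite fh//; near: a; exact: HK.
Unshelve. all: by end_near. Qed.

Lemma O_inv_add f h l m : O_inv f l -> O_inv h m -> O_inv (fun a => f a + h a) (l + m).
Proof.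
move=> [K K0 HK] [M M0 HM]; exists (K + M); first exact: addr_ge0.
near=> a.
have Ka : `|f a - l| <= K * a^-1 by near: a; exact: HK.
have Ma : `|h a - m| <= M * a^-1 by near: a; exact: HM.
rewrite [X in `|X|](_ : _ = (f a - l) + (h a - m)); last by ring.
by rewrite mulrDl (le_trans (ler_normD _ _))// lerD.
Unshelve. all: by end_near. Qed.

Lemma O_inv_opp f l : O_inv f l -> O_inv (fun a => - f a) (- l).
Proof.
move=> [K K0 HK]; exists K => //; apply: filterS HK => a.
by rewrite -opprD normrN.
Qed.

Lemma O_inv_bounded f l : O_inv f l -> \forall a \near +oo, `|f a - l| <= 1.
Proof.
move=> [K K0 HK]; near=> a.
have Ka : `|f a - l| <= K * a^-1 by near: a; exact: HK.
have aK : K < a by near: a; apply: nbhs_pinfty_gt; exact: num_real.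
have a0 : 0 < a by exact: le_lt_trans aK.
by rewrite (le_trans Ka)// ler_pdivrMr// mul1r ltW.
Unshelve. all: by end_near. Qed.

(** From f h - l m = (f - l) h + l (h - m), with h bounded near infinity. *)
Lemma O_inv_mul f h l m : O_inv f l -> O_inv h m -> O_inv (fun a => f a * h a) (l * m).
Proof.
move=> Of Oh; have h1 := O_inv_bounded Oh.
case: Of => K K0 HK; case: Oh => M M0 HM.
exists (K * (`|m| + 1) + `|l| * M).
  by rewrite addr_ge0// mulr_ge0// addr_ge0.
near=> a.
have Ka : `|f a - l| <= K * a^-1 by near: a; exact: HK.
have Ma : `|h a - m| <= M * a^-1 by near: a; exact: HM.
have ha : `|h a - m| <= 1 by near: a; exact: h1.
have hb : `|h a| <= `|m| + 1.
  rewrite -(subrK m (h a)) (le_trans (ler_normD _ _))// addrC lerD2l//.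
rewrite [X in `|X|](_ : _ = (f a - l) * h a + l * (h a - m)); last by ring.
rewrite (le_trans (ler_normD _ _))// !normrM mulrDl lerD//.
  by rewrite mulrAC ler_pM.
by rewrite -mulrA ler_wpM2l.
Unshelve. all: by end_near. Qed.

Lemma O_inv_exp f l n : O_inv f l -> O_inv (fun a => f a ^+ n) (l ^+ n).
Proof.
move=> Of; elim: n => [|n IH]; first exact: (O_inv_cst 1).
rewrite exprS; have := O_inv_mul Of IH.
by apply: O_inv_near => a _; rewrite exprS.
Qed.

Lemma O_inv_cvg f l : O_inv f l -> f a @[a --> +oo] --> l.
Proof.
move=> [K K0 HK]; apply/cvgrPdist_le => e e0; near=> a.
have Ka : `|f a - l| <= K * a^-1 by near: a; exact: HK.
have aK : K / e < a by near: a; apply: nbhs_pinfty_gt; exact: num_real.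
have a0 : 0 < a by rewrite (le_lt_trans _ aK)// divr_ge0// ltW.
have {}Ka : `|l - f a| <= K * a^-1 by rewrite distrC.
by apply: (le_trans Ka); rewrite ler_pdivrMr// mulrC -ler_pdivrMr// ltW.
Unshelve. all: by end_near. Qed.

(** From 1/f - 1/l = - (f - l) / (f l), where |f| > |l| / 2 near infinity. *)
Lemma O_inv_inv f l : l != 0 -> O_inv f l -> O_inv (fun a => (f a)^-1) l^-1.
Proof.
move=> l0 Of; have /cvgrPdist_lt fl := O_inv_cvg Of.
case: Of => K K0 HK; have ln0 : 0 < `|l| by rewrite normr_gt0.
exists (K * (2 / `|l| ^+ 2)); first by rewrite mulr_ge0// divr_ge0// sqr_ge0.
have hl := fl _ (divr_gt0 ln0 (ltr0Sn _ 1)).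
near=> a.
have Ka : `|f a - l| <= K * a^-1 by near: a; exact: HK.
have fa : `|l| / 2 < `|f a|.
  have : `|l - f a| < `|l| / 2 by near: a; exact: hl.
  by have := ler_normD (l - f a) (f a); rewrite subrK; lra.
have f0 : f a != 0 by rewrite -normr_gt0 (lt_trans _ fa)// divr_gt0.
rewrite [X in `|X|](_ : _ = (f a - l) * (- (f a * l)^-1)); last by field; rewrite f0 l0.
rewrite normrM normrN normfV mulrAC ler_pM//.
rewrite -[leRHS]invrK lef_pV2 ?posrE ?normr_gt0 ?mulf_neq0//; last first.
  by rewrite invr_gt0 divr_gt0// exprn_gt0.
by rewrite invf_div normrM expr2 mulrAC ler_pM2r// ltW.
Unshelve. all: by end_near. Qed.

Lemma O_inv_eqO f l : O_inv f l ->
  (fun a => `|f a - l|) =O_ (at_infty R) (fun a => a^-1).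
Proof.
move=> [K K0 HK]; apply/eqO_exP; exists (K + 1); first by rewrite ltr_wpDl.
near=> a.
have Ka : `|f a - l| <= K * a^-1 by near: a; exact: HK.
have a0 : 0 < a by near: a; exact: nbhs_pinfty_gt.
rewrite normr_id [`|a^-1|]gtr0_norm ?invr_gt0// (le_trans Ka)// ler_pM2r ?invr_gt0//.
by rewrite lerDl.
Unshelve. all: by end_near. Qed.

Lemma O_inv_eps (r : R) : 0 < r -> O_inv (fun a => 1 / (a * r)) 0.
Proof.
move=> r0; exists (r^-1); first by rewrite invr_ge0 ltW.
near=> a; have a0 : 0 < a by near: a; exact: nbhs_pinfty_gt.
by rewrite subr0 mul1r gtr0_norm ?invr_gt0 ?mulr_gt0// invfM mulrC.
Unshelve. all: by end_near. Qed.

(** The Robin constants are polynomials of degree 2 in eps = 1 / (alpha r1), whose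
value at eps = 0 is the Dirichlet constant. *)
Lemma O_inv_quadratic (r p0 p1 p2 : R) f : 0 < r ->
  (forall a, 0 < a -> f a = p0 + p1 * (1 / (a * r)) + p2 * (1 / (a * r)) ^+ 2) ->
  O_inv f p0.
Proof.
move=> r0 fE; have e := O_inv_eps r0; apply: (O_inv_near fE).
have := O_inv_add (O_inv_add (O_inv_cst p0) (O_inv_mul (O_inv_cst p1) e))
  (O_inv_mul (O_inv_cst p2) (O_inv_exp 2 e)).
by rewrite expr0n /= !mulr0 !addr0.
Qed.

End rates.

Section coeffs_rate.
Variable R : realType.
Variables r1 r2 : R.
Hypotheses (r1_gt0 : 0 < r1).
Let E := coeffs_dir r1 r2.
Let Ea a := coeffs_rob r1 r2 a.
Let rho := r2 / r1.
Let L := ln (r2 / r1).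

Lemma O_inv_E1 : O_inv (fun a => E1 (Ea a)) (E1 E).
Proof.
apply: (@O_inv_quadratic _ r1 _
  (1 / 8 * (1 / 2 - 5 / 2 * rho ^+ 2 + rho ^+ 4 * (7 / 2 - 2 * L) + rho ^+ 6 * (2 * L - 3 / 2)))
  (1 / 8 * (- 1 + 3 * rho ^+ 2 - 3 * rho ^+ 4 + rho ^+ 6)) _ r1_gt0) => a _.
rewrite /Ea /E /= /L /rho; set e := 1 / (a * r1); set l := ln _; set p := r2 / r1.
by field.
Qed.

Lemma O_inv_E2 : O_inv (fun a => E2 (Ea a)) (E2 E).
Proof.
apply: (@O_inv_quadratic _ r1 _
  (1 / 4 * (2 * rho ^+ 2 + rho ^+ 4 * (4 * L - 2)))
  (1 / 4 * (- 2 * rho ^+ 2 + 2 * rho ^+ 4)) _ r1_gt0) => a _.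
rewrite /Ea /E /= /L /rho; set e := 1 / (a * r1); set l := ln _; set p := r2 / r1.
by field.
Qed.

Lemma O_inv_E3 : O_inv (fun a => E3 (Ea a)) (E3 E).
Proof. exact: O_inv_cst. Qed.

Lemma O_inv_E4 : O_inv (fun a => E4 (Ea a)) (E4 E).
Proof.
apply: (@O_inv_quadratic _ r1 _
  (1 / 4 * (3 / 2 * rho + rho ^+ 3 * (2 * L - 4) + rho ^+ 5 * (- 4 * L + 5 / 2)))
  (1 / 4 * (- 2 * rho + 4 * rho ^+ 3 - 2 * rho ^+ 5)) _ r1_gt0) => a _.
rewrite /Ea /E /= /L /rho; set e := 1 / (a * r1); set l := ln _; set p := r2 / r1.
by field.
Qed.

Lemma O_inv_E5 : O_inv (fun a => E5 (Ea a)) (E5 E).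
Proof.
apply: (@O_inv_quadratic _ r1 _ (1 / 2 * (1 - 2 * rho ^+ 2 + rho ^+ 4)) 0 _ r1_gt0) => a _.
rewrite /Ea /E /= /L /rho; set e := 1 / (a * r1); set l := ln _; set p := r2 / r1.
by field.
Qed.

Lemma O_inv_E6 : O_inv (fun a => E6 (Ea a)) (E6 E).
Proof.
apply: (@O_inv_quadratic _ r1 _ (rho - rho ^+ 3) 0 _ r1_gt0) => a _.
rewrite /Ea /E /= /L /rho; set e := 1 / (a * r1); set l := ln _; set p := r2 / r1.
by field.
Qed.

End coeffs_rate.

(** * Optimal controls and values *)

Section optima_rate.
Variable R : realType.
Variables (r1 r2 zd : R) (c : R -> coeffs R) (c0 : coeffs R).
Hypotheses (h1 : O_inv (fun a => E1 (c a)) (E1 c0))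
  (h2 : O_inv (fun a => E2 (c a)) (E2 c0)) (h3 : O_inv (fun a => E3 (c a)) (E3 c0))
  (h4 : O_inv (fun a => E4 (c a)) (E4 c0)) (h5 : O_inv (fun a => E5 (c a)) (E5 c0))
  (h6 : O_inv (fun a => E6 (c a)) (E6 c0)).

Ltac O_inv_tac := repeat first
  [ eassumption
  | apply: O_inv_cst
  | apply: O_inv_add
  | apply: O_inv_opp
  | apply: O_inv_mul
  | apply: O_inv_exp
  | apply: O_inv_inv; [assumption|] ].

(** Only the nonvanishing of the limit denominators is needed: the formulas are
otherwise built from the constants E_i by field operations. *)
Lemma O_inv_optimum1 M1 q b :
  2 * r1 ^+ 2 * (E1 c0 + E3 c0 * (M1 / r1 ^+ 4)) != 0 ->
  4 * (E1 c0 + E3 c0 * (M1 / r1 ^+ 4)) != 0 ->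
  O_inv (fun a => g_op (c a) r1 zd M1 q b) (g_op c0 r1 zd M1 q b) /\
  O_inv (fun a => J1_op (c a) r1 zd M1 q b) (J1_op c0 r1 zd M1 q b).
Proof. by move=> d1 d2; split; rewrite /g_op /J1_op /=; O_inv_tac. Qed.

Lemma O_inv_optimum2 M2 g b :
  2 * r1 * (E2 c0 + M2 * r2 / r1 ^+ 4) != 0 ->
  4 * (E2 c0 + M2 * r2 / r1 ^+ 4) != 0 ->
  O_inv (fun a => q_op (c a) r1 r2 zd M2 g b) (q_op c0 r1 r2 zd M2 g b) /\
  O_inv (fun a => J2_op (c a) r1 r2 zd M2 g b) (J2_op c0 r1 r2 zd M2 g b).
Proof. by move=> d1 d2; split; rewrite /q_op /J2_op /=; O_inv_tac. Qed.

Lemma O_inv_optimum3 M3 g q :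
  2 * (E3 c0 + M3 / r1) != 0 -> 4 * (E3 c0 + M3 / r1) != 0 ->
  O_inv (fun a => b_op (c a) r1 zd M3 g q) (b_op c0 r1 zd M3 g q) /\
  O_inv (fun a => J3_op (c a) r1 zd M3 g q) (J3_op c0 r1 zd M3 g q).
Proof. by move=> d1 d2; split; rewrite /b_op /J3_op /=; O_inv_tac. Qed.

Lemma O_inv_optimum4 M4 M5 b : den4 c0 r1 r2 M4 M5 != 0 ->
  [/\ O_inv (fun a => (gq_op (c a) r1 r2 zd M4 M5 b).1) (gq_op c0 r1 r2 zd M4 M5 b).1,
      O_inv (fun a => (gq_op (c a) r1 r2 zd M4 M5 b).2) (gq_op c0 r1 r2 zd M4 M5 b).2 &
      O_inv (fun a => J4_op (c a) r1 r2 zd M4 M5 b) (J4_op c0 r1 r2 zd M4 M5 b)].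
Proof.
move=> d; have hd : O_inv (fun a => den4 (c a) r1 r2 M4 M5) (den4 c0 r1 r2 M4 M5).
  by rewrite /den4 /=; O_inv_tac.
by split; rewrite /gq_op /J4_op /Delta2 /Pi2 /=; O_inv_tac.
Qed.

End optima_rate.

Theorem theorem3p5 (R : realType) (r1 r2 zd M1 M2 M3 M4 M5 g q b : R)
    (r1_gt0 : 0 < r1) (r1_lt_r2 : r1 < r2)
    (M1_gt0 : 0 < M1) (M2_gt0 : 0 < M2) (M3_gt0 : 0 < M3)
    (M4_gt0 : 0 < M4) (M5_gt0 : 0 < M5) :
  let S := state r1 r2 in
  let Sa := state_alpha r1 r2 in
  let J1 := cost1 S r1 r2 zd M1 q b in
  let J1a a := cost1 (Sa a) r1 r2 zd M1 q b in
  let J2 := cost2 S r1 r2 zd M2 g b in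
  let J2a a := cost2 (Sa a) r1 r2 zd M2 g b in
  let J3 := cost3 S r1 r2 zd M3 g q in
  let J3a a := cost3 (Sa a) r1 r2 zd M3 g q in
  let J4 := cost4 S r1 r2 zd M4 M5 b in
  let J4a a := cost4 (Sa a) r1 r2 zd M4 M5 b in
  let E := coeffs_dir r1 r2 in
  let Ea := coeffs_rob r1 r2 in
  let gop := g_op E r1 zd M1 q b in
  let gopa a := g_op (Ea a) r1 zd M1 q b in
  let qop := q_op E r1 r2 zd M2 g b in
  let qopa a := q_op (Ea a) r1 r2 zd M2 g b in
  let bop := b_op E r1 zd M3 g q in
  let bopa a := b_op (Ea a) r1 zd M3 g q in
  let gqop := gq_op E r1 r2 zd M4 M5 b in
  let gqopa a := gq_op (Ea a) r1 r2 zd M4 M5 b in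
  (* i *)
  [/\ [/\ unique_minimizer J1 gop,
          J1 gop = J1_op E r1 zd M1 q b &
          forall a, 0 < a ->
            unique_minimizer (J1a a) (gopa a) /\
            J1a a (gopa a) = J1_op (Ea a) r1 zd M1 q b],
  (* ii *)
      [/\ unique_minimizer J2 qop,
          J2 qop = J2_op E r1 r2 zd M2 g b &
          forall a, 0 < a ->
            unique_minimizer (J2a a) (qopa a) /\
            J2a a (qopa a) = J2_op (Ea a) r1 r2 zd M2 g b],
  (* iii *)
      [/\ unique_minimizer J3 bop,
          J3 bop = J3_op E r1 zd M3 g q &
          forall a, 0 < a ->
            unique_minimizer (J3a a) (bopa a) /\
            J3a a (bopa a) = J3_op (Ea a) r1 zd M3 g q],
  (* iv *)
      [/\ unique_minimizer J4 gqop,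
          J4 gqop = J4_op E r1 r2 zd M4 M5 b &
          forall a, 0 < a ->
            unique_minimizer (J4a a) (gqopa a) /\
            J4a a (gqopa a) = J4_op (Ea a) r1 r2 zd M4 M5 b] &
  (* v *)
      [/\ [/\ gopa a @[a --> +oo] --> gop,
              qopa a @[a --> +oo] --> qop,
              bopa a @[a --> +oo] --> bop &
              gqopa a @[a --> +oo] --> gqop],
          [/\ (fun a => `|gopa a - gop|) =O_ (at_infty R) (fun a => a^-1),
              (fun a => `|qopa a - qop|) =O_ (at_infty R) (fun a => a^-1),
              (fun a => `|bopa a - bop|) =O_ (at_infty R) (fun a => a^-1),
              (fun a => `|(gqopa a).1 - gqop.1|) =O_ (at_infty R) (fun a => a^-1) &
              (fun a => `|(gqopa a).2 - gqop.2|) =O_ (at_infty R) (fun a => a^-1)],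
          [/\ J1a a (gopa a) @[a --> +oo] --> J1 gop,
              J2a a (qopa a) @[a --> +oo] --> J2 qop,
              J3a a (bopa a) @[a --> +oo] --> J3 bop &
              J4a a (gqopa a) @[a --> +oo] --> J4 gqop] &
          [/\ (fun a => `|J1a a (gopa a) - J1 gop|) =O_ (at_infty R) (fun a => a^-1),
              (fun a => `|J2a a (qopa a) - J2 qop|) =O_ (at_infty R) (fun a => a^-1),
              (fun a => `|J3a a (bopa a) - J3 bop|) =O_ (at_infty R) (fun a => a^-1) &
              (fun a => `|J4a a (gqopa a) - J4 gqop|) =O_ (at_infty R) (fun a => a^-1)]]].
Proof.
move=> S Sa J1 J1a J2 J2a J3 J3a J4 J4a E Ea gop gopa qop qopa bop bopa gqop gqopa.
have tE : forall g q b zd, sqnormH r1 r2 (fun x => S g q b x - zd) =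
    2 * pi * r1 ^+ 2 * tracking_form r1 E g q (b - zd).
  by move=> *; exact: tracking_dir.
have tEa a : 0 < a -> forall g q b zd,
    sqnormH r1 r2 (fun x => Sa a g q b x - zd) =
    2 * pi * r1 ^+ 2 * tracking_form r1 (Ea a) g q (b - zd).
  by move=> a0 *; exact: tracking_rob.
have e3 : E3 E = 1 / 2 * (- 1 + (r2 / r1) ^+ 2) by [].
have e3a a : E3 (Ea a) = 1 / 2 * (- 1 + (r2 / r1) ^+ 2) by [].
have o1 : unique_minimizer J1 gop /\ J1 gop = J1_op E r1 zd M1 q b.
  exact: (optimum1 zd r1_gt0 r1_lt_r2 tE e3 q b M1_gt0).
have o2 : unique_minimizer J2 qop /\ J2 qop = J2_op E r1 r2 zd M2 g b.
  exact: (optimum2 zd r1_gt0 r1_lt_r2 tE g b M2_gt0).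
have o3 : unique_minimizer J3 bop /\ J3 bop = J3_op E r1 zd M3 g q.
  exact: (optimum3 zd r1_gt0 r1_lt_r2 tE e3 g q M3_gt0).
have o4 : unique_minimizer J4 gqop /\ J4 gqop = J4_op E r1 r2 zd M4 M5 b.
  exact: (optimum4 zd r1_gt0 r1_lt_r2 tE e3 b M4_gt0 M5_gt0).
have o1a a : 0 < a -> unique_minimizer (J1a a) (gopa a) /\
    J1a a (gopa a) = J1_op (Ea a) r1 zd M1 q b.
  by move=> a0; exact: (optimum1 zd r1_gt0 r1_lt_r2 (tEa a a0) (e3a a) q b M1_gt0).
have o2a a : 0 < a -> unique_minimizer (J2a a) (qopa a) /\
    J2a a (qopa a) = J2_op (Ea a) r1 r2 zd M2 g b.
  by move=> a0; exact: (optimum2 zd r1_gt0 r1_lt_r2 (tEa a a0) g b M2_gt0).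
have o3a a : 0 < a -> unique_minimizer (J3a a) (bopa a) /\
    J3a a (bopa a) = J3_op (Ea a) r1 zd M3 g q.
  by move=> a0; exact: (optimum3 zd r1_gt0 r1_lt_r2 (tEa a a0) (e3a a) g q M3_gt0).
have o4a a : 0 < a -> unique_minimizer (J4a a) (gqopa a) /\
    J4a a (gqopa a) = J4_op (Ea a) r1 r2 zd M4 M5 b.
  by move=> a0; exact: (optimum4 zd r1_gt0 r1_lt_r2 (tEa a a0) (e3a a) b M4_gt0 M5_gt0).
have d1 : 0 < E1 E + E3 E * (M1 / r1 ^+ 4) by exact: (den1_gt0 r1_gt0 r1_lt_r2 tE e3).
have d2 : 0 < E2 E + M2 * r2 / r1 ^+ 4 by exact: (den2_gt0 r1_gt0 r1_lt_r2 tE).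
have d3 : 0 < E3 E + M3 / r1 by exact: (den3_gt0 r1_gt0 r1_lt_r2 e3).
have d4 : 0 < den4 E r1 r2 M4 M5 by exact: (den4_gt0 r1_gt0 r1_lt_r2 tE e3).
have h1 := O_inv_E1 r2 r1_gt0; have h2 := O_inv_E2 r2 r1_gt0; have h3 := O_inv_E3 r1 r2.
have h4 := O_inv_E4 r2 r1_gt0; have h5 := O_inv_E5 r2 r1_gt0; have h6 := O_inv_E6 r2 r1_gt0.
have [rg rJ1] : O_inv gopa gop /\
    O_inv (fun a => J1_op (Ea a) r1 zd M1 q b) (J1_op E r1 zd M1 q b).
  by apply: O_inv_optimum1 => //; rewrite gt_eqF// !mulr_gt0// exprn_gt0.
have [rq rJ2] : O_inv qopa qop /\
    O_inv (fun a => J2_op (Ea a) r1 r2 zd M2 g b) (J2_op E r1 r2 zd M2 g b).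
  by apply: O_inv_optimum2 => //; rewrite gt_eqF// !mulr_gt0// exprn_gt0.
have [rb rJ3] : O_inv bopa bop /\
    O_inv (fun a => J3_op (Ea a) r1 zd M3 g q) (J3_op E r1 zd M3 g q).
  by apply: O_inv_optimum3 => //; rewrite gt_eqF// !mulr_gt0// exprn_gt0.
have [rg4 rq4 rJ4] : [/\ O_inv (fun a => (gqopa a).1) gqop.1,
    O_inv (fun a => (gqopa a).2) gqop.2 &
    O_inv (fun a => J4_op (Ea a) r1 r2 zd M4 M5 b) (J4_op E r1 r2 zd M4 M5 b)].
  by apply: O_inv_optimum4 => //; rewrite gt_eqF.
have {}rJ1 : O_inv (fun a => J1a a (gopa a)) (J1 gop).
  by rewrite o1.2; apply: O_inv_near rJ1 => a /o1a[].
have {}rJ2 : O_inv (fun a => J2a a (qopa a)) (J2 qop).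
  by rewrite o2.2; apply: O_inv_near rJ2 => a /o2a[].
have {}rJ3 : O_inv (fun a => J3a a (bopa a)) (J3 bop).
  by rewrite o3.2; apply: O_inv_near rJ3 => a /o3a[].
have {}rJ4 : O_inv (fun a => J4a a (gqopa a)) (J4 gqop).
  by rewrite o4.2; apply: O_inv_near rJ4 => a /o4a[].
split; [by case: o1|by case: o2|by case: o3|by case: o4|].
split.
- split; [exact: O_inv_cvg rg|exact: O_inv_cvg rq|exact: O_inv_cvg rb|].
  exact: (cvg_pair (O_inv_cvg rg4) (O_inv_cvg rq4)).
- split; [exact: O_inv_eqO rg|exact: O_inv_eqO rq|exact: O_inv_eqO rb| |].
    exact: O_inv_eqO rg4.
  exact: O_inv_eqO rq4.
- by split; exact: O_inv_cvg.
- split; [exact: O_inv_eqO rJ1|exact: O_inv_eqO rJ2|exact: O_inv_eqO rJ3|].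
  exact: O_inv_eqO rJ4.
Qed.
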